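(* Let $\mathcal{O}$ be the ring of integers of a number field $K$, with Dedekind zeta function $\zeta_K(s)$. For all $m,n\in\mathbb{N}$, $$\zeta_{\mathbf{G}_{m,n}(\mathcal{O})}(s)=\frac{\zeta_K(s\,e(m,n)-n)}{\zeta_K(s\,e(m,n))}.$$
   Context: $\mathbb{N}=\{1,2,\dots\}$, $\mathbb{N}_0=\mathbb{N}\cup\{0\}$; $e(m,n)=\binom{n+m-2}{n-1}$. The Lie ring $L_{m,n}$: put $\mathbf{E}=\{\mathbf{e}\in\mathbb{N}_0^n \mid e_1+\dots+e_n=m-1\}$ and $\mathbf{F}=\{\mathbf{f}\in\mathbb{N}_0^n\mid f_1+\dots+f_n=m\}$. $L_{m,n}$ is the class-2-nilpotent Lie ring which is free as a $\mathbb{Z}$-module on the elements $x_{\mathbf{e}}$ ($\mathbf{e}\in\mathbf{E}$), $y_{\mathbf{f}}$ ($\mathbf{f}\in\mathbf{F}$), $z_1,\dots,z_n$, with $[x_{\mathbf{e}},y_{\mathbf{f}}]=-[y_{\mathbf f},x_{\mathbf e}]=z_i$ if $\mathbf{f}-\mathbf{e}$ is the $i$-th standard basis vector of $\mathbb{Z}^n$, $[x_{\mathbf{e}},y_{\mathbf{f}}]=0$ if $\mathbf{f}-\mathbf{e}$ is not a standard basis vector, and all other brackets of basis elements equal to $0$. $\mathbf{G}_{m,n}$ is the unipotent group scheme (of nilpotency class 2) over $\mathbb{Z}$ associated to $L_{m,n}$. Concretely, for a commutative ring $R$, $\mathbf{G}_{m,n}(R)$ is (isomorphic to) the group with underlying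 set $R^{\mathbf{E}}\times R^{\mathbf{F}}\times R^n$ and multiplication $$(a,b,c)\cdot(a',b',c')=(a+a',\,b+b',\,c''),\qquad c''_i=c_i+c'_i+\sum_{\mathbf{e}\in\mathbf{E},\,\mathbf{f}\in\mathbf{F},\ \mathbf{f}-\mathbf{e}=\varepsilon_i}a_{\mathbf{e}}\,b'_{\mathbf{f}},$$ where $\varepsilon_i$ is the $i$-th standard basis vector of $\mathbb{Z}^n$; so group commutators reproduce the Lie brackets of $L_{m,n}\otimes_{\mathbb{Z}} R$. Representation zeta function: for a finitely generated torsion-free nilpotent group $G$, two irreducible complex representations $\rho,\rho'$ are twist-isoclass equivalent if $\rho'\cong\chi\otimes\rho$ for a one-dimensional complex representation $\chi$ of $G$. Let $\widetilde{r}_k(G)$ be the (finite) number of twist-isoclasses of irreducible complex $k$-dimensional representations of $G$. Then $\zeta_G(s)=\sum_{k=1}^{\infty}\widetilde{r}_k(G)k^{-s}$. *)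

(* Defs.v *)
From HB Require Import structures.
From mathcomp Require Import all_boot all_order all_algebra all_field.
From mathcomp Require Import finmap complex.
From mathcomp Require Import all_classical all_reals all_analysis.

Set Implicit Arguments.
Unset Strict Implicit.
Unset Printing Implicit Defensive.

Import Order.TTheory GRing.Theory Num.Theory.
Import numFieldNormedType.Exports.

Local Open Scope classical_set_scope.
Local Open Scope ring_scope.

(* Equal to 0 when A is infinite. *)
Definition nb_elements (T : choiceType) (A : set T) : nat := #|` fset_set A |%fset.

Section DirichletSeries.
Variable R : realType.

(* k ^ (- s) = exp (- s * ln k), for k >= 1 *)
Definition npowN (k : nat) (s : R[i]) : R[i] :=
  let t := ln (k%:R : R) in
  Complex (expR (- (complex.Re s * t)) * cos (complex.Im s * t))
          (- (expR (- (complex.Re s * t)) * sin (complex.Im s * t))).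

(* Partial sums of \sum_(k >= 1) a k * k ^ (- s); the regular module R[i]^o is
   the copy of R[i] that carries the topology of the complex norm. *)
Definition dirichlet_partial (a : nat -> nat) (s : R[i]) : nat -> R[i]^o :=
  [series ((a k.+1)%:R * npowN k.+1 s : R[i]^o)]_k.

Definition dirichlet_series (a : nat -> nat) (s : R[i]) : R[i] :=
  limn (dirichlet_partial a s).

End DirichletSeries.

Section RingOfIntegers.
Variable K : fieldExtType rat.

Definition integralZ : {pred K} :=
  fun x => `[< integralOver (intr : int -> K) x >].

Fact integralZ_subring_closed : subring_closed integralZ.
Proof.
split=> [|x y /asboolP xZ /asboolP yZ|x y /asboolP xZ /asboolP yZ].
- exact/asboolP/integral1.
- exact/asboolP/integral_sub.
- exact/asboolP/integral_mul.
Qed.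

HB.instance Definition _ :=
  GRing.isSubringClosed.Build K integralZ integralZ_subring_closed.

Definition ring_of_integers := {x : K | x \in integralZ}.

HB.instance Definition _ := SubChoice.on ring_of_integers.
HB.instance Definition _ :=
  [SubChoice_isSubComNzRing of ring_of_integers by <:].

End RingOfIntegers.

Section DedekindZeta.

Definition is_ideal (A : comNzRingType) (I : set A) : Prop :=
  [/\ I 0, (forall x y, I x -> I y -> I (x + y))
     & (forall a x, I x -> I (a * x))].

Definition ideal_norm (A : comNzRingType) (I : set A) : nat :=
  nb_elements [set [set x + y | y in I] | x in [set: A]].

Definition nb_ideals (A : comNzRingType) (k : nat) : nat :=
  nb_elements [set I : set A |
    [/\ is_ideal I, I != [set 0] & ideal_norm I = k]].

(* \sum_(I != 0) N(I) ^ (- s), with the ideals grouped by norm *)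
Definition dedekind_zeta (R : realType) (K : fieldExtType rat) (s : R[i]) :
  R[i] := dirichlet_series (nb_ideals (ring_of_integers K)) s.

End DedekindZeta.

Section RepresentationZeta.
Variables (R : realType) (G : groupType).

Definition is_repr (k : nat) (rho : G -> 'M[R[i]]_k) : Prop :=
  rho 1%g = 1%:M /\ forall g h, rho (g * h)%g = rho g *m rho h.

(* As in mxrepresentation, matrices act on row vectors and U stands for its
   row space. *)
Definition is_irr_repr (k : nat) (rho : G -> 'M[R[i]]_k) : Prop :=
  [/\ is_repr rho, (0 < k)%N
    & forall U : 'M[R[i]]_k,
        (forall g, stablemx U (rho g)) -> U != 0 -> row_full U].

Definition repr_iso (k : nat) (rho rho' : G -> 'M[R[i]]_k) : Prop :=
  exists2 B : 'M[R[i]]_k, B \in unitmx & forall g, rho' g *m B = B *m rho g.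

(* chi \otimes rho, for chi of dimension 1 *)
Definition repr_twist (k : nat) (chi : G -> 'M[R[i]]_1)
    (rho : G -> 'M[R[i]]_k) : G -> 'M[R[i]]_k :=
  fun g => chi g 0 0 *: rho g.

Definition twist_iso (k : nat) (rho rho' : G -> 'M[R[i]]_k) : Prop :=
  exists2 chi : G -> 'M[R[i]]_1,
    is_repr chi & repr_iso rho' (repr_twist chi rho).

Definition twist_isoclass (k : nat) (rho : G -> 'M[R[i]]_k) :
    set (G -> 'M[R[i]]_k) :=
  [set rho' | is_irr_repr rho' /\ twist_iso rho rho'].

Definition twist_isoclasses (k : nat) : set (set (G -> 'M[R[i]]_k)) :=
  [set twist_isoclass rho | rho in [set rho | is_irr_repr rho]].
Arguments twist_isoclasses : clear implicits.

Definition nb_twist_isoclasses (k : nat) : nat :=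
  nb_elements (twist_isoclasses k).

Definition repr_zeta (s : R[i]) : R[i] :=
  dirichlet_series nb_twist_isoclasses s.

End RepresentationZeta.
Arguments twist_isoclasses : clear implicits.
Arguments nb_twist_isoclasses : clear implicits.

Definition e_mn (m n : nat) : nat := 'C(n + m - 2, n.-1).

(* Vectors v in N_0^n with v_1 + ... + v_n = d; the bound v_i <= d, which the
   sum forces, makes this a finType. *)
Definition compositions (n d : nat) : Type :=
  {v : {ffun 'I_n -> 'I_d.+1} | (\sum_i v i == d)%N}.
HB.instance Definition _ n d := Finite.on (compositions n d).

Notation Eset m n := (compositions n m.-1).
Notation Fset m n := (compositions n m).

(* f - e is the i-th standard basis vector *)
Definition diff_basis (m n : nat) (e : Eset m n) (f : Fset m n) (i : 'I_n) :=
  [forall j, val f j == val e j + (j == i) :> nat]%N.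

Section GroupScheme.
Variables (m n : nat) (A : comNzRingType).

Definition Gmn : Type :=
  ({ffun Eset m n -> A} * {ffun Fset m n -> A} * {ffun 'I_n -> A})%type.

HB.instance Definition _ := Choice.on Gmn.

Definition Gmn_form (a : {ffun Eset m n -> A}) (b : {ffun Fset m n -> A}) :
    {ffun 'I_n -> A} :=
  [ffun i => \sum_(e : Eset m n) \sum_(f : Fset m n | diff_basis e f i)
     a e * b f].

Definition Gmn_mul (x y : Gmn) : Gmn :=
  let: (a, b, c) := x in let: (a', b', c') := y in
  (a + a', b + b', c + c' + Gmn_form a b').

Definition Gmn_one : Gmn := (0, 0, 0).

Definition Gmn_inv (x : Gmn) : Gmn :=
  let: (a, b, c) := x in (- a, - b, - c + Gmn_form a b).

Let formDl a a' b : Gmn_form (a + a') b = Gmn_form a b + Gmn_form a' b.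
Proof.
apply/ffunP=> i; rewrite !ffunE -big_split; apply: eq_bigr => e _ /=.
by rewrite -big_split; apply: eq_bigr => f _; rewrite ffunE mulrDl.
Qed.

Let formDr a b b' : Gmn_form a (b + b') = Gmn_form a b + Gmn_form a b'.
Proof.
apply/ffunP=> i; rewrite !ffunE -big_split; apply: eq_bigr => e _ /=.
by rewrite -big_split; apply: eq_bigr => f _; rewrite ffunE mulrDr.
Qed.

Let form0l b : Gmn_form 0 b = 0.
Proof. by apply: (addrI (Gmn_form 0 b)); rewrite -formDl !addr0. Qed.

Let form0r a : Gmn_form a 0 = 0.
Proof. by apply: (addrI (Gmn_form a 0)); rewrite -formDr !addr0. Qed.

Let formNl a b : Gmn_form (- a) b = - Gmn_form a b.
Proof. by apply: (addrI (Gmn_form a b)); rewrite -formDl !subrr form0l. Qed.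

Let formNr a b : Gmn_form a (- b) = - Gmn_form a b.
Proof. by apply: (addrI (Gmn_form a b)); rewrite -formDr !subrr form0r. Qed.

Fact Gmn_mulA : associative Gmn_mul.
Proof.
move=> [[a b] c] [[a' b'] c'] [[a2 b2] c2] /=; congr (_, _, _).
- exact: addrA.
- exact: addrA.
- by rewrite formDl formDr !addrA [LHS](ACl (1*2*5*3*6*4))%AC.
Qed.

Fact Gmn_mul1g : left_id Gmn_one Gmn_mul.
Proof. by move=> [[a b] c] /=; rewrite !add0r form0l addr0. Qed.

Fact Gmn_mulg1 : right_id Gmn_one Gmn_mul.
Proof. by move=> [[a b] c] /=; rewrite !addr0 form0r addr0. Qed.

Fact Gmn_mulVg : left_inverse Gmn_one Gmn_inv Gmn_mul.
Proof.
move=> [[a b] c] /=; rewrite !addNr formNl addrAC addrK addNr //.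
Qed.

Fact Gmn_mulgV : right_inverse Gmn_one Gmn_inv Gmn_mul.
Proof.
by move=> [[a b] c] /=; rewrite !subrr formNr addrA addrN add0r subrr.
Qed.

HB.instance Definition _ := isGroup.Build Gmn
  Gmn_mulA Gmn_mul1g Gmn_mulg1 Gmn_mulVg Gmn_mulgV.

End GroupScheme.

(* Main.v *)
Require Import Defs.
From mathcomp Require Import all_boot all_order all_algebra all_field.
From mathcomp Require Import finmap complex.
From mathcomp Require Import all_classical all_reals all_analysis.
From mathcomp Require Import zify ring lra.
Import numFieldNormedType.Exports.

(** Write [A] for the ring of integers. The centre of the group is [A ^ n] and
    consists of commutators. By Schur's lemma an irreducible representation
    [rho] of dimension [k] has a central character [psi], which is invariant
    under twisting, and taking determinants of commutators shows that [psi ^ k]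
    is trivial; so the ideal [I] of the [x] in [A] that annihilate [psi] is not
    zero ([central_char_exists]).

    Conversely [psi] determines [rho] up to twist. The commutator form of the
    group pairs [A ^ E] with [A ^ F], and composed with [psi] it has a radical
    in [A ^ E]. Common eigenvectors of the two abelian subgroups [A ^ E] and
    [A ^ F] provide the twist that turns [rho] into a standard representation
    on the functions on the quotient of [A ^ E] by the radical
    ([irr_std_repr]). If the points of [A ^ E] are seen as polynomials of degree
    [m - 1] and [psi] as a linear form, the radical consists of the polynomials
    whose product with the form vanishes, and by Gauss's lemma these are the
    polynomials with coefficients in [I] ([ann_radical]). Hence
    [k = N(I) ^ e(m, n)], and the twist isoclasses of dimension [k] correspond
    to the torsion characters [psi] of [A ^ n] with [N(I) ^ e(m, n) = k]
    ([twist_isoclassesE]).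

    It remains to sum [N(I) ^ (- w)] over all torsion characters, where
    [w = s e(m, n)]. The characters annihilated by a given ideal [I] are those
    of the finite group [(A / I) ^ n], and there are [N(I) ^ n] of them
    ([count_characters]). As to contain an ideal is to divide it, multiplying
    the sum by [zeta_K(w)] gives the sum of [N(I) ^ n N(I) ^ (- w)] over all
    ideals [I], that is, [zeta_K(w - n)] ([pairs_convolution],
    [torsion_zeta]).

    The arithmetic needed is the invertibility of nonzero ideals and the
    multiplicativity of the norm. Both rest on integral closedness and on the
    finiteness of the quotients by nonzero ideals, which follow from the fact
    that [A] is finitely generated as a group; the latter is seen by means of
    the trace form. Convergence of the zeta function to the right of 1, and the
    fact that it does not vanish there, are obtained by sieving the ideals by
    maximal ideals, one at a time ([sifted_sum_cons]): a maximal ideal [P]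
    contributes the factor [1 - N(P) ^ (- w)]. *)

Set Implicit Arguments.
Unset Strict Implicit.
Unset Printing Implicit Defensive.

Import Order.TTheory GRing.Theory Num.Theory.

Local Open Scope classical_set_scope.
Local Open Scope ring_scope.

(** * Subgroups of finitely generated abelian groups *)

Section Lattices.
Variable V : zmodType.

Definition subgroup (H : set V) := H 0 /\ forall x y, H x -> H y -> H (x - y).

Definition zspan d (w : 'I_d -> V) : set V :=
  [set x | exists c : 'I_d -> int, x = \sum_i w i *~ c i].

Lemma subgroupN H x : subgroup H -> H x -> H (- x).
Proof. by move=> [H0 HB] Hx; rewrite -sub0r; exact: HB. Qed.

Lemma subgroupD H x y : subgroup H -> H x -> H y -> H (x + y).
Proof. by move=> sH Hx Hy; rewrite -(opprK y); apply: sH.2 => //; exact: subgroupN. Qed.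

Lemma subgroupMz H x c : subgroup H -> H x -> H (x *~ c).
Proof.
move=> sH Hx; have Hn (k : nat) : H (x *+ k).
  by elim: k => [|k IH]; rewrite ?mulr0n ?mulrS; [exact: sH.1|exact: subgroupD].
case: c => k; first by exact: Hn.
by rewrite NegzE mulrNz; apply: subgroupN => //; exact: Hn.
Qed.

Lemma subgroup_sum H (I : Type) (r : seq I) (P : pred I) (F : I -> V) :
  subgroup H -> (forall i, P i -> H (F i)) -> H (\sum_(i <- r | P i) F i).
Proof.
move=> sH HF; elim/big_ind : _ => //; first exact: sH.1.
by move=> x y; exact: subgroupD.
Qed.

Lemma subgroup_subC H x y : subgroup H -> H (x - y) -> H (y - x).
Proof. by move=> sH Hxy; rewrite -opprB; exact: subgroupN. Qed.

Lemma subgroup_sub_trans H y x z :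
  subgroup H -> H (x - y) -> H (y - z) -> H (x - z).
Proof. by move=> sH Hxy Hyz; rewrite -[x](subrK y) -addrA; exact: subgroupD. Qed.

End Lattices.

(** The generator is the least positive element, if there is one. *)
Lemma int_subgroup_principal (H : set int) : subgroup H ->
  exists2 g : int, H g & forall x, H x -> exists q, x = q * g.
Proof.
move=> sH; have [[k [k0 Hk]]|noH] := pselect (exists k : nat, (0 < k)%N /\ H k%:Z).
  have exk : exists k : nat, `[< (0 < k)%N /\ H k%:Z >] by exists k; exact/asboolP.
  case: (ex_minnP exk) => g /asboolP[g0 Hg] gmin.
  exists g%:Z => // x Hx; exists (x %/ g%:Z)%Z.
  have Hr : H (x %% g%:Z)%Z.
    rewrite /modz; apply: sH.2 => //.
    by rewrite mulrC -mulrzz; apply: subgroupMz.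
  have gz : g%:Z != 0 by rewrite eqz_nat -lt0n.
  have r0 := modz_ge0 x gz.
  have rlt : (x %% g%:Z)%Z < g%:Z by rewrite ltz_pmod // ltz_nat.
  case r_eq: (x %% g%:Z)%Z r0 rlt Hr => [[|r]|r] // _ rlt Hr.
    by rewrite {1}(divz_eq x g%:Z) r_eq addr0.
  by have := gmin r.+1 (asboolT (conj isT Hr)); rewrite leqNgt -ltz_nat rlt.
exists 0; first exact: sH.1.
move=> x Hx; exists 0; rewrite mul0r; apply/eqP; apply: contra_notT noH => x0.
exists `|x|%N; split; first by rewrite absz_gt0.
have [x_ge0|x_lt0] := leP 0 x; first by rewrite gez0_abs.
by rewrite ltz0_abs //; apply: subgroupN.
Qed.

(** Project to the coefficient of the first generator: the coefficients that
    occur form a subgroup of Z, so one element of [H] accounts for them all,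
    and what remains of [H] lies in the span of the other generators. *)
Lemma subgroup_zspan (V : zmodType) d (v : 'I_d -> V) (H : set V) :
  subgroup H -> (forall x, H x -> zspan v x) ->
  exists w : 'I_d -> V, H = zspan w.
Proof.
elim: d v H => [|d IH] v H sH Hv.
  exists v; apply/seteqP; split => // x [c ->].
  by rewrite big_ord0; exact: sH.1.
pose v' i := v (lift ord0 i).
pose C := [set c : int | exists2 y, zspan v' y & H (v ord0 *~ c + y)].
have zspanB y z : zspan v' y -> zspan v' z -> zspan v' (y - z).
  move=> [c ->] [c' ->]; exists (fun i => c i - c' i).
  by rewrite -sumrB; apply: eq_bigr => i _; rewrite mulrzBr.
have zspan0 : zspan v' 0 by exists (fun=> 0); rewrite big1.
have sC : subgroup C.
  split; first by exists 0 => //; rewrite mulr0z addr0; exact: sH.1.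
  move=> c c' [y yv Hy] [y' y'v Hy']; exists (y - y'); first exact: zspanB.
  by rewrite mulrzBr addrACA -opprD; exact: sH.2.
have [g [y yv Hg] Cg] := int_subgroup_principal sC.
have [|x [Hx xv]|w Hw] := IH v' (H `&` zspan v').
- split; first by split => //; exact: sH.1.
  by move=> x z [Hx xv] [Hz zv]; split; [exact: sH.2|exact: zspanB].
- by [].
set h := v ord0 *~ g + y in Hg.
exists (fun i => oapp w h (unlift ord0 i)); apply/seteqP; split => x.
  move=> Hx; have [c xE] := Hv x Hx; rewrite big_ord_recl in xE.
  have [|q cE] := Cg (c ord0).
    exists (\sum_(i < d) v' i *~ c (lift ord0 i)); last by rewrite -xE.
    by exists (fun i => c (lift ord0 i)).
  have : zspan w (x - h *~ q).
    rewrite -Hw; split; first by apply: sH.2 => //; exact: subgroupMz.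
    rewrite xE cE /h mulrzDl mulrC -mulrzA opprD addrACA subrr add0r.
    apply: zspanB; first by exists (fun i => c (lift ord0 i)).
    have [e ->] := yv; exists (fun i => e i * q).
    by rewrite mulrz_suml; apply: eq_bigr => i _; rewrite mulrzA.
  move=> [e eE]; exists (fun i => oapp e q (unlift ord0 i)).
  rewrite big_ord_recl unlift_none /=.
  under eq_bigr => i _ do rewrite liftK /=.
  by rewrite -eE addrC subrK.
move=> [c ->]; rewrite big_ord_recl unlift_none /=.
apply: subgroupD => //; first exact: subgroupMz.
under eq_bigr => i _ do rewrite liftK /=.
have [] : (H `&` zspan v') (\sum_i w i *~ c (lift ord0 i)); last by [].
by rewrite Hw; exists (fun i => c (lift ord0 i)).
Qed.

(** * The ring of integers of a number field *)

Section Trace.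
Variable K : fieldExtType rat.
Let d := \dim {:K}.
Let b := vbasis {:K}.

Definition regular_mx (x : K) : 'M[rat]_d :=
  \matrix_(i, j) coord b j (x * b`_i).

Lemma regular_mxE x (i : 'I_d) : x * b`_i = \sum_j regular_mx x i j *: b`_j.
Proof.
rewrite {1}(coord_vbasis (memvf (x * b`_i))); apply: eq_bigr => j _.
by rewrite mxE.
Qed.

Lemma regular_mx_uniq x (A : 'M[rat]_d) :
  (forall i : 'I_d, x * b`_i = \sum_(j < d) A i j *: b`_j) -> A = regular_mx x.
Proof.
move=> AE; apply/matrixP => i j; rewrite mxE AE.
have fb : free b by exact: basis_free (vbasisP {:K}).
by rewrite coord_sum_free.
Qed.

Lemma regular_mxD x y : regular_mx (x + y) = regular_mx x + regular_mx y.
Proof. by apply/matrixP => i j; rewrite !mxE mulrDl linearD. Qed.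

Lemma regular_mx0 : regular_mx 0 = 0.
Proof. by apply/matrixP => i j; rewrite !mxE mul0r linear0. Qed.

Lemma regular_mxZ a x : regular_mx (a *: x) = a *: regular_mx x.
Proof. by apply/matrixP => i j; rewrite !mxE -scalerAl linearZ. Qed.

Lemma regular_mxM x y : regular_mx (x * y) = regular_mx y *m regular_mx x.
Proof.
apply/esym/regular_mx_uniq => i.
rewrite -mulrA regular_mxE mulr_sumr.
transitivity (\sum_j \sum_k (regular_mx y i j * regular_mx x j k) *: b`_k).
  apply: eq_bigr => j _; rewrite -scalerAr regular_mxE scaler_sumr.
  by apply: eq_bigr => k _; rewrite scalerA.
rewrite exchange_big; apply: eq_bigr => k _.
by rewrite mxE scaler_suml.
Qed.

Lemma regular_mx1 : regular_mx 1 = 1%:M.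
Proof.
apply/esym/regular_mx_uniq => i; rewrite mul1r (bigD1 i) //= big1 ?mxE ?eqxx.
  by rewrite addr0 scale1r.
by move=> j ji; rewrite mxE eq_sym (negPf ji) scale0r.
Qed.

Definition trace x := \tr (regular_mx x).

Lemma traceD x y : trace (x + y) = trace x + trace y.
Proof. by rewrite /trace regular_mxD linearD. Qed.

Lemma traceZ a x : trace (a *: x) = a * trace x.
Proof. by rewrite /trace regular_mxZ linearZ. Qed.

Lemma trace1_neq0 : trace 1 != 0.
Proof.
rewrite /trace regular_mx1 mxtrace1 pnatr_eq0 -lt0n.
exact: adim_gt0.
Qed.

(** Every eigenvalue of multiplication by an integral [x] is a root of any
    polynomial that kills [x]. The trace is the sum of the eigenvalues, so
    that it is at once an algebraic integer and a rational number. *)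
Lemma trace_integral x : integralOver (intr : int -> K) x ->
  trace x \is a Num.int.
Proof.
move=> [p p_monic px].
pose B : 'M[algC]_d := map_mx ratr (regular_mx x).
have d_gt0 : (0 < d)%N by exact: adim_gt0.
have eig z : eigenvalue B z -> z \in Aint.
  move=> /eigenvalueP[v vB v0].
  have ev (q : {poly int}) :
      v *m map_mx ratr (regular_mx (map_poly intr q).[x])
      = (map_poly intr q).[z] *: v.
    elim/poly_ind: q => [|q c IH].
      rewrite !rmorph0 !horner0 scale0r.
      by rewrite regular_mx0 map_mx0 mulmx0.
    rewrite !rmorphD !rmorphM /= !map_polyX !map_polyC /= !hornerMXaddC.
    rewrite mulrC regular_mxD regular_mxM map_mxD map_mxM mulmxDr mulmxA IH.
    rewrite -scalemxAl vB scalerA scalerDl; congr (_ + _).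
    rewrite -(scaler_int c 1) regular_mxZ regular_mx1.
    by rewrite scalemx1 map_scalar_mx mul_mx_scalar /= ratr_int.
  have := ev p; rewrite (rootP px) regular_mx0 map_mx0 mulmx0 => /esym/eqP.
  rewrite scaler_eq0 (negPf v0) orbF => pz.
  apply: (@root_monic_Aint (map_poly intr p)) => //.
    by apply: monic_map.
  by apply/polyOverP => i; rewrite coef_map /= rpred_int.
have [r rE] := closed_field_poly_normal (char_poly B).
rewrite (monicP (char_poly_monic B)) scale1r in rE.
have szr : size r = d by have := size_char_poly B; rewrite rE size_prod_XsubC => -[].
have trE : ratr (trace x) = \sum_(z <- r) z.
  have sz0 : size r != 0%N by rewrite szr -lt0n.
  have -> : ratr (trace x) = \tr B.
    by rewrite /B trace_map_mx.
  apply: (@oppr_inj algC); rewrite -char_poly_trace // rE.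
  by rewrite -(coefPn_prod_XsubC sz0) szr.
have trAint : ratr (trace x) \in Aint.
  rewrite trE big_seq; apply: rpred_sum => z zr; apply: eig.
  by rewrite eigenvalue_root_char rE root_prod_XsubC.
have /intrP[c cE] := Cint_rat_Aint (Crat_rat _) trAint.
apply/intrP; exists c.
by apply: (fmorph_inj (ratr : {rmorphism rat -> algC})); rewrite /= cE ratr_int.
Qed.

End Trace.

(** The properties of a ring of integers that the rest of the argument uses;
    the last one is integral closedness in the form in which the determinant
    trick delivers it. *)
Record integers_like (A : comNzRingType) (d : nat) : Prop := IntegersLike {
  int_domain : forall x y : A, x * y = 0 -> x = 0 \/ y = 0;
  int_char0 : forall k, k%:R = 0 :> A -> k = 0%N;
  int_norm : forall x : A, x != 0 -> exists y k, (0 < k)%N /\ x * y = k%:R;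
  int_gen : exists u : 'I_d -> A, forall x, zspan u x;
  int_closed : forall (J : set A) (a b : A), is_ideal J ->
    (exists2 x, J x & x != 0) -> a != 0 ->
    (forall x, J x -> exists2 y, J y & b * x = a * y) -> exists c, b = a * c
}.

Lemma ideal_subgroup (A : comNzRingType) (J : set A) :
  is_ideal J -> subgroup J.
Proof.
move=> [J0 JD JM]; split=> // x y Jx Jy; apply: JD => //.
by rewrite -mulN1r; exact: JM.
Qed.

Section RingOfIntegers.
Variable K : fieldExtType rat.
Notation O := (ring_of_integers K).
Implicit Types x y : O.

Lemma integers_integral x : integralOver (intr : int -> K) (val x).
Proof. by have /asboolP := valP x. Qed.

Lemma integersP (z : K) :
  integralOver (intr : int -> K) z -> exists x : O, val x = z.
Proof. by move=> /asboolP zO; exists (Sub z zO); rewrite SubK. Qed.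

Lemma integers_domain x y : x * y = 0 -> x = 0 \/ y = 0.
Proof.
move=> /(congr1 val); rewrite rmorphM rmorph0 => /eqP; rewrite mulf_eq0.
by case/orP => /eqP h; [left|right]; apply: val_inj; rewrite h rmorph0.
Qed.

Lemma integers_char0 k : k%:R = 0 :> O -> k = 0%N.
Proof.
move=> /(congr1 val); rewrite rmorph_nat rmorph0 => /eqP.
rewrite -(scaler_nat k (1 : K)) scaler_eq0 oner_eq0 orbF pnatr_eq0.
by move/eqP.
Qed.

(** The constant term of an integral equation for [x] is a multiple of [x]. *)
Lemma integers_norm x : x != 0 -> exists y k, (0 < k)%N /\ x * y = k%:R.
Proof.
move=> x0; have [p p_monic] := integers_integral x.
move=> /rootP px; have {px} : (map_poly intr p).[x] = 0.
  apply: val_inj; rewrite rmorph0 -px -horner_map -map_poly_comp.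
  congr (_.[_]); apply: eq_map_poly => c; exact: (rmorph_int (\val : {rmorphism O -> K})).
have := monic_neq0 p_monic; move: {p_monic} p; elim/poly_ind => [|p c IH].
  by rewrite eqxx.
rewrite rmorphD rmorphM /= map_polyX map_polyC hornerMXaddC.
have [->|c0 _ /eqP] := eqVneq c 0.
  rewrite addr0 mulf_eq0 negb_or polyX_eq0 andbT => p0; rewrite /= addr0.
  by move=> /integers_domain[|xx]; [exact: IH|rewrite xx eqxx in x0].
rewrite addr_eq0 mulrC => /eqP xE; rewrite /= in xE.
have [c_ge0|c_lt0] := leP 0 c.
  exists (- (map_poly intr p).[x]), `|c|%N; split; first by rewrite absz_gt0.
  by rewrite mulrN xE opprK -{1}(gez0_abs c_ge0).
exists (map_poly intr p).[x], `|c|%N; split; first by rewrite absz_gt0.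
by rewrite xE -{1}(opprK c) -(ltz0_abs c_lt0) rmorphN opprK.
Qed.

(** Pairing with a maximal linearly independent family of integral elements
    under the trace form embeds the ring into a power of Z: the form is
    nondegenerate because every nonzero element divides a nonzero rational
    integer, which has nonzero trace. *)
Lemma integers_gen :
  exists d (u : 'I_d -> O), forall x, zspan u x.
Proof.
pose P k := `[< exists2 s : seq O, size s = k & free (map val s) >].
have exP : exists k, P k.
  by exists 0%N; apply/asboolP; exists [::] => //; exact: nil_free.
have bP k : P k -> (k <= \dim {:K})%N.
  move=> /asboolP[s <- /eqP sfree]; rewrite -(size_map val s) -sfree.
  by rewrite dimvS ?subvf.
case: (ex_maxnP exP bP) => k /asboolP[s sk sfree] kmax.
have span_s x : val x \in <<map val s>>%VS.
  apply: contraT => xs; have : P k.+1.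
    by apply/asboolP; exists (x :: s); rewrite /= ?sk // free_cons xs.
  by move=> /kmax; rewrite ltnn.
exists k; have tr_int x : trace (val x) \is a Num.int.
  exact/trace_integral/integers_integral.
pose phi x : {ffun 'I_k -> int} := [ffun i : 'I_k => Num.floor (trace (val (x * s`_i)))].
have phiE x i : (phi x i)%:~R = trace (val (x * s`_i)).
  by rewrite ffunE floorK.
have phiD x y : phi (x + y) = phi x + phi y.
  apply/ffunP => i; apply: (@intr_inj rat).
  by rewrite [(phi x + phi y) i]ffunE rmorphD /= !phiE mulrDl rmorphD traceD.
have phi0 : phi 0 = 0 by apply: (addrI (phi 0)); rewrite -phiD !addr0.
have phiB x y : phi (x - y) = phi x - phi y.
  by apply/eqP; rewrite eq_sym subr_eq -phiD subrK.
have phi_inj x : phi x = 0 -> x = 0.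
  move=> px; apply/eqP; apply: contraT => x0.
  have [y [N [N0 xyN]]] := integers_norm x0.
  have : trace (val (x * y)) = 0.
    rewrite rmorphM /= (coord_span (X := in_tuple (map val s)) (span_s y)) mulr_sumr.
    elim/big_ind : _ => [|a b Ha Hb|i _].
    - by rewrite -(scale0r (0:K)) traceZ mul0r.
    - by rewrite traceD Ha Hb addr0.
    rewrite -scalerAr traceZ.
    have ik : (i < k)%N by rewrite -sk -(size_map val s).
    rewrite (nth_map 0) ?sk //=.
    have -> : \val x * \val s`_i = \val (x * s`_i) by rewrite rmorphM.
    by rewrite -(phiE x (Ordinal ik)) px ffunE mulr0.
  rewrite xyN rmorph_nat -(scaler_nat N (1 : K)) traceZ => /eqP.
  by rewrite mulf_eq0 (negPf (trace1_neq0 K)) orbF pnatr_eq0 eqn0Ngt N0.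
have [||w Hw] := @subgroup_zspan _ k (fun i => [ffun j => (i == j)%:R]) (range phi).
- split; first by exists 0.
  by move=> _ _ [x _ <-] [y _ <-]; exists (x - y); rewrite ?phiB.
- move=> f _; exists f; apply/ffunP => j.
  rewrite sum_ffunE (bigD1 j) //= big1 ?addr0.
    by rewrite ffunMzE ffunE eqxx intz.
  by move=> i ij; rewrite ffunMzE ffunE (negPf ij) mul0rz.
have wphi i : exists x, phi x = w i.
  suff : range phi (w i) by move=> [x _ <-]; exists x.
  rewrite Hw; exists (fun j => (j == i)%:R).
  rewrite (bigD1 i) //= eqxx mulr1z big1 ?addr0 // => j ji.
  by rewrite (negPf ji) mulr0z.
have [u uE] := choice wphi.
exists u => x; have : range phi (phi x) by exists x.
rewrite Hw => -[c cE]; exists c; apply/eqP; rewrite -subr_eq0; apply/eqP.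
apply: phi_inj; rewrite phiB cE; apply/eqP; rewrite subr_eq0; apply/eqP.
have phiMn z (q : nat) : phi (z *+ q) = phi z *+ q.
  by elim: q => [|q IHq]; rewrite ?mulr0n // !mulrS phiD IHq.
have phiMz z q : phi (z *~ q) = phi z *~ q.
  case: q => q; first exact: phiMn.
  by rewrite NegzE !mulrNz -[- (z *~ _)]sub0r phiB phi0 sub0r phiMn.
rewrite (big_morph phi phiD phi0); apply: eq_bigr => i _.
by rewrite phiMz uE.
Qed.

(** The matrix of multiplication by [b / a] on generators of [J] has integer
    entries, and [b / a] is a root of its characteristic polynomial. *)
Lemma integers_closed (J : set O) (a b : O) : is_ideal J ->
  (exists2 x, J x & x != 0) -> a != 0 ->
  (forall x, J x -> exists2 y, J y & b * x = a * y) -> exists c, b = a * c.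
Proof.
move=> J_ideal [x0 Jx0 x0_neq0] a0 bJ.
have [d [v vE]] := integers_gen.
have [|u uE] := subgroup_zspan (ideal_subgroup J_ideal) (v := v).
  by move=> x _; exact: vE.
have Ju i : J (u i).
  rewrite uE; exists (fun j => (j == i)%:R).
  rewrite (bigD1 i) //= eqxx mulr1z big1 ?addr0 // => j ji.
  by rewrite (negPf ji) mulr0z.
have /choice[M ME] i : exists c : 'I_d -> int,
    b * u i = a * \sum_j u j *~ c j.
  by have [y] := bJ _ (Ju i); rewrite {1}uE => -[c ->]; exists c.
have va0 : val a != 0 by apply: contraNneq a0 => h; apply/eqP/val_inj; rewrite h rmorph0.
pose B : 'M[int]_d := \matrix_(j, i) M i j.
have /integersP[c cE] : integralOver (intr : int -> K) (val b / val a).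
  exists (char_poly B); first exact: char_poly_monic.
  rewrite map_char_poly -eigenvalue_root_char; apply/eigenvalueP.
  exists (\row_i val (u i)).
    apply/rowP => i; rewrite !mxE; apply: (mulfI va0).
    rewrite [RHS]mulrA [val a * (_ / _)]mulrCA divff // mulr1.
    have -> : val b * val (u i) = val a * val (\sum_j u j *~ M i j).
      by rewrite -!rmorphM ME.
    rewrite rmorph_sum.
    congr (_ * _); apply: eq_bigr => j _; rewrite !mxE rmorphMz.
    by rewrite mulrzr.
  apply: contraNneq x0_neq0 => u0; move: Jx0; rewrite uE => -[c ->].
  rewrite big1 // => i _; have /rowP/(_ i) := u0; rewrite !mxE => ui.
  have -> : u i = 0 by apply: val_inj; rewrite ui rmorph0.
  by rewrite mul0rz.
exists c; apply: val_inj; transitivity (val a * val c); last by rewrite rmorphM.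
by rewrite cE mulrC divfK.
Qed.

Lemma integers_like_integers : exists d, integers_like O d.
Proof.
have [d u] := integers_gen.
exists d; split => //.
- exact: integers_domain.
- exact: integers_char0.
- exact: integers_norm.
- exact: integers_closed.
Qed.

End RingOfIntegers.

(** * Enumerations and indices *)

Definition enumerates (T : choiceType) (s : seq T) (A : set T) :=
  uniq s /\ forall x, (x \in s) <-> A x.

Lemma nb_elementsE (T : choiceType) (s : seq T) (A : set T) :
  enumerates s A -> nb_elements A = size s.
Proof.
move=> [us sA]; rewrite /nb_elements.
have -> : A = [set` [fset x in s]%fset].
  apply/seteqP; split => x /=; first by move=> /sA xs; rewrite inE.
  by rewrite inE => /sA.
by rewrite set_fsetK card_fseq undup_id.
Qed.

Lemma finite_enumerates (T : choiceType) (A : set T) :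
  finite_set A -> exists s, enumerates s A.
Proof.
move=> finA; exists (enum_fset (fset_set A)); split; first exact: fset_uniq.
by move=> x; rewrite in_fset_set // inE.
Qed.

Lemma enumerates_finite (T : choiceType) (s : seq T) (A : set T) :
  enumerates s A -> finite_set A.
Proof.
move=> [_ sA]; have -> : A = [set` s] by apply/seteqP; split => x /sA.
exact: finite_seq.
Qed.

Lemma enumerates_image (T U : choiceType) (f : T -> U) s A :
  {in A &, injective f} -> enumerates s A -> enumerates (map f s) (f @` A).
Proof.
move=> finj [us sA]; split.
  rewrite map_inj_in_uniq // => x y /sA xs /sA ys; apply: finj; exact/mem_set.
move=> y; split; first by move=> /mapP[x /sA Ax ->]; exists x.
by move=> [x /sA Ax <-]; exact: map_f.
Qed.

Section Index.
Variable V : zmodType.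
Implicit Types M L H : set V.

Definition transversal_of (T : finType) (r : T -> V) M H :=
  [/\ forall t, M (r t), forall x, M x -> exists t, H (x - r t)
    & forall t t', H (r t - r t') -> t = t'].

Definition has_index M H k :=
  exists (T : finType) (r : T -> V), transversal_of r M H /\ #|T| = k.

Lemma has_index_le M H k l :
  subgroup H -> has_index M H k -> has_index M H l -> (k <= l)%N.
Proof.
move=> sH [T [r [[rM _ rI] <-]]] [T' [r' [[_ r'S _] <-]]].
have /choice[f fE] t : exists t', H (r t - r' t') by exact: r'S.
apply: (@leq_card _ _ f) => t u ftu; apply: rI.
apply: (subgroup_sub_trans (y := r' (f t))) => //.
by rewrite ftu; exact: subgroup_subC.
Qed.

Lemma has_index_uniq M H k l :
  subgroup H -> has_index M H k -> has_index M H l -> k = l.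
Proof.
by move=> sH Hk Hl; apply/eqP; rewrite eqn_leq !(has_index_le sH Hk, has_index_le sH Hl).
Qed.

Lemma has_index_cover (T : finType) (s : T -> V) M H : subgroup H ->
  (forall t, M (s t)) -> (forall x, M x -> exists t, H (x - s t)) ->
  exists2 k, has_index M H k & (k <= #|T|)%N.
Proof.
move=> sH sM cov.
have /choice[f fE] t : exists u : T, [pick u | `[< H (s t - s u) >]] = Some u.
  case: pickP => [u|/(_ t)/asboolP[]]; first by exists u.
  by rewrite subrr; exact: sH.1.
have Hf t : H (s t - s (f t)).
  by have := fE t; case: pickP => // u /asboolP Hu [<-].
have f_eq t u : H (s t - s u) -> f t = f u.
  move=> Htu; have := fE t; have := fE u.
  rewrite (_ : [pick v | `[< H (s t - s v) >]] = [pick v | `[< H (s u - s v) >]]).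
    by move=> -> [].
  apply: eq_pick => v; apply: asbool_equiv_eq; split => h.
    by apply: (subgroup_sub_trans (y := s t)) => //; exact: subgroup_subC.
  exact: (subgroup_sub_trans (y := s u)).
exists #|{: {t | f t == t}}|; last by rewrite card_sig; exact: max_card.
exists {t | f t == t}, (fun t => s (val t)); split=> //; split => //.
  move=> x /cov[t xt].
  have ft : f (f t) == f t by apply/eqP/esym/f_eq.
  exists (exist _ (f t) ft) => /=.
  exact: (subgroup_sub_trans (y := s t)).
move=> [t tf] [u uf] /= /f_eq; rewrite (eqP tf) (eqP uf) => tu.
exact: val_inj.
Qed.

Lemma has_index_mul M L H k l : subgroup M -> subgroup L -> subgroup H ->
  H `<=` L -> L `<=` M ->
  has_index M L k -> has_index L H l -> has_index M H (k * l).
Proof.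
move=> sM sL sH HL LM [T [r [[rM rS rI] <-]]] [U [s [[sinL sS sI] <-]]].
exists (T * U)%type, (fun t => r t.1 + s t.2); split; last by rewrite card_prod.
split.
- by move=> t; apply: subgroupD => //; exact: LM.
- move=> x /rS[t xt]; have [u xu] := sS _ xt.
  by exists (t, u); rewrite /= opprD addrA.
- move=> [t u] [t' u'] /=; rewrite opprD addrACA => h.
  have tt' : t = t'.
    apply: rI; rewrite -[_ - _](addrK (s u - s u')).
    by apply: sL.2; [exact: HL|exact: sL.2].
  by congr (_, _) => //; apply: sI; move: h; rewrite tt' subrr add0r.
Qed.

Lemma has_index_sub M L H k : subgroup L -> subgroup H ->
  H `<=` L -> L `<=` M -> has_index M H k -> exists l, has_index L H l.
Proof.
move=> sL sH HL LM [T [r [[rM rS rI] _]]].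
have [//|[t Lt]|x Lx|l Ll _] := @has_index_cover
  {: {t | `[< L (r t) >]}} (fun t => r (val t)) L H.
- exact/asboolP.
- have [t xt] := rS x (LM _ Lx).
  have Lt : L (r t) by rewrite -[r t](subKr x); apply: sL.2; [|exact: HL].
  by exists (exist _ t (asboolT Lt)).
by exists l.
Qed.

Lemma has_index_gt0 M H k : M !=set0 -> has_index M H k -> (0 < k)%N.
Proof.
by move=> [x Mx] [T [r [[_ rS _] <-]]]; have [t _] := rS x Mx; apply/card_gt0P; exists t.
Qed.

Lemma has_index1 H : subgroup H -> has_index H H 1.
Proof.
move=> [H0 _]; exists unit, (fun=> 0); split; last by rewrite card_unit.
split=> //; first by move=> x Hx; exists tt; rewrite subr0.
by move=> [] [].
Qed.

Lemma has_index1_eq M H : subgroup M -> subgroup H -> H `<=` M ->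
  has_index M H 1 -> M = H.
Proof.
move=> sM sH HM [T [r [[rM rS rI] T1]]].
apply/seteqP; split => // x Mx.
have [t0 tP] := fintype1 T1.
have [t xt] := rS x Mx; have [u Hu] := rS 0 sM.1.
rewrite -[x]subr0; apply: (subgroup_sub_trans (y := r t)) => //.
by rewrite tP -(tP u); exact: subgroup_subC.
Qed.

(** Translation by [x] permutes the cosets of [H], so it does not change the
    sum of a system of representatives modulo [H]. *)
Lemma has_indexMn H k x : subgroup H -> has_index setT H k -> H (x *+ k).
Proof.
move=> sH [T [r [[_ rS rI] <-]]].
have /choice[f fE] t : exists u, H (r t + x - r u) by exact: rS.
have f_inj : injective f.
  move=> t u ftu; apply: rI.
  have : H ((r t + x) - (r u + x)).
    apply: (subgroup_sub_trans (y := r (f t))) => //.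
    by rewrite ftu; exact: subgroup_subC.
  by rewrite opprD addrACA subrr addr0.
have : H (\sum_t (r t + x - r (f t))) by exact: subgroup_sum.
rewrite sumrB big_split /= sumr_const.
have -> : \sum_t r (f t) = \sum_t r t by rewrite [RHS](reindex_inj f_inj).
by rewrite addrAC subrr add0r.
Qed.

End Index.

Lemma has_index_ffun (V : zmodType) (E : finType) (H : set V) k :
  has_index setT H k ->
  has_index setT [set a : {ffun E -> V} | forall e, H (a e)] (k ^ #|E|).
Proof.
move=> [T [r [[_ rS rI] <-]]].
exists {ffun E -> T}, (fun t : {ffun E -> T} => [ffun e => r (t e)]).
split; last by rewrite card_ffun.
split => // [x _|t u h].
  have /choice[f fE] e : exists t, H (x e - r t) by exact: rS.
  by exists [ffun e => f e] => e; rewrite !ffunE.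
by apply/ffunP => e; apply: rI; have := h e; rewrite !ffunE.
Qed.

(** * Ideals *)

Section Ideals.
Variable A : comNzRingType.
Implicit Types (I J H P : set A) (a b x y : A).

Definition nzideal I := is_ideal I /\ exists2 x, I x & x != 0.

Lemma nzidealP I : nzideal I <-> is_ideal I /\ I != [set 0].
Proof.
split=> [[I_ideal [x Ix x0]]|[I_ideal I0]]; split=> //.
  by apply: contraNneq x0 => I0; move: Ix; rewrite I0 => ->.
apply: contrapT => no; move/eqP: I0; apply; apply/seteqP; split => x /=.
  by move=> Ix; apply: contrapT => /eqP x0; apply: no; exists x.
by move=> ->; case: I_ideal.
Qed.

Lemma idealT : is_ideal [set: A].
Proof. by []. Qed.

Lemma nzidealT : nzideal [set: A].
Proof. by split => //; exists 1 => //; exact: oner_neq0. Qed.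

Lemma nzidealS I J : nzideal I -> is_ideal J -> I `<=` J -> nzideal J.
Proof. by move=> [_ [x Ix x0]] J_ideal IJ; split => //; exists x => //; exact: IJ. Qed.

Lemma ideal1 I : is_ideal I -> I 1 -> I = setT.
Proof.
move=> [_ _ IM] I1; apply/seteqP; split => // x _.
by rewrite -[x]mulr1; exact: IM.
Qed.

Definition principal a : set A := [set x | exists y, x = a * y].

Lemma principal_ideal a : is_ideal (principal a).
Proof.
split; first by exists 0; rewrite mulr0.
  by move=> _ _ [x ->] [y ->]; exists (x + y); rewrite mulrDr.
by move=> b _ [x ->]; exists (b * x); rewrite mulrCA.
Qed.

Lemma principalE I a : is_ideal I -> I a -> principal a `<=` I.
Proof. by move=> [_ _ IM] Ia _ [y ->]; rewrite mulrC; exact: IM. Qed.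

Lemma mem_principal a : principal a a.
Proof. by exists 1; rewrite mulr1. Qed.

Definition colon I a : set A := [set x | I (a * x)].

Lemma colon_ideal I a : is_ideal I -> is_ideal (colon I a).
Proof.
move=> [I0 ID IM]; split; rewrite /colon /=.
- by rewrite mulr0.
- by move=> x y; rewrite mulrDr; exact: ID.
- by move=> b x; rewrite mulrCA; exact: IM.
Qed.

Lemma sub_colon I a : is_ideal I -> I `<=` colon I a.
Proof. by move=> [_ _ IM] x Ix; exact: IM. Qed.

Definition adjoin I a : set A := [set x | exists2 p, I p & exists q, x = p + a * q].

Lemma adjoin_ideal I a : is_ideal I -> is_ideal (adjoin I a).
Proof.
move=> [I0 ID IM]; split.
- by exists 0 => //; exists 0; rewrite mulr0 addr0.
- move=> _ _ [p Ip [q ->]] [p' Ip' [q' ->]]; exists (p + p'); first exact: ID.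
  by exists (q + q'); rewrite mulrDr addrACA.
- move=> b _ [p Ip [q ->]]; exists (b * p); first exact: IM.
  by exists (b * q); rewrite mulrDr [b * (a * q)]mulrCA.
Qed.

Lemma sub_adjoin I a : I `<=` adjoin I a.
Proof. by move=> x Ix; exists x => //; exists 0; rewrite mulr0 addr0. Qed.

Lemma mem_adjoin I a : is_ideal I -> adjoin I a a.
Proof. by move=> [I0 _ _]; exists 0 => //; exists 1; rewrite mulr1 add0r. Qed.

(** The product of [I] and [J] as the least ideal that contains the products;
    an inclusion [idmul I J `<=` L] is then checked on generators. *)
Definition idmul I J : set A :=
  [set x | forall L, is_ideal L -> (forall a b, I a -> J b -> L (a * b)) -> L x].

Lemma idmul_ideal I J : is_ideal (idmul I J).
Proof.
split=> [L [L0 _ _] _|x y xP yP L iL LP|a x xP L iL LP] //.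
  by case: (iL) => _ LD _; apply: LD; [exact: xP|exact: yP].
by case: (iL) => _ _ LM; apply: LM; exact: xP.
Qed.

Lemma mem_idmul I J a b : I a -> J b -> idmul I J (a * b).
Proof. by move=> Ia Jb L _; exact. Qed.

Lemma idmul_sub I J L : is_ideal L ->
  (forall a b, I a -> J b -> L (a * b)) -> idmul I J `<=` L.
Proof. by move=> iL LP x; exact. Qed.

Lemma idmulC I J : idmul I J = idmul J I.
Proof.
by apply/seteqP; split; apply: idmul_sub; do ?[exact: idmul_ideal];
  move=> a b Ia Jb; rewrite mulrC; exact: mem_idmul.
Qed.

Lemma idmulSr I J H : J `<=` H -> idmul I J `<=` idmul I H.
Proof.
move=> JH; apply: idmul_sub; first exact: idmul_ideal.
by move=> a b Ia /JH Hb; exact: mem_idmul.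
Qed.

Lemma idmul_subl I J : is_ideal I -> idmul I J `<=` I.
Proof.
by move=> iI; apply: idmul_sub => // a b Ia _; rewrite mulrC; case: iI => _ _; exact.
Qed.

Lemma idmul_subr I J : is_ideal J -> idmul I J `<=` J.
Proof. by rewrite idmulC; exact: idmul_subl. Qed.

Lemma idmulA I J H : idmul I (idmul J H) = idmul (idmul I J) H.
Proof.
have half I1 I2 I3 : idmul (idmul I1 I2) I3 `<=` idmul I1 (idmul I2 I3).
  apply: idmul_sub; first exact: idmul_ideal.
  have [L0 LD LM] := idmul_ideal I1 (idmul I2 I3).
  move=> x c xP I3c; suff : [set y | idmul I1 (idmul I2 I3) (y * c)] x by [].
  apply: xP.
    split => /= [|y z Ly Lz|y z Lz]; first by rewrite mul0r.
      by rewrite mulrDl; exact: LD.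
    by rewrite -mulrA; exact: LM.
  by move=> a b I1a I2b /=; rewrite -mulrA; do ?apply: mem_idmul.
apply/seteqP; split; last exact: half.
by rewrite (idmulC I) (idmulC J) (idmulC _ H) (idmulC I J); exact: half.
Qed.

Lemma idmulT I : is_ideal I -> idmul I setT = I.
Proof.
move=> iI; apply/seteqP; split; first exact: idmul_subl.
by move=> x Ix; rewrite -[x]mulr1; exact: mem_idmul.
Qed.

Lemma idmul_principal a I : is_ideal I ->
  idmul (principal a) I = [set x | exists2 y, I y & x = a * y].
Proof.
move=> [I0 ID IM]; apply/seteqP; split; last first.
  by move=> _ [y Iy ->]; apply: mem_idmul => //; exact: mem_principal.
apply: idmul_sub.
  split; first by exists 0; rewrite ?mulr0.
    by move=> _ _ [x Ix ->] [y Iy ->]; exists (x + y); rewrite ?mulrDr //; exact: ID.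
  by move=> b _ [x Ix ->]; exists (b * x); [exact: IM|rewrite mulrCA].
by move=> _ y [x ->] Iy; exists (x * y); [exact: IM|rewrite mulrA].
Qed.

End Ideals.

(** * Norms of ideals *)

Lemma ideal_normE (A : comNzRingType) (I : set A) k :
  is_ideal I -> has_index setT I k -> ideal_norm I = k.
Proof.
move=> iI [T [r [[_ rS rI] <-]]]; have [I0 ID IM] := iI.
pose coset x := [set x + y | y in I].
have cosetE x z : coset x z <-> I (z - x).
  split; first by move=> [y Iy <-]; rewrite addrC addKr.
  by move=> Izx; exists (z - x); rewrite // subrKC.
have enum_cosets : enumerates [seq coset (r t) | t <- enum T]
    [set [set x + y | y in I] | x in [set: A]].
  split.
    rewrite map_inj_uniq ?enum_uniq // => t t' tt'; apply: rI; apply/cosetE.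
    by rewrite -tt'; apply/cosetE; rewrite subrr.
  move=> X; split; first by move=> /mapP[t _ ->]; exists (r t).
  move=> [x _ <-]; have [t xt] := rS x Logic.I.
  apply/mapP; exists t; first by rewrite mem_enum.
  apply/seteqP; split => z /cosetE zx; apply/cosetE.
    exact: (subgroup_sub_trans (ideal_subgroup iI) zx).
  apply: (subgroup_sub_trans (ideal_subgroup iI) zx).
  exact: (subgroup_subC (ideal_subgroup iI)).
by rewrite /ideal_norm (nb_elementsE enum_cosets) size_map -cardE.
Qed.

Section Norm.
Variables (A : comNzRingType) (d : nat) (HA : integers_like A d).
Implicit Types (I J H P : set A) (a b x y : A).

Lemma ideal_index_nat I k : is_ideal I -> (0 < k)%N -> I k%:R ->
  exists2 l, has_index setT I l & (l <= k ^ d)%N.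
Proof.
move=> iI k0 Ik; have [u uE] := int_gen HA; have [_ ID IM] := iI.
have -> : (k ^ d)%N = #|{ffun 'I_d -> 'I_k}| by rewrite card_ffun !card_ord.
apply: (has_index_cover (s := fun c : {ffun 'I_d -> 'I_k} => \sum_i u i *+ c i)).
- exact: ideal_subgroup.
- by [].
move=> x _; have [c ->] := uE x.
have kz : k%:Z != 0 by rewrite eqz_nat -lt0n.
have cmod i : (`|(c i %% k%:Z)%Z| < k)%N.
  by rewrite -ltz_nat gez0_abs ?modz_ge0 // ltz_pmod // ltz_nat.
exists [ffun i => Ordinal (cmod i)].
rewrite -sumrB; apply: subgroup_sum; first exact: ideal_subgroup.
move=> i _; rewrite ffunE /= pmulrn gez0_abs ?modz_ge0 //.
rewrite {1}(divz_eq (c i) k%:Z) mulrzDr addrK mulrzA.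
by rewrite -pmulrn -mulr_natr; exact: IM.
Qed.

Lemma nzideal_nat I : nzideal I -> exists2 k, (0 < k)%N & I k%:R.
Proof.
move=> [[_ _ IM] [x Ix x0]]; have [y [k [k0 xyk]]] := int_norm HA x0.
by exists k => //; rewrite -xyk mulrC; exact: IM.
Qed.

Lemma natr_neq0 k : (0 < k)%N -> k%:R != 0 :> A.
Proof. by move=> k0; apply: contraTneq k0 => /(int_char0 HA) ->. Qed.

Lemma nat_nzideal I k : is_ideal I -> (0 < k)%N -> I k%:R -> nzideal I.
Proof. by move=> iI k0 Ik; split => //; exists k%:R => //; exact: natr_neq0. Qed.

Lemma ideal_normP I : nzideal I -> has_index setT I (ideal_norm I).
Proof.
move=> nI; have [k k0 Ik] := nzideal_nat nI; have iI := nI.1.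
have [l Il _] := ideal_index_nat iI k0 Ik.
by rewrite (ideal_normE iI Il).
Qed.

Lemma ideal_norm_gt0 I : nzideal I -> (0 < ideal_norm I)%N.
Proof. by move=> /ideal_normP; apply: has_index_gt0; exists 0. Qed.

Lemma ideal_normS I J : nzideal I -> is_ideal J -> I `<=` J ->
  exists2 l, has_index J I l & ideal_norm I = (ideal_norm J * l)%N.
Proof.
move=> nI iJ IJ; have iI := nI.1; have nJ := nzidealS nI iJ IJ.
have [l Jl] := has_index_sub (ideal_subgroup iJ) (ideal_subgroup iI) IJ
  (@subsetT _ _) (ideal_normP nI).
exists l => //; apply: ideal_normE => //.
by apply: (has_index_mul _ _ _ IJ _ (ideal_normP nJ) Jl);
  do ?[exact: ideal_subgroup].
Qed.

Lemma ideal_norm_ltn I J : nzideal I -> is_ideal J -> I `<=` J -> I <> J ->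
  (ideal_norm J < ideal_norm I)%N.
Proof.
move=> nI iJ IJ I_neq_J; have [l Jl ->] := ideal_normS nI iJ IJ.
have J0 := ideal_norm_gt0 (nzidealS nI iJ IJ).
rewrite ltn_Pmulr //; case: l Jl => [|[|l]] // Jl.
  have J_ne : J !=set0 by exists 0; case: iJ.
  by have := has_index_gt0 J_ne Jl.
case: I_neq_J; apply/esym/has_index1_eq => //; apply: ideal_subgroup => //.
exact: nI.1.
Qed.

Lemma ideal_normT : ideal_norm [set: A] = 1%N.
Proof. by apply: ideal_normE; [exact: idealT|apply: has_index1]. Qed.

Lemma ideal_norm_eq1 I : nzideal I -> ideal_norm I = 1%N -> I = setT.
Proof.
move=> nI I1; apply: contrapT => IT.
by have := ideal_norm_ltn nI (idealT A) (@subsetT _ _) IT; rewrite I1 ideal_normT.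
Qed.

Lemma ideal_norm_mem I : nzideal I -> I (ideal_norm I)%:R.
Proof.
move=> nI; apply: has_indexMn; first exact/ideal_subgroup/nI.1.
exact: ideal_normP.
Qed.

Lemma ideal_norm_ind (Q : set A -> Prop) :
  (forall I, nzideal I -> (forall J, is_ideal J -> I `<=` J -> I <> J -> Q J) -> Q I) ->
  forall I, nzideal I -> Q I.
Proof.
move=> IH I; have [k] := ubnP (ideal_norm I); elim: k I => // k IHk I Ik nI.
apply: IH => // J iJ IJ I_neq_J; apply: IHk; last exact: nzidealS IJ.
by rewrite -ltnS; apply: leq_trans Ik; rewrite ltnS; exact: ideal_norm_ltn.
Qed.

Lemma finite_ideals_nat k : (0 < k)%N ->
  finite_set [set I : set A | is_ideal I /\ I k%:R].
Proof.
move=> k0; have ik := principal_ideal (k%:R : A).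
have [l [T [r [[_ rS rI] _]]] _] := ideal_index_nat ik k0 (mem_principal _).
pose F (S : {set T}) := [set x : A | exists2 t, t \in S & principal k%:R (x - r t)].
apply: (@sub_finite_set _ _ (range F)); last exact: finite_image.
move=> I [iI Ik]; have [_ ID IM] := iI.
exists [set t | `[< I (r t) >]]%SET => //; apply/seteqP; split => x.
  move=> [t]; rewrite inE => /asboolP It /(principalE iI Ik) Ixt.
  by rewrite -(subrK (r t) x); exact: ID.
move=> Ix; have [t xt] := rS x Logic.I; exists t => //; rewrite inE.
apply/asboolP; rewrite -(subKr x (r t)).
by apply: (ideal_subgroup iI).2 => //; exact: (principalE iI Ik).
Qed.

Lemma finite_ideals_norm k :
  finite_set [set I : set A | nzideal I /\ (ideal_norm I <= k)%N].
Proof.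
apply: (sub_finite_set _ (finite_ideals_nat (fact_gt0 k))) => I [nI Ik].
split; first exact: nI.1.
have /dvdnP[q ->] : (ideal_norm I %| k`!)%N by rewrite dvdn_fact // Ik ideal_norm_gt0.
by rewrite natrM; case: (nI) => -[_ _ IM] _; apply: IM; exact: ideal_norm_mem.
Qed.

End Norm.

(** * Invertibility of ideals *)

Section Dedekind.
Variables (A : comNzRingType) (d : nat) (HA : integers_like A d).
Implicit Types (I J H P : set A) (a b x y : A).

Definition maximal_ideal P :=
  [/\ nzideal P, P <> setT
    & forall J, is_ideal J -> P `<=` J -> J = P \/ J = setT].

Lemma maximal_not1 P : maximal_ideal P -> ~ P 1.
Proof. by move=> [nP PT _] /(ideal1 nP.1). Qed.

Lemma ex_maximal_ideal I : nzideal I -> I <> setT ->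
  exists2 P, maximal_ideal P & I `<=` P.
Proof.
move=> nI; move: I nI; apply: (ideal_norm_ind HA) => I nI IH IT.
have [mI|nmI] := pselect (maximal_ideal I); first by exists I.
have [J [iJ IJ JI JT]] : exists J, [/\ is_ideal J, I `<=` J, I <> J & J <> setT].
  apply: contrapT => no; apply: nmI; split => // J iJ IJ.
  have [->|JI] := pselect (J = I); [by left|right].
  apply: contrapT => JT; apply: no; exists J; split => //.
  exact: nesym.
have [P mP JP] := IH J iJ IJ JI JT.
by exists P => // x /IJ /JP.
Qed.

Lemma maximal_prime P x y : maximal_ideal P -> P (x * y) -> P x \/ P y.
Proof.
move=> [[iP _] PT Pmax] Pxy; have [_ PD PM] := iP.
have [eqP|/seteqP[_ /(_ 1 Logic.I)[p Pp [q pq]]]] :=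
  Pmax _ (adjoin_ideal x iP) (@sub_adjoin _ P x).
  by left; rewrite -eqP; exact: mem_adjoin.
right; rewrite -[y]mul1r pq mulrDl; apply: PD; first by rewrite mulrC; exact: PM.
by rewrite mulrAC mulrC; exact: PM.
Qed.

Lemma maximal_prime_ideal P I J : maximal_ideal P -> idmul I J `<=` P ->
  I `<=` P \/ J `<=` P.
Proof.
move=> mP IJP; have [|noI] := pselect (I `<=` P); [by left|right].
have [x Ix Px] : exists2 x, I x & ~ P x.
  apply: contrapT => no; apply: noI => x Ix; apply: contrapT => Px.
  by apply: no; exists x.
move=> y Jy; have := IJP _ (mem_idmul Ix Jy).
by move=> /(maximal_prime mP)[].
Qed.

(** Multiplication by an element outside of a prime ideal [J] permutes the
    finitely many cosets of [J], so that element is invertible modulo [J]. *)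
Lemma prime_maximal J P : nzideal J -> is_ideal P -> J `<=` P -> ~ P 1 ->
  (forall x y, J (x * y) -> J x \/ J y) -> P `<=` J.
Proof.
move=> nJ iP JP P1 Jprime p Pp; apply: contrapT => Jp.
have sJ := ideal_subgroup nJ.1.
have [T [r [[_ rS rI] _]]] := ideal_normP HA nJ.
have /choice[f fE] t : exists u, J (p * r t - r u) by exact: rS.
have f_inj : injective f.
  move=> t u ftu; apply: rI.
  have : J (p * (r t - r u)).
    rewrite mulrBr; apply: (subgroup_sub_trans (y := r (f t))) => //.
    by rewrite ftu; exact: subgroup_subC.
  by move=> /Jprime[].
have [t0 t0E] := rS 1 Logic.I.
have := fE (invF f_inj t0); rewrite f_invF => h.
apply: P1; rewrite -(subrK (p * r (invF f_inj t0)) 1).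
have [_ PD PM] := iP; apply: PD; last by rewrite mulrC; exact: PM.
apply: JP; apply: (subgroup_sub_trans (y := r t0)) => //.
exact: subgroup_subC.
Qed.

(** Induction on the norm of [J]: if [x y] lies in [J] but [x] and [y] do
    not, then the ideals [J : x] and [J : y] are larger than [J]. When neither
    of them is contained in [P], there is [z] outside of [P] with [z x] in
    [J], and then [J : z] is larger than [J] and contained in [P]. *)
Lemma maximal_associated P J : maximal_ideal P -> nzideal J -> J `<=` P ->
  exists2 b, ~ J b & forall x, P x -> J (b * x).
Proof.
move=> mP nJ; have [[iP _] PT _] := mP; have P1 := maximal_not1 mP.
move: J nJ; apply: (ideal_norm_ind HA) => J nJ IH JP; have iJ := nJ.1.
have [_ _ JM] := iJ.
have step z y : ~ J z -> ~ J y -> J (z * y) -> colon J z `<=` P ->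
    exists2 b, ~ J b & forall x, P x -> J (b * x).
  move=> Jz Jy Jzy zP.
  have Jcol : J <> colon J z.
    by move=> Jcol; apply: Jy; have : colon J z y := Jzy; rewrite -Jcol.
  have [b bz bP] := IH _ (colon_ideal z iJ) (sub_colon z iJ) Jcol zP.
  by exists (z * b) => // x /bP; rewrite -mulrA.
have [PJ|PJ] := pselect (P `<=` J).
  by exists 1 => [/JP//|x /PJ]; rewrite mul1r.
have [x [y [Jx Jy Jxy]]] : exists x y, [/\ ~ J x, ~ J y & J (x * y)].
  apply: contrapT => no; apply: PJ; apply: (prime_maximal nJ) => // x y Jxy.
  apply: contrapT => /not_orP[Jx Jy]; apply: no; by exists x, y.
have [xP|xP] := pselect (colon J x `<=` P); first exact: (step x y).
have [z zx Pz] : exists2 z, colon J x z & ~ P z.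
  apply: contrapT => no; apply: xP => z zx; apply: contrapT => Pz.
  by apply: no; exists z.
rewrite /colon /= mulrC in zx.
apply: (step z x) => //; first by move=> /JP.
by move=> w /JP /(maximal_prime mP)[].
Qed.

(** Take [a] in [P] and [b] outside of [(a)] with [b P] in [(a)], and let [S]
    be the ideal of the [x] with [x P] in [(a)]. The ideal [P S / a] contains
    [P]. It is not equal to [P] since [b / a] would then stabilize [P], and
    [b / a] is not integral. So [P S = (a)]. *)
Lemma maximal_invertible P : maximal_ideal P ->
  exists S a b, [/\ is_ideal S, S a, a != 0, S b /\ ~ principal a b
    & idmul P S = principal a].
Proof.
move=> mP; have [nP PT Pmax] := mP; have [iP [a Pa a0]] := nP.
have na : nzideal (principal a).
  by split; [exact: principal_ideal|exists a => //; exact: mem_principal].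
have [b ab bP] := maximal_associated mP na (principalE iP Pa).
have [a_0 aD aM] := na.1.
pose S : set A := [set x | forall p, P p -> principal a (x * p)].
have iS : is_ideal S.
  split => [p _|x y xS yS p Pp|c x xS p Pp]; first by rewrite mul0r.
    by rewrite mulrDl; apply: aD; [exact: xS|exact: yS].
  by rewrite -mulrA; apply: aM; exact: xS.
have Sa : S a by move=> p _; exists p.
have PSa : idmul P S `<=` principal a.
  by apply: (idmul_sub na.1) => x s Px Ss; rewrite mulrC; exact: Ss.
exists S, a, b; split => //; apply/seteqP; split => //.
apply: principalE; first exact: idmul_ideal.
have [||eqP|eqT] := Pmax (colon (idmul P S) a).
- exact/colon_ideal/idmul_ideal.
- by move=> p Pp; rewrite /colon /= mulrC; exact: mem_idmul.
- case: ab; apply: (int_closed HA iP) => //; first by exists a.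
  move=> x Px; have [y bx] := bP x Px; exists y => //.
  by rewrite -eqP /colon /= -bx mulrC; exact: mem_idmul.
- have : colon (idmul P S) a 1 by rewrite eqT.
  by rewrite /colon /= mulr1.
Qed.

Lemma idmul_principal_principal a b :
  idmul (principal a) (principal b) = principal (a * b).
Proof.
rewrite (idmul_principal _ (principal_ideal b)); apply/seteqP; split => x.
  by move=> [_ [y ->] ->]; exists y; rewrite mulrA.
by move=> [y ->]; exists (b * y); [exists y|rewrite mulrA].
Qed.

Lemma idmul_colon a I : is_ideal I -> I `<=` principal a ->
  idmul (principal a) (colon I a) = I.
Proof.
move=> iI Ia; rewrite idmul_principal; last exact: colon_ideal.
apply/seteqP; split => [_ [y Iy ->]//|x Ix].
by have [y xy] := Ia x Ix; exists y; rewrite ?/colon /= -?xy.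
Qed.

Lemma mulfI_domain a x y : a != 0 -> a * x = a * y -> x = y.
Proof.
move=> a0 /eqP; rewrite -subr_eq0 -mulrBr => /eqP /(int_domain HA)[a_0|].
  by rewrite a_0 eqxx in a0.
by move=> /eqP; rewrite subr_eq0 => /eqP.
Qed.

(** The ideal [J S / a], with [S] and [a] from a maximal ideal that contains
    [J], is larger than [J] for the same reason as above, hence invertible by
    induction on the norm. *)
Lemma ideal_invertible J : nzideal J ->
  exists J' a, [/\ is_ideal J', a != 0 & idmul J J' = principal a].
Proof.
move: J; apply: (ideal_norm_ind HA) => J nJ IH; have iJ := nJ.1.
have [->|JT] := pselect (J = setT).
  exists setT, 1; split; [exact: idealT|exact: oner_neq0|].
  rewrite idmulT; last exact: idealT.
  by apply/seteqP; split => // x _; exists x; rewrite mul1r.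
have [P mP JP] := ex_maximal_ideal nJ JT.
have [S [a [b [iS Sa a0 [Sb ab] PSa]]]] := maximal_invertible mP.
have JSa : idmul J S `<=` principal a.
  by rewrite -PSa ![idmul _ S]idmulC; exact: idmulSr.
have iJS := idmul_ideal J S.
have J1J : J `<=` colon (idmul J S) a.
  by move=> x Jx; rewrite /colon /= mulrC; exact: mem_idmul.
have [|J2 [c [iJ2 c0 J12]]] := IH (colon (idmul J S) a) (colon_ideal a iJS) J1J.
  move=> J1E; apply: ab; apply: (int_closed HA iJ) => //; first exact: nJ.2.
  move=> x Jx; have bx : idmul J S (b * x) by rewrite mulrC; exact: mem_idmul.
  have [y bxy] := JSa _ bx; exists y => //.
  by rewrite J1E /colon /= -bxy.
exists (idmul S J2), (a * c); split.
- exact: idmul_ideal.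
- by apply/eqP => /(int_domain HA)[] h; [move: a0|move: c0]; rewrite h eqxx.
- by rewrite idmulA -(idmul_colon iJS JSa) -idmulA J12 idmul_principal_principal.
Qed.

Lemma principal_cancel a I J : a != 0 -> is_ideal I -> is_ideal J ->
  idmul (principal a) I `<=` idmul (principal a) J -> I `<=` J.
Proof.
move=> a0 iI iJ; rewrite !idmul_principal // => IJ x Ix.
have [|y Jy /(mulfI_domain a0)->//] := IJ (a * x); by exists x.
Qed.

Lemma idmul_cancel I J H : nzideal I -> is_ideal J -> is_ideal H ->
  idmul I J `<=` idmul I H -> J `<=` H.
Proof.
move=> nI iJ iH IJH; have [I' [a [iI' a0 II']]] := ideal_invertible nI.
apply: (principal_cancel a0) => //.
by rewrite -II' (idmulC I) -!idmulA; exact: idmulSr.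
Qed.

Lemma idmul_inj I J H : nzideal I -> is_ideal J -> is_ideal H ->
  idmul I J = idmul I H -> J = H.
Proof.
move=> nI iJ iH JH.
by apply/seteqP; split; apply: (idmul_cancel nI) => //; rewrite JH.
Qed.

(** If [J J' = (a)], the quotient is [I J' / a]. *)
Lemma ideal_divides I J : is_ideal I -> nzideal J -> I `<=` J ->
  exists2 H, is_ideal H & I = idmul J H.
Proof.
move=> iI nJ IJ; have [J' [a [iJ' a0 JJ']]] := ideal_invertible nJ.
have IJa : idmul I J' `<=` principal a.
  by rewrite -JJ' ![idmul _ J']idmulC; exact: idmulSr.
have iIJ := idmul_ideal I J'.
exists (colon (idmul I J') a); first exact: colon_ideal.
have eqa : idmul (principal a) I = idmul (principal a) (idmul J (colon (idmul I J') a)).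
  rewrite [RHS]idmulA [idmul _ J]idmulC -idmulA idmul_colon //.
  by rewrite -JJ' -idmulA (idmulC J').
by apply/seteqP; split; apply: (principal_cancel a0) => //;
  do ?[exact: idmul_ideal]; rewrite eqa.
Qed.

Lemma nzideal_mul I J : nzideal I -> nzideal J -> nzideal (idmul I J).
Proof.
move=> [_ [x Ix x0]] [_ [y Jy y0]]; split; first exact: idmul_ideal.
exists (x * y); first exact: mem_idmul.
by apply/eqP => /(int_domain HA)[] h; [move: x0|move: y0]; rewrite h eqxx.
Qed.

(** [J / J P] has no proper submodule, so it is generated by the class of any
    element [x] of [J] outside of [J P] and is isomorphic to the quotient of
    the ring by [P]. *)
Lemma ideal_normM_maximal J P : nzideal J -> maximal_ideal P ->
  ideal_norm (idmul J P) = (ideal_norm J * ideal_norm P)%N.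
Proof.
move=> nJ mP; have [nP PT Pmax] := mP.
have [[iJ iP] iJP] := (nJ.1, nP.1, idmul_ideal J P).
have [_ JD JM] := iJ; have [_ JPD JPM] := iJP.
have JPJ : idmul J P `<=` J by exact: idmul_subl.
have [x Jx JPx] : exists2 x, J x & ~ idmul J P x.
  apply: contrapT => no; apply: (maximal_not1 mP).
  apply: (idmul_cancel nJ (idealT A) iP) => //; rewrite idmulT // => x Jx.
  by apply: contrapT => JPx; apply: no; exists x.
have adjE : adjoin (idmul J P) x = J.
  have MJ : adjoin (idmul J P) x `<=` J.
    by move=> _ [p /JPJ Jp [q ->]]; apply: JD => //; rewrite mulrC; exact: JM.
  have iM := adjoin_ideal x iJP.
  have [H iH MH] := ideal_divides iM nJ MJ.
  have PH : P `<=` H.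
    by apply: (idmul_cancel nJ iP iH); rewrite -MH; exact: sub_adjoin.
  have [HP|HT] := Pmax H iH PH; last by rewrite MH HT idmulT.
  by case: JPx; rewrite -HP -MH; exact: mem_adjoin.
have colE : colon (idmul J P) x `<=` P.
  have [||->//|colT] := Pmax (colon (idmul J P) x).
  - exact: colon_ideal.
  - by move=> p Pp; exact: mem_idmul.
  - case: JPx; have : colon (idmul J P) x 1 by rewrite colT.
    by rewrite /colon /= mulr1.
have [T [r [[_ rS rI] Tn]]] := ideal_normP HA nP.
apply: ideal_normE => //.
apply: (has_index_mul _ _ _ JPJ _ (ideal_normP HA nJ)); do ?[exact: ideal_subgroup].
- by [].
exists T, (fun t => x * r t); split => //; split.
- by move=> t; rewrite mulrC; exact: JM.
- move=> y; rewrite -{1}adjE => -[p JPp [q ->]]; have [t qt] := rS q Logic.I.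
  by exists t; rewrite -addrA -mulrBr; apply: JPD => //; exact: mem_idmul.
- by move=> t u; rewrite -mulrBr => /colE /rI.
Qed.

Lemma ideal_normM J H : nzideal J -> nzideal H ->
  ideal_norm (idmul J H) = (ideal_norm J * ideal_norm H)%N.
Proof.
move=> nJ nH; move: H nH J nJ; apply: (ideal_norm_ind HA) => H nH IH J nJ.
have [->|HT] := pselect (H = setT).
  by rewrite idmulT ?(ideal_normT A) ?muln1 //; exact: nJ.1.
have [P mP HP] := ex_maximal_ideal nH HT; have [nP PT _] := mP.
have [H' iH' HE] := ideal_divides nH.1 nP HP.
have HH' : H `<=` H' by rewrite HE; exact: idmul_subr.
have nH' := nzidealS nH iH' HH'.
have H_neq : H <> H'.
  move=> eqH; apply: PT; apply: ideal1 nP.1 _.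
  apply: (idmul_cancel nH (idealT A) nP.1 _ Logic.I).
  rewrite idmulT; last exact: nH.1.
  by rewrite {1}HE -eqH idmulC => y.
rewrite {1}HE idmulA (IH H') //; last exact: nzideal_mul.
rewrite ideal_normM_maximal // -mulnA; congr (_ * _)%N.
by rewrite HE (IH H').
Qed.

(** * Maximal ideals above a rational prime *)

Lemma maximal_eq P Q : maximal_ideal P -> maximal_ideal Q -> P `<=` Q -> P = Q.
Proof.
move=> [_ _ Pmax] [nQ QT _] PQ.
by have [->|] := Pmax Q nQ.1 PQ.
Qed.

(** An ideal contained in distinct maximal ideals is contained in their
    product: a product of some of them is not contained in another one. *)
Lemma ideal_sub_prod I (s : seq (set A)) : nzideal I -> uniq s ->
  (forall P, P \in s -> maximal_ideal P /\ I `<=` P) ->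
  exists Q, [/\ nzideal Q, I `<=` Q,
    ideal_norm Q = (\prod_(P <- s) ideal_norm P)%N
    & forall P, maximal_ideal P -> P \notin s -> ~ (Q `<=` P)].
Proof.
move=> nI; elim: s => [|P s IHs] /=.
  exists setT; split => //; first exact: nzidealT.
    by rewrite big_nil (ideal_normT A).
  by move=> P mP _ TP; apply: (maximal_not1 mP); exact: TP.
move=> /andP[Ps us] sI; have [mP IP] := sI P (mem_head _ _).
have [|Q [nQ IQ Qn QP]] := IHs us.
  by move=> P' P's; apply: sI; rewrite inE P's orbT.
have [nP _ _] := mP.
have [H iH IE] := ideal_divides nI.1 nQ IQ.
have HP : H `<=` P.
  by have [|/(QP P mP Ps)|] // := @maximal_prime_ideal P Q H mP; rewrite -IE.
exists (idmul Q P); split.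
- exact: nzideal_mul.
- by rewrite IE; exact: idmulSr.
- by rewrite big_cons ideal_normM // Qn mulnC.
move=> P' mP'; rewrite inE negb_or => /andP[P'P P's].
move=> /(maximal_prime_ideal mP')[/(QP P' mP' P's)//|PP'].
by rewrite (maximal_eq mP mP' PP') eqxx in P'P.
Qed.

Lemma maximal_dvdn_norm P p : maximal_ideal P -> prime p -> P p%:R ->
  (p %| ideal_norm P)%N.
Proof.
move=> mP p_prime Pp; have [nP _ _] := mP; have [_ PD PM] := nP.1.
apply: contraT; rewrite -prime_coprime // => /coprimeP.
move=> /(_ (prime_gt0 p_prime))[[u v] /= uv].
case: (maximal_not1 mP).
have -> : 1 = u%:R * p%:R - v%:R * (ideal_norm P)%:R :> A.
  by rewrite -!natrM -natrB ?uv // ltnW // -subn_gt0 uv.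
apply: (ideal_subgroup nP.1).2; apply: PM => //.
exact: (ideal_norm_mem HA nP).
Qed.

Lemma maximal_has_prime P : maximal_ideal P -> exists2 p, prime p & P p%:R.
Proof.
move=> mP; have [nP _ _] := mP.
have := ideal_norm_mem HA nP; have := ideal_norm_gt0 HA nP.
elim/ltn_ind: (ideal_norm P) => -[|[|k]] IH // _ Pk.
  by case: (maximal_not1 mP).
have pk := pdiv_prime (isT : (1 < k.+2)%N).
have /dvdnP[q kE] := pdiv_dvd k.+2.
move: Pk; rewrite kE natrM => /(maximal_prime mP)[Pq|]; last by exists (pdiv k.+2).
have q0 : (0 < q)%N by rewrite lt0n; apply/eqP => q0; rewrite q0 in kE.
apply: (IH q) => //; rewrite kE ltn_Pmulr //; exact: prime_gt1.
Qed.

(** The product of the maximal ideals in question contains [p], so its norm is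
    at most [p ^ d], whereas each of the factors has norm at least [p]. *)
Lemma maximal_above_prime p (s : seq (set A)) : prime p -> uniq s ->
  (forall P, P \in s -> maximal_ideal P /\ P p%:R) -> (size s <= d)%N.
Proof.
move=> p_prime us sP; have p0 := prime_gt0 p_prime.
have ip := principal_ideal (p%:R : A).
have np := nat_nzideal HA ip p0 (mem_principal _).
have [|Q [nQ pQ Qn _]] := ideal_sub_prod np us.
  by move=> P /sP[mP Pp]; split => //; apply: principalE => //; case: mP => -[].
have [l Ql l_le] := ideal_index_nat HA nQ.1 p0 (pQ _ (mem_principal _)).
rewrite -(leq_exp2l _ _ (prime_gt1 p_prime)).
apply: leq_trans l_le; rewrite -(ideal_normE nQ.1 Ql) Qn.
have {}sP P : P \in s -> (p <= ideal_norm P)%N.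
  move=> /sP[mP Pp]; apply: dvdn_leq; last exact: maximal_dvdn_norm.
  by apply: ideal_norm_gt0 HA _ _; case: mP.
elim: s sP {us Qn} => [|P s IHs] sP; first by rewrite big_nil.
rewrite big_cons expnS leq_mul //; first by rewrite sP ?mem_head.
by apply: IHs => P' P's; rewrite sP // inE P's orbT.
Qed.

End Dedekind.

(** * Characters of abelian groups *)

Lemma enumerates_fibers (T U : choiceType) (A : set T) (f : T -> U) (r : seq U)
    (S : U -> seq T) : uniq r ->
  (forall u, u \in r -> enumerates (S u) [set x | A x /\ f x = u]) ->
  (forall x, A x -> f x \in r) ->
  enumerates (flatten [seq S u | u <- r]) A.
Proof.
move=> ur SE Ar.
suff [uf fE] : enumerates (flatten [seq S u | u <- r]) [set x | A x /\ f x \in r].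
  split => // x; split; first by move=> /fE[].
  by move=> Ax; apply/fE; split => //; exact: Ar.
elim: r ur SE {Ar} => [|u r IHr] /=; first by split => // x; split => // -[].
move=> /andP[ur0 ur] SE.
have [|uf fE] := IHr ur; first by move=> v vr; apply: SE; rewrite inE vr orbT.
have [uSu SuE] := SE u (mem_head _ _).
split => [|x].
  rewrite cat_uniq uSu uf andbT; apply/hasPn => x /fE[_ fxr].
  by apply: contra ur0 => /SuE[_ <-].
rewrite mem_cat; split.
  case/orP => [/SuE[Ax fx]|/fE[Ax fr]]; split => //; rewrite inE.
    by rewrite fx eqxx.
  by rewrite fr orbT.
move=> [Ax]; rewrite inE => /orP[/eqP fx|fr]; apply/orP; [left|right].
  exact/SuE.
exact/fE.
Qed.

Section Characters.
Variable C : numClosedFieldType.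
Variable V : zmodType.
Implicit Types (H : set V) (psi lam : V -> C).

Definition character_on H lam :=
  lam 0 = 1 /\ forall x y, H x -> H y -> lam (x + y) = lam x * lam y.

Definition character psi := character_on setT psi.

Lemma char0 psi : character psi -> psi 0 = 1.
Proof. by case. Qed.

Lemma charD psi x y : character psi -> psi (x + y) = psi x * psi y.
Proof. by move=> [_]; apply. Qed.

Lemma char_neq0 H lam x : subgroup H -> character_on H lam -> H x -> lam x != 0.
Proof.
move=> sH [l0 lD] Hx; apply/eqP => lx; have := oner_neq0 C.
by rewrite -l0 -(subrr x) lD ?lx ?mul0r ?eqxx //; exact: subgroupN.
Qed.

Lemma charMn H lam x k : subgroup H -> character_on H lam -> H x ->
  lam (x *+ k) = lam x ^+ k.
Proof.
move=> sH [l0 lD] Hx; have Hk (j : nat) : H (x *+ j) by exact: (subgroupMz j%:Z).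
elim: k => [|k IH]; first by rewrite mulr0n expr0.
by rewrite mulrS exprS lD // IH.
Qed.

Lemma charN H lam x : subgroup H -> character_on H lam -> H x ->
  lam (- x) = (lam x)^-1.
Proof.
move=> sH cl Hx; apply: (mulfI (char_neq0 sH cl Hx)).
rewrite divff; last exact: (char_neq0 sH cl Hx).
by case: (cl) => l0 lD; rewrite -lD ?subrr //; exact: subgroupN.
Qed.

Lemma charMz H lam x (k : int) : subgroup H -> character_on H lam -> H x ->
  lam (x *~ k) = lam x ^ k.
Proof.
move=> sH cl Hx; case: k => k; first exact: (charMn k sH cl).
rewrite NegzE mulrNz (charN sH cl); last exact: (subgroupMz k.+1%:Z).
by congr (_^-1); exact: (charMn k.+1 sH cl).
Qed.

Lemma subgroupT : subgroup [set: V]. Proof. by []. Qed.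

(** The value at [x] of an extension is any [m]-th root of the value at [m x],
    where [m] is the order of [x] modulo [H]. *)
Lemma char_extend H lam x (m : nat) z : subgroup H -> character_on H lam ->
  (0 < m)%N -> (forall j : int, H (x *~ j) <-> (m%:Z %| j)%Z) ->
  z ^+ m = lam (x *+ m) ->
  exists lam', [/\ character_on [set y | exists2 h, H h & exists j, y = h + x *~ j] lam',
     forall h, H h -> lam' h = lam h & lam' x = z].
Proof.
move=> sH cl m0 Hx zm; have [l0 lD] := cl.
have z0 : z != 0.
  apply/eqP => z0; move: zm; rewrite z0 expr0n eqn0Ngt m0 => /esym/eqP.
  by apply/negP; apply: (char_neq0 sH cl); apply/(Hx m%:Z).
have wd h j h' j' : H h -> H h' -> h + x *~ j = h' + x *~ j' ->
    lam h * z ^ j = lam h' * z ^ j'.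
  move=> Hh Hh' e.
  have e' : h' = h + x *~ (j - j').
    by rewrite mulrzBr addrA e addrK.
  have Hj : H (x *~ (j - j')).
    by rewrite (_ : x *~ _ = h' - h); [exact: sH.2|rewrite e' addrAC subrr add0r].
  have /(Hx _)/dvdzP[q jq] := Hj.
  rewrite e' lD // jq [q * _]mulrC mulrzA.
  have Hm : H (x *~ m) by exact/Hx.
  rewrite (charMz _ sH cl Hm) (_ : lam (x *~ m) = z ^ m); last by rewrite -exprnP zm.
  by rewrite -mulrA exprz_exp -expfzDr // [_ * q]mulrC -jq subrK.
have /choice[lam' lamE] y : exists c : C, forall h j, H h -> y = h + x *~ j ->
    c = lam h * z ^ j.
  have [[h [j [Hh yE]]]|no] := pselect (exists h j, H h /\ y = h + x *~ j).
    by exists (lam h * z ^ j) => h' j' Hh' yE'; apply: wd => //; rewrite -yE.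
  by exists 0 => h j Hh yE; case: no; exists h, j.
have {}lamE h j : H h -> lam' (h + x *~ j) = lam h * z ^ j.
  by move=> Hh; exact: lamE.
exists lam'; split.
- split.
    by have := lamE 0 0 sH.1; rewrite l0 mulr0z addr0 expr0z mul1r.
  move=> _ _ [h Hh [j ->]] [h' Hh' [j' ->]].
  rewrite addrACA -mulrzDr !lamE ?lD ?expfzDr //; last exact: subgroupD.
  by rewrite mulrACA.
- by move=> h Hh; have := lamE h 0 Hh; rewrite mulr0z addr0 expr0z mulr1.
- by have := lamE 0 1 sH.1; rewrite l0 mulr1z add0r expr1z mul1r.
Qed.

Lemma nth_roots (c : C) m : (0 < m)%N -> c != 0 ->
  exists s : seq C, enumerates s [set z | z ^+ m = c] /\ size s = m.
Proof.
move=> m0 c0; pose p : {poly C} := 'X^m - c%:P.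
have pm : p \is monic by exact: monicXnsubC.
have [s sE] := closed_field_poly_normal p.
rewrite (monicP pm) scale1r in sE.
exists s; split; last first.
  by apply/succn_inj; rewrite -(size_prod_XsubC s id) -sE size_XnsubC.
split.
  rewrite -separable_prod_XsubC -sE separable_poly.unlock.
  apply/Pdiv.ClosedField.coprimepP => z; rewrite rootE !hornerE subr_eq0 => /eqP zm.
  rewrite /p derivB derivXn derivC subr0 hornerMn hornerXn.
  rewrite -mulr_natr mulf_neq0 ?pnatr_eq0 -?lt0n // expf_neq0 //.
  by apply: contra_eq_neq zm => ->; rewrite expr0n eqn0Ngt m0 eq_sym.
move=> z; rewrite -root_prod_XsubC -sE rootE !hornerE subr_eq0.
by split=> /eqP.
Qed.

(** Adding one element [x] of order [m] modulo [H] at a time multiplies the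
    number of extensions by the number [m] of roots, and divides the index
    by [m]. *)
Lemma char_extensions H lam k : subgroup H -> character_on H lam ->
  has_index setT H k ->
  exists s, enumerates s [set psi | character psi /\ forall x, H x -> psi x = lam x]
            /\ size s = k.
Proof.
elim/ltn_ind: k H lam => k IH H lam sH cl Hk.
have [HT|HT] := pselect (H = setT).
  exists [:: lam]; split.
    split => // psi; rewrite inE; split=> [/eqP ->|[_ psiE]].
      by split => //; rewrite /character -HT.
    by apply/eqP/funext => x; apply: psiE; rewrite HT.
  apply: (has_index_uniq sH _ Hk); rewrite HT; exact: has_index1.
have [x Hx] : exists x, ~ H x.
  apply: contrapT => no; apply: HT; apply/seteqP; split => // x _.
  by apply: contrapT => Hx; apply: no; exists x.
have k0 : (0 < k)%N by apply: has_index_gt0 Hk; exists 0.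
have [|g Hg gP] := @int_subgroup_principal [set j : int | H (x *~ j)].
  split; first by rewrite /= mulr0z; exact: sH.1.
  by move=> i j /=; rewrite mulrzBr; exact: sH.2.
have g0 : g != 0.
  have [q kE] := gP k%:Z (has_indexMn x sH Hk).
  by apply/eqP => g0; move: kE k0; rewrite g0 mulr0 => -[->].
pose m := `|g|%N; have m0 : (0 < m)%N by rewrite absz_gt0.
have xP (j : int) : H (x *~ j) <-> (m%:Z %| j)%Z.
  have -> : (m%:Z %| j)%Z = (g %| j)%Z by rewrite !dvdzE absz_nat.
  split => [/gP[q ->]|/dvdzP[q ->]].
    exact: dvdz_mull.
  by rewrite mulrC mulrzA; exact: subgroupMz.
pose H' : set V := [set y | exists2 h, H h & exists j, y = h + x *~ j].
have sH' : subgroup H'.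
  split; first by exists 0; [exact: sH.1|exists 0; rewrite mulr0z addr0].
  move=> _ _ [h Hh [j ->]] [h' Hh' [j' ->]]; exists (h - h'); first exact: sH.2.
  by exists (j - j'); rewrite mulrzBr opprD addrACA.
have HH' : H `<=` H' by move=> h Hh; exists h => //; exists 0; rewrite mulr0z addr0.
have H'x : H' x by exists 0; [exact: sH.1|exists 1; rewrite add0r mulr1z].
have Hm : has_index H' H m.
  exists 'I_m, (fun i : 'I_m => x *+ i); split; last exact: card_ord.
  split.
  - by move=> i; exists 0; [exact: sH.1|exists i%:Z; rewrite add0r].
  - have mz : m%:Z != 0 by rewrite eqz_nat -lt0n.
    move=> _ [h Hh [j ->]].
    have jm : (`|(j %% m%:Z)%Z| < m)%N.
      by rewrite -ltz_nat gez0_abs ?modz_ge0 // ltz_pmod // ltz_nat.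
    exists (Ordinal jm) => /=; rewrite pmulrn gez0_abs ?modz_ge0 //.
    rewrite -addrA -mulrzBr; apply: subgroupD => //; apply/xP.
    by rewrite -eqz_mod_dvd modz_mod.
  - move=> i j; rewrite !pmulrn -mulrzBr => /xP.
    rewrite -eqz_mod_dvd !modz_nat => /eqP[]; rewrite !modn_small //.
    exact: val_inj.
have [l Hl] : exists l, has_index setT H' l.
  have [T [r [[_ rS _] _]]] := Hk.
  have [||l Hl _] := @has_index_cover _ _ r setT H' sH'; last by exists l.
  - by [].
  - by move=> y _; have [t yt] := rS y Logic.I; exists t; exact: HH'.
have kE : k = (l * m)%N.
  by apply: (has_index_uniq sH Hk); apply: has_index_mul sH' sH HH' _ Hl Hm.
have m1 : (1 < m)%N.
  rewrite ltn_neqAle m0 andbT; apply/eqP => m1; apply: Hx.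
  by rewrite -[x]mulr1z; apply/xP; rewrite -m1.
have lk : (l < k)%N.
  by rewrite kE ltn_Pmulr // lt0n; apply/eqP => l0; rewrite kE l0 in k0.
have Hxm : H (x *+ m) by exact/(xP m%:Z).
have [r [rE rm]] := nth_roots m0 (char_neq0 sH cl Hxm).
have /choice[S SP] z : exists S, z \in r -> enumerates S
    [set psi | (character psi /\ forall x, H x -> psi x = lam x) /\ psi x = z]
    /\ size S = l.
  have [/rE.2 zm|] := boolP (z \in r); last by exists [::].
  have [lam' [cl' lamE lamx]] := char_extend sH cl m0 xP zm.
  have [S [SE Sl]] := IH l lk H' lam' sH' cl' Hl; exists S => _; split => //.
  rewrite (_ : [set psi | _] = [set psi | character psi /\
    forall x, H' x -> psi x = lam' x]) //.
  apply/seteqP; split => psi /=.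
    move=> [[cpsi psiE] psix]; split => // _ [h Hh [j ->]].
    rewrite charD // cl'.2; [|exact: HH'|by apply: subgroupMz].
    rewrite psiE // lamE //; congr (_ * _).
    by rewrite (charMz _ subgroupT cpsi) // (charMz _ sH' cl') // psix lamx.
  move=> [cpsi psiE]; split; last by rewrite psiE.
  by split => // h Hh; rewrite psiE ?lamE //; exact: HH'.
exists (flatten [seq S z | z <- r]); split.
  apply: (enumerates_fibers (f := fun psi => psi x)); first exact: rE.1.
    by move=> z /SP[].
  move=> psi [cpsi psiE]; apply/(rE.2 _) => /=.
  by rewrite -psiE // (charMn _ subgroupT cpsi).
rewrite size_flatten /shape -map_comp sumnE big_map big_seq.
rewrite (eq_bigr (fun=> l)); last by move=> z /SP[].
by rewrite -big_seq big_const_seq count_predT iter_addn_0 rm mulnC kE mulnC.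
Qed.

End Characters.

(** * The commutator form *)

Section Single.
Variables (E : finType) (A : comNzRingType).

Definition single (e : E) (x : A) : {ffun E -> A} :=
  [ffun e' => if e' == e then x else 0].

Lemma singleD e x y : single e (x + y) = single e x + single e y.
Proof. by apply/ffunP => e'; rewrite !ffunE; case: eqP; rewrite ?addr0. Qed.

Lemma ffun_sum_single (a : {ffun E -> A}) : a = \sum_e single e (a e).
Proof.
apply/ffunP => e; rewrite sum_ffunE (bigD1 e) //= big1 ?addr0 ?ffunE ?eqxx //.
by move=> e' ee'; rewrite ffunE eq_sym (negPf ee').
Qed.

End Single.

Section CompositionsOf.
Variables (n m : nat).
Hypothesis m_gt0 : (0 < m)%N.
Implicit Types (e : Eset m n) (f : Fset m n) (i j : 'I_n).

Lemma diff_basisP e f i :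
  reflect (forall j, val f j = val e j + (j == i) :> nat)%N (diff_basis e f i).
Proof. by apply: (iffP forallP) => h j; apply/eqP; rewrite ?h. Qed.

Lemma diff_basis_inj e e' f i : diff_basis e f i -> diff_basis e' f i -> e = e'.
Proof.
move=> /diff_basisP h /diff_basisP h'; apply/val_inj/ffunP => j; apply: val_inj.
by apply: (@addIn (j == i)); rewrite /= -h -h'.
Qed.

Lemma diff_basis_index e f i j : diff_basis e f i -> diff_basis e f j -> i = j.
Proof.
move=> /diff_basisP h /diff_basisP h'; have := h i; rewrite h' eqxx => /addnI.
by case: eqP.
Qed.

Lemma ex_diff_basis e i : exists f, diff_basis e f i.
Proof.
pose v : {ffun 'I_n -> 'I_m.+1} := [ffun j => inord (val e j + (j == i))].
have vE j : v j = (val e j + (j == i))%N :> nat.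
  rewrite ffunE inordK // ltnS; apply: (@leq_trans (m.-1 + 1)).
    by rewrite leq_add // ?leq_b1 // -ltnS.
  by rewrite addn1 prednK.
have v_sum : (\sum_j v j == m)%N.
  under eq_bigr => j _ do rewrite vE.
  rewrite big_split /= (eqP (valP e)) (bigD1 i) //= eqxx big1 ?addn0.
    by rewrite addn1 prednK.
  by move=> j /negPf ->.
by exists (Sub v v_sum); apply/diff_basisP => j; rewrite SubK vE.
Qed.

(** A linear functional with decreasing weights orders the monomials of
    degree [m - 1]; it plays the part of a monomial order. *)
Definition weight e := (\sum_(j < n) val e j * (n - j))%N.

Lemma weight_lt e e' f i i' :
  diff_basis e f i -> diff_basis e' f i' -> (i < i')%N -> (weight e < weight e')%N.
Proof.
have weightE e1 i1 : diff_basis e1 f i1 ->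
    (\sum_(j < n) val f j * (n - j) = weight e1 + (n - i1))%N.
  move=> /diff_basisP h; under eq_bigr => j _ do rewrite h mulnDl.
  rewrite big_split /=; congr addn.
  by rewrite (bigD1 i1) //= eqxx mul1n big1 ?addn0 // => j /negPf ->.
move=> /weightE h /weightE h' ii'.
have : (weight e + (n - i) = weight e' + (n - i'))%N by rewrite -h -h'.
have : (n - i' < n - i)%N by apply: ltn_sub2l.
lia.
Qed.

End CompositionsOf.

Lemma card_compositions n m : (0 < n)%N -> (0 < m)%N ->
  #|{: Eset m n}| = e_mn m n.
Proof.
case: n => // n _; case: m => // m _; rewrite /e_mn /=.
rewrite (_ : n.+1 + m.+1 - 2 = n + m)%N; last by lia.
rewrite -card_ord_partitions card_sig.
pose F (t : n.+1.-tuple 'I_m.+1) := [ffun i => tnth t i].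
have F_inj : injective F.
  by move=> t u /ffunP tu; apply: eq_from_tnth => i; have := tu i; rewrite !ffunE.
rewrite -(card_imset _ F_inj); apply: eq_card => v; rewrite !inE.
apply/idP/imsetP => [v_sum|[t]].
  exists [tuple v i | i < n.+1]; last by apply/ffunP => i; rewrite ffunE tnth_mktuple.
  by rewrite inE big_tuple; under eq_bigr => i _ do rewrite tnth_mktuple.
rewrite inE big_tuple => t_sum ->.
by under eq_bigr => i _ do rewrite ffunE.
Qed.

Section Annihilator.
Variables (C : numClosedFieldType) (A : comNzRingType) (d : nat).
Variables (HA : integers_like A d) (n m : nat).
Hypotheses (n_gt0 : (0 < n)%N) (m_gt0 : (0 < m)%N).
Implicit Types (psi : {ffun 'I_n -> A} -> C) (I : set A).
Implicit Types (a : {ffun Eset m n -> A}) (b : {ffun Fset m n -> A}).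

(** The characters of [A ^ n] form an [A]-module. *)
Definition annihilator psi : set A :=
  [set x | forall v : {ffun 'I_n -> A}, psi [ffun i => x * v i] = 1].

Lemma annihilator_ideal psi : character psi -> is_ideal (annihilator psi).
Proof.
move=> cpsi; split => [v|x y xP yP v|x y yP v].
- by rewrite -(char0 cpsi); congr psi; apply/ffunP => i; rewrite !ffunE mul0r.
- rewrite -[RHS]mulr1 -{1}(xP v) -(yP v) -charD //; congr psi.
  by apply/ffunP => i; rewrite !ffunE mulrDl.
- rewrite -(yP [ffun i => x * v i]); congr psi.
  by apply/ffunP => i; rewrite !ffunE mulrCA mulrA.
Qed.

Lemma char_sum psi (J : Type) (r : seq J) (P : pred J) (F : J -> {ffun 'I_n -> A}) :
  character psi ->
  psi (\sum_(j <- r | P j) F j) = \prod_(j <- r | P j) psi (F j).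
Proof. by move=> cpsi; apply: big_morph; [move=> x y; exact: charD|exact: char0]. Qed.

Lemma charE psi v : character psi -> psi v = \prod_i psi (single i (v i)).
Proof. by move=> cpsi; rewrite {1}[v]ffun_sum_single char_sum. Qed.

Lemma annihilator_single psi x : character psi ->
  annihilator psi x <-> forall i y, psi (single i (x * y)) = 1.
Proof.
move=> cpsi; split=> [xP i y|xP v].
  rewrite -(xP (single i y)); congr psi; apply/ffunP => j; rewrite !ffunE.
  by case: eqP; rewrite ?mulr0.
by rewrite charE // big1 // => i _; rewrite ffunE xP.
Qed.

Lemma annihilator1 psi x i : character psi -> annihilator psi x ->
  psi (single i x) = 1.
Proof.
by move=> cpsi /(annihilator_single _ cpsi)/(_ i 1); rewrite mulr1.
Qed.

(** The coefficients at [f] of the products of the polynomial [\sum_e a_e X^e]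
    with the variables. *)
Definition shadow a (f : Fset m n) (i : 'I_n) :=
  \sum_(e : Eset m n | diff_basis e f i) a e.

Lemma Gmn_form_shadow a b :
  Gmn_form a b = [ffun i => \sum_f shadow a f i * b f].
Proof.
apply/ffunP => i; rewrite !ffunE.
rewrite (exchange_big_dep predT) //=; apply: eq_bigr => f _.
by rewrite mulr_suml.
Qed.

Lemma Gmn_form_single a f y :
  Gmn_form a (single f y) = [ffun i => shadow a f i * y].
Proof.
rewrite Gmn_form_shadow; apply/ffunP => i; rewrite !ffunE (bigD1 f) //=.
rewrite big1 ?addr0 ?ffunE ?eqxx // => f' /negPf ff'.
by rewrite ffunE ff' mulr0.
Qed.

Lemma shadow_diff_basis a e f i : diff_basis e f i -> shadow a f i = a e.
Proof.
move=> ef; rewrite /shadow (bigD1 e) //= big1 ?addr0 // => e' /andP[e'f].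
by rewrite (diff_basis_inj e'f ef) eqxx.
Qed.

Definition radical psi : set {ffun Eset m n -> A} :=
  [set a | forall b, psi (Gmn_form a b) = 1].

Lemma radical_ann psi a : character psi ->
  (forall e, annihilator psi (a e)) -> radical psi a.
Proof.
move=> cpsi aP b; have iI := annihilator_ideal cpsi.
rewrite charE // big1 // => i _; apply: annihilator1 => //.
rewrite ffunE; apply: subgroup_sum; first exact: ideal_subgroup.
move=> e _; apply: subgroup_sum; first exact: ideal_subgroup.
by move=> f _; rewrite mulrC; case: iI => _ _; apply.
Qed.

(** Gauss's lemma: the [a_e] are the coefficients of a polynomial that is
    killed by the linear form with coefficients [psi_i]. If they do not all
    annihilate [psi], some multiple of the polynomial has coefficients in
    [I'], where [I = Q I'] is the annihilator and [Q] is maximal. As [I' / I]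
    is simple, a coefficient outside of [I] annihilates [psi_i] only if [I']
    does, so that the product of two suitable extreme coefficients gives a
    contradiction. *)
Lemma ann_radical psi a : character psi -> nzideal (annihilator psi) ->
  radical psi a -> forall e, annihilator psi (a e).
Proof.
move=> cpsi nI a_rad; set I := annihilator psi in nI *; have iI := nI.1.
have [_ ID IM] := iI.
apply: contrapT => /existsNP[e0 ae0].
pose J : set A := [set x | forall e, I (x * a e)].
have iJ : is_ideal J.
  split => [e|x y Jx Jy e|x y Jy e]; first by rewrite mul0r; case: iI.
    by rewrite mulrDl; apply: ID; [exact: Jx|exact: Jy].
  by rewrite -mulrA; apply: IM; exact: Jy.
have IJ : I `<=` J by move=> x Ix e; rewrite mulrC; exact: IM.
have nJ := nzidealS nI iJ IJ.
have JT : J <> setT.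
  move=> JT; apply: ae0; have : J 1 by rewrite JT.
  by move=> /(_ e0); rewrite mul1r.
have [Q mQ JQ] := ex_maximal_ideal HA nJ JT; have [nQ QT Qmax] := mQ.
(* The multiple is by an element [h] of [J / Q] outside of [J]. *)
have [H iH JE] := ideal_divides HA iJ nQ JQ.
have nH : nzideal H by apply: (nzidealS nJ iH); rewrite JE; exact: idmul_subr.
have [h Hh Jh] : exists2 h, H h & ~ J h.
  apply: contrapT => no; apply: (maximal_not1 mQ).
  apply: (idmul_cancel HA nH (idealT A) nQ.1 _ Logic.I).
  rewrite idmulT // [idmul H Q]idmulC -JE => x Hx.
  by apply: contrapT => Jx; apply: no; exists x.
pose a' e := h * a e.
have [e1 a'e1] : exists e, ~ I (a' e) by apply/existsNP.
have Qa' q e : Q q -> I (q * a' e).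
  move=> Qq; have : J (q * h) by rewrite JE; exact: mem_idmul.
  by move=> /(_ e); rewrite -mulrA.
have IQ : I `<=` Q by move=> x /IJ /JQ.
have [I' iI' IE] := ideal_divides HA iI nQ IQ.
have II' : I `<=` I' by rewrite IE; exact: idmul_subr.
have nI' := nzidealS nI iI' II'.
have a'I' e : I' (a' e).
  apply: (idmul_cancel HA nQ (principal_ideal (a' e)) iI' _ (mem_principal _)).
  rewrite -IE; apply: idmul_sub => // q _ Qq [y ->].
  by rewrite mulrA mulrC; apply: IM; exact: Qa'.
have simple e i : ~ I (a' e) -> (forall y, psi (single i (a' e * y)) = 1) ->
    forall x, I' x -> psi (single i x) = 1.
  move=> Ia' kill x; have iM := adjoin_ideal (a' e) iI.
  have nM := nzidealS nI iM (@sub_adjoin _ I (a' e)).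
  have MI' : adjoin I (a' e) `<=` I'.
    move=> _ [p Ip [q ->]]; case: iI' => _ I'D I'M; apply: I'D; first exact: II'.
    by rewrite mulrC; exact: I'M.
  have [L iL ML] := ideal_divides HA iM nI' MI'.
  have QL : Q `<=` L.
    apply: (idmul_cancel HA nI' nQ.1 iL).
    by rewrite -ML [idmul I' Q]idmulC -IE; exact: sub_adjoin.
  have [LQ|LT] := Qmax L iL QL.
    by case: Ia'; rewrite IE [idmul Q I']idmulC -LQ -ML; exact: mem_adjoin.
  rewrite -(idmulT iI') -LT -ML => -[p Ip [q ->]].
  by rewrite singleD charD // kill mulr1; exact: annihilator1.
(* [i0] is the first variable whose coefficient is not killed by [I'], and [e2]
   the monomial of largest weight with coefficient outside of [I]. Only their
   product contributes to the coefficient at [f]. *)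
pose dead (i : 'I_n) := `[< forall x, I' x -> psi (single i x) = 1 >].
have ex_alive : exists i : nat, [exists i0 : 'I_n, (i0 == i :> nat) && ~~ dead i0].
  apply: contrapT => no; apply: (maximal_not1 mQ).
  apply: (idmul_cancel HA nI' (idealT A) nQ.1 _ Logic.I).
  rewrite idmulT // [idmul I' Q]idmulC -IE => x I'x.
  apply/annihilator_single => // i y.
  have /asboolP : dead i.
    apply: contra_notT no => alive.
    by exists i; apply/existsP; exists i; rewrite eqxx.
  by apply; rewrite mulrC; case: iI' => _ _; apply.
case: (ex_minnP ex_alive) => _ /existsP[i0 /andP[/eqP <- alive]] i0_min.
have live_e1 : `[< ~ I (a' e1) >] by exact/asboolP.
case: (@arg_maxnP _ e1 (fun e => `[< ~ I (a' e) >]) (@weight n m) live_e1).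
move=> e2 /asboolP a'e2 e2_max.
have [f e2f] := ex_diff_basis m_gt0 e2 i0.
case/asboolP: alive; apply: (simple e2) => // y.
have := a_rad (single f (h * y)).
rewrite Gmn_form_single charE // (bigD1 i0) //= big1.
  rewrite mulr1 ffunE (shadow_diff_basis _ e2f) => <-.
  by rewrite /a' mulrA [a e2 * h]mulrC.
move=> i i_neq; rewrite ffunE.
have : (i < i0)%N || (i0 < i)%N by rewrite -neq_ltn -(inj_eq val_inj) in i_neq *.
have sy x : h * y * x = h * x * y by rewrite mulrAC.
rewrite mulrC /shadow mulr_sumr.
under eq_bigr => e _ do rewrite sy.
case/orP => [i_lt|i_gt].
  have /asboolP : dead i.
    apply: contraT => ai; have := i0_min i; rewrite leqNgt i_lt; apply.
    by apply/existsP; exists i; rewrite eqxx.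
  apply; apply: subgroup_sum; first exact: ideal_subgroup.
  by move=> e _; rewrite mulrC; case: iI' => _ _; apply; exact: a'I'.
apply: annihilator1 => //; apply: subgroup_sum; first exact: ideal_subgroup.
move=> e ef; rewrite mulrC; apply: IM; apply: contrapT => a'e.
have /= := e2_max e (asboolT a'e).
by rewrite leqNgt (weight_lt m_gt0 e2f ef i_gt).
Qed.

Lemma radicalE psi : character psi -> nzideal (annihilator psi) ->
  radical psi = [set a | forall e, annihilator psi (a e)].
Proof.
move=> cpsi nI; apply/seteqP; split => a; first exact: ann_radical.
exact: radical_ann.
Qed.

Lemma radical_index psi : character psi -> nzideal (annihilator psi) ->
  has_index setT (radical psi) (ideal_norm (annihilator psi) ^ e_mn m n).
Proof.
move=> cpsi nI; rewrite radicalE // -card_compositions //.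
exact/has_index_ffun/(ideal_normP HA).
Qed.

Lemma count_characters I : nzideal I ->
  exists s, enumerates s [set psi | character psi /\ I `<=` annihilator psi]
            /\ size s = (ideal_norm I ^ n)%N.
Proof.
move=> nI; have iI := nI.1.
have := has_index_ffun 'I_n (ideal_normP HA nI); rewrite card_ord => In.
have sI : subgroup [set v : {ffun 'I_n -> A} | forall i, I (v i)].
  split => [i|u v Iu Iv i]; rewrite !ffunE; first by case: iI.
  by apply: (ideal_subgroup iI).2.
have [|s [sE sn]] := @char_extensions C _ _ (fun=> 1) _ sI _ In.
  by split => // x y _ _; rewrite mulr1.
exists s; split => //; rewrite (_ : [set psi | _] = [set psi | character psi /\
  forall v : {ffun 'I_n -> A}, (forall i, I (v i)) -> psi v = 1]) //.
apply/seteqP; split => psi /= [cpsi psiI]; split => //.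
  move=> v Iv; rewrite charE // big1 // => i _.
  by apply: annihilator1 => //; exact: psiI.
by move=> x Ix v; apply: psiI => i; rewrite ffunE mulrC; case: iI => _ _; apply.
Qed.

End Annihilator.

(** * Representations with a given central character *)

Section LinearAlgebra.
Variables (C : numClosedFieldType) (k : nat).
Hypothesis k_gt0 : (0 < k)%N.

(** On a nonzero invariant subspace of least dimension every member of the
    family acts as a scalar. *)
Lemma commuting_eigenvector (T : Type) (F : T -> 'M[C]_k) :
  (forall s t, F s *m F t = F t *m F s) ->
  exists (v : 'rV[C]_k) (lam : T -> C), v != 0 /\ forall t, v *m F t = lam t *: v.
Proof.
move=> Fcomm.
pose Q r := `[< exists U : 'M[C]_k,
  [/\ \rank U = r, (0 < r)%N & forall t, stablemx U (F t)] >].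
have exQ : exists r, Q r.
  exists k; apply/asboolP; exists 1%:M; split => //; first exact: mxrank1.
  by move=> t; exact: stableCmx.
case: (ex_minnP exQ) => r /asboolP[U [Ur r0 Ustab]] rmin.
have scal t : exists a, (U <= eigenspace (F t) a)%MS.
  pose B := row_base U.
  have [D DE] : exists D, B *m F t = D *m B.
    by apply/submxP; have : stablemx B (F t) by rewrite stablemx_row_base.
  have [a /eigenvalueP[w wD w0]] : exists a, eigenvalue D a.
    by apply: eigenvalue_closed; rewrite Ur.
  exists a; set W := (U :&: eigenspace (F t) a)%MS.
  have WU : (W <= U)%MS by exact: capmxSl.
  have wBW : (w *m B <= W)%MS.
    rewrite sub_capmx; apply/andP; split.
      by rewrite (submx_trans (submxMl _ _)) // eq_row_base.
    by apply/eigenspaceP; rewrite -mulmxA DE mulmxA wD -scalemxAl.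
  have wB0 : w *m B != 0.
    by rewrite mulmx_free_eq0 // row_base_free.
  have W_gt0 : (0 < \rank W)%N.
    by rewrite lt0n mxrank_eq0; apply: contraNneq wB0 => W0; rewrite -submx0 -W0.
  have rW : (r <= \rank W)%N.
    apply: rmin; apply/asboolP; exists W; split => // s.
    rewrite sub_capmx (submx_trans (submxMr _ WU) (Ustab s)) /=.
    apply: submx_trans (submxMr _ (capmxSr _ _)) _.
    exact/comm_mx_stable_eigenspace/Fcomm.
  have UW : (U <= W)%MS by rewrite -(mxrank_leqif_sup WU) eqn_leq Ur rW -Ur mxrankS.
  exact: submx_trans UW (capmxSr _ _).
have /choice[lam lamE] := scal.
exists (nz_row U), lam; split; first by rewrite nz_row_eq0 -mxrank_eq0 Ur -lt0n.
by move=> t; apply/eigenspaceP; apply: submx_trans (nz_row_sub U) (lamE t).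
Qed.

End LinearAlgebra.

Section Schur.
Variables (R : realType) (G : groupType) (k : nat) (rho : G -> 'M[R[i]]_k).

Lemma repr_unit g : is_repr rho -> rho g \in unitmx.
Proof.
move=> [r1 rM]; have : rho g *m rho g^-1%g = 1%:M by rewrite -rM mulgV r1.
by move=> /mulmx1_unit[].
Qed.

Lemma schur (M : 'M[R[i]]_k) : is_irr_repr rho ->
  (forall g, M *m rho g = rho g *m M) -> exists c, M = c%:M.
Proof.
move=> [_ k0 rirr] Mcomm.
have [c /eigenvalueP[v vM v0]] := eigenvalue_closed M k0.
have /row_fullP[D DE] : row_full (eigenspace M c).
  apply: rirr; first by move=> g; exact/comm_mx_stable_eigenspace/Mcomm.
  by apply: contraNneq v0 => E0; rewrite -submx0 -E0; apply/eigenspaceP.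
exists c; have /eigenspaceP : (1%:M <= eigenspace M c)%MS.
  by rewrite -DE; exact: submxMl.
by rewrite mul1mx scalemx1.
Qed.

End Schur.

Section Classification.
Variables (R : realType) (A : comNzRingType) (d : nat).
Variables (HA : integers_like A d) (m n : nat).
Hypotheses (m_gt0 : (0 < m)%N) (n_gt0 : (0 < n)%N).
Notation C := R[i].
Notation G := (Gmn m n A).
Notation VE := {ffun Eset m n -> A}.
Notation VF := {ffun Fset m n -> A}.
Notation VZ := {ffun 'I_n -> A}.
Implicit Types (a : VE) (b : VF) (c : VZ).

Lemma Gmn_formDl a a' b : Gmn_form (a + a') b = Gmn_form a b + Gmn_form a' b.
Proof.
apply/ffunP => i; rewrite !ffunE -big_split; apply: eq_bigr => e _ /=.
by rewrite -big_split; apply: eq_bigr => f _; rewrite ffunE mulrDl.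
Qed.

Lemma Gmn_formDr a b b' : Gmn_form a (b + b') = Gmn_form a b + Gmn_form a b'.
Proof.
apply/ffunP => i; rewrite !ffunE -big_split; apply: eq_bigr => e _ /=.
by rewrite -big_split; apply: eq_bigr => f _; rewrite ffunE mulrDr.
Qed.

Lemma Gmn_form0l b : Gmn_form 0 b = 0.
Proof. by apply: (addrI (Gmn_form 0 b)); rewrite -Gmn_formDl !addr0. Qed.

Lemma Gmn_form0r a : Gmn_form a 0 = 0.
Proof. by apply: (addrI (Gmn_form a 0)); rewrite -Gmn_formDr !addr0. Qed.

Definition elemA a : G := (a, 0, 0).
Definition elemB b : G := (0, b, 0).
Definition elemZ c : G := (0, 0, c).

Lemma GmnM a b c a' b' c' : (((a, b, c) : G) * ((a', b', c') : G))%g =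
  (a + a', b + b', c + c' + Gmn_form a b') :> G.
Proof. by []. Qed.

Definition elemE := (GmnM, Gmn_form0l, Gmn_form0r, addr0, add0r).

Lemma elemA_M a a' : (elemA a * elemA a')%g = elemA (a + a').
Proof. by rewrite /elemA !elemE. Qed.

Lemma elemB_M b b' : (elemB b * elemB b')%g = elemB (b + b').
Proof. by rewrite /elemB !elemE. Qed.

Lemma elemZ_M c c' : (elemZ c * elemZ c')%g = elemZ (c + c').
Proof. by rewrite /elemZ !elemE. Qed.

Lemma elemZ_central c (g : G) : (elemZ c * g)%g = (g * elemZ c)%g.
Proof. by case: g => [[a b] c']; rewrite /elemZ !elemE addrC. Qed.

Lemma elemA_mul a a' b c : (elemA a * (a', b, c))%g =
  (elemZ (c + Gmn_form a b) * (elemB b * elemA (a + a')))%g.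
Proof. by rewrite /elemA /elemB /elemZ !elemE. Qed.

Lemma elem_comm a b :
  (elemA a * elemB b)%g = (elemZ (Gmn_form a b) * (elemB b * elemA a))%g.
Proof. by rewrite /elemA /elemB /elemZ !elemE. Qed.

Lemma elemA_comm a (g : G) :
  (elemA a * g)%g = (elemZ (Gmn_form a g.1.2) * (g * elemA a))%g.
Proof.
by case: g => [[a' b] c]; rewrite /elemA /elemZ !elemE [a + a']addrC [c + _]addrC.
Qed.

Lemma single_form (i : 'I_n) (x : A) : exists a b, Gmn_form a b = single i x.
Proof.
have /card_gt0P[e _] : (0 < #|{: Eset m n}|)%N.
  by rewrite card_compositions // bin_gt0; lia.
have [f ef] := ex_diff_basis m_gt0 e i.
exists (single e x), (single f 1); rewrite Gmn_form_single.
apply/ffunP => j; rewrite !ffunE mulr1 /shadow.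
case: eqP => [->|ji].
  rewrite (bigD1 e) //= ffunE eqxx big1 ?addr0 // => e' /andP[_ /negPf ee'].
  by rewrite ffunE ee'.
rewrite big1 // => e' e'f; rewrite ffunE; case: eqP => // ee'.
by case: ji; rewrite ee' in e'f; exact: (diff_basis_index e'f ef).
Qed.

(** Every multiple of a standard basis vector is a value of the form, and hence
    a commutator of the group. *)
Lemma char_form (psi : VZ -> C) : character psi ->
  (forall a b, psi (Gmn_form a b) = 1) -> forall c, psi c = 1.
Proof.
move=> cpsi psi1 c; rewrite charE // big1 // => i _.
by have [a [b <-]] := single_form i (c i).
Qed.

Definition has_central_char k (rho : G -> 'M[C]_k) (psi : VZ -> C) :=
  forall c, rho (elemZ c) = (psi c)%:M.

(** Taking determinants in [elem_comm] shows that [psi ^ k] is trivial on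
    commutators, so that the integer [k] annihilates [psi]. *)
Lemma central_char_exists k (rho : G -> 'M[C]_k) : is_irr_repr rho ->
  exists psi, [/\ character psi, has_central_char rho psi
    & nzideal (annihilator psi)].
Proof.
move=> rho_irr; have [rho_repr k0 _] := rho_irr; have [rho1 rhoM] := rho_repr.
have /choice[psi psiE] c : exists z, rho (elemZ c) = z%:M.
  by apply: schur rho_irr _ => g; rewrite -!rhoM elemZ_central.
have scal_inj (x y : C) : x%:M = y%:M :> 'M[C]_k -> x = y.
  by move=> /matrixP/(_ (Ordinal k0) (Ordinal k0)); rewrite !mxE eqxx !mulr1n.
have cpsi : character psi.
  split=> [|x y _ _]; apply: scal_inj; first by rewrite -psiE -rho1.
  by rewrite -psiE -elemZ_M rhoM !psiE -scalar_mxM.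
exists psi; split => //; apply: (nat_nzideal HA (k := k)) => //.
  exact: annihilator_ideal.
have psik : forall c, psi c ^+ k = 1.
  apply: (@char_form (fun c => psi c ^+ k)).
    split; first by rewrite (char0 cpsi) expr1n.
    by move=> x y _ _; rewrite charD // exprMn.
  move=> a b; have := congr1 rho (elem_comm a b).
  rewrite !rhoM psiE mul_scalar_mx => /(congr1 determinant).
  rewrite detZ !det_mulmx => detE.
  have det0 g : \det (rho g) != 0.
    by rewrite -unitfE -unitmxE; exact: repr_unit.
  apply: (mulIf (mulf_neq0 (det0 (elemA a)) (det0 (elemB b)))).
  by rewrite mul1r [RHS]detE [\det (rho (elemA a)) * _]mulrC.
move=> v; rewrite -(psik v) -(charMn k (@subgroupT _) cpsi) //; congr psi.
by apply/ffunP => i; rewrite !ffunE ffunMnE mulr_natl.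
Qed.

(** The twisting character is trivial on commutators, hence on the centre. *)
Lemma twist_central_char k (rho rho' : G -> 'M[C]_k) psi : (0 < k)%N ->
  is_repr rho' -> twist_iso rho rho' -> has_central_char rho psi ->
  has_central_char rho' psi.
Proof.
move=> k0 rho'_repr [chi [chi1 chiM] [B Bu BE]] rho_psi c.
have chiZ : forall c, chi (elemZ c) 0 0 = 1.
  apply: (@char_form (fun c => chi (elemZ c) 0 0)).
    split; first by rewrite [elemZ 0](_ : _ = 1%g) // chi1 mxE eqxx.
    by move=> x y _ _; rewrite -elemZ_M chiM mxE big_ord1.
  move=> a b; have := congr1 (fun g => chi g 0 0) (elem_comm a b).
  rewrite !chiM !mxE !big_ord1 !mxE !big_ord1 => h.
  have chi_neq0 g : chi g 0 0 != 0.
    have : chi g *m chi g^-1%g = 1%:M by rewrite -chiM mulgV.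
    move=> /matrixP/(_ 0 0); rewrite !mxE big_ord1 eqxx => e.
    by apply: contraTneq isT => g0; move/eqP: e; rewrite g0 mul0r eq_sym oner_eq0.
  apply: (mulIf (mulf_neq0 (chi_neq0 (elemA a)) (chi_neq0 (elemB b)))).
  by rewrite mul1r [RHS]h [chi (elemA a) 0 0 * _]mulrC.
have := BE (elemZ c); rewrite /repr_twist chiZ scale1r rho_psi mul_scalar_mx.
move=> /(congr1 (mulmx (invmx B))); rewrite mulKmx // -scalemxAr mulVmx //.
by rewrite scalemx1.
Qed.

End Classification.

Lemma has_index_ord (V : zmodType) (M H : set V) k :
  has_index M H k -> exists r : 'I_k -> V, transversal_of r M H.
Proof.
move=> [T [r [[rM rS rI] Tk]]]; case: _ / Tk.
exists (fun i => r (enum_val i)); split=> [//|x /rS[t xt]|i j /rI /enum_val_inj //].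
by exists (enum_rank t); rewrite enum_rankK.
Qed.

Section StandardRepresentation.
Variables (R : realType) (A : comNzRingType) (m n : nat).
Notation C := R[i].
Notation G := (Gmn m n A).
Notation VE := {ffun Eset m n -> A}.
Notation VF := {ffun Fset m n -> A}.
Notation VZ := {ffun 'I_n -> A}.
Variables (psi : VZ -> C) (cpsi : character psi).
Variables (N : nat) (r : 'I_N -> VE) (rP : transversal_of r setT (radical psi)).
Implicit Types (a : VE) (b : VF) (c : VZ).

Lemma radical_subgroup : subgroup (radical psi : set VE).
Proof.
split=> [b|a a' Ha Ha' b]; first by rewrite Gmn_form0l char0.
have e : Gmn_form a b = Gmn_form (a - a') b + Gmn_form a' b.
  by rewrite -Gmn_formDl subrK.
by rewrite -(Ha b) e charD // Ha' mulr1.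
Qed.

Lemma char_form_radical a a' b : radical psi (a - a') ->
  psi (Gmn_form a b) = psi (Gmn_form a' b).
Proof. by move=> /(_ b) h; rewrite -{1}(subrK a' a) Gmn_formDl charD // h mul1r. Qed.

Lemma ex_shift : exists sigma : 'I_N -> VE -> 'I_N,
  forall i a, radical psi (r i + a - r (sigma i a)).
Proof.
have /choice[s sE] (x : 'I_N * VE) : exists j, radical psi (r x.1 + x.2 - r j).
  by case: rP => _ rS _; exact: rS.
by exists (fun i a => s (i, a)) => i a; exact: (sE (i, a)).
Qed.

Definition shift := projT1 (cid ex_shift).

Lemma shiftP i a : radical psi (r i + a - r (shift i a)).
Proof. exact: (projT2 (cid ex_shift)). Qed.

Lemma shift_uniq i a j : radical psi (r i + a - r j) -> shift i a = j.
Proof.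
move=> h; case: rP => _ _ rI; have sR := radical_subgroup.
apply: (rI (shift i a) j).
exact: (subgroup_sub_trans sR (subgroup_subC sR (shiftP i a)) h).
Qed.

Lemma shift0 i : shift i 0 = i.
Proof. by apply: shift_uniq; rewrite addr0 subrr; case: radical_subgroup. Qed.

Lemma shiftD i a a' : shift i (a + a') = shift (shift i a) a'.
Proof.
apply: shift_uniq; have sR := radical_subgroup.
have h : radical psi (r i + (a + a') - (r (shift i a) + a')).
  by rewrite addrA opprD addrACA subrr addr0; exact: shiftP.
exact: (subgroup_sub_trans sR h (shiftP (shift i a) a')).
Qed.

Lemma shift_sub i j : shift i (r j - r i) = j.
Proof. by apply: shift_uniq; rewrite subrKC subrr; case: radical_subgroup. Qed.

(** The representation induced from the character [(a, b, c) |-> psi c] of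
    the inverse image of the radical; its basis is indexed by cosets. *)
Definition std_repr (g : G) : 'M[C]_N :=
  \matrix_(i, j) (psi (g.2 + Gmn_form (r i) g.1.2) *+ (shift i g.1.1 == j)).

Lemma std_reprE i g : delta_mx 0 i *m std_repr g =
  psi (g.2 + Gmn_form (r i) g.1.2) *: delta_mx 0 (shift i g.1.1) :> 'rV[C]_N.
Proof.
by rewrite -rowE; apply/rowP => j; rewrite !mxE eq_sym eqxx mulr_natr.
Qed.

Lemma std_repr_repr : is_repr std_repr.
Proof.
split=> [|[[a b] c] [[a' b'] c']]; apply/row_matrixP => i; rewrite !rowE.
  rewrite std_reprE /= mulmx1 shift0 Gmn_form0r addr0 char0 //.
  exact: scale1r.
rewrite mulmxA !std_reprE /= -scalemxAl std_reprE /= scalerA shiftD.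
congr (_ *: _); rewrite !charD // Gmn_formDr charD //.
have -> : psi (Gmn_form (r (shift i a)) b') = psi (Gmn_form (r i + a) b').
  by apply/esym/char_form_radical; exact: shiftP.
rewrite Gmn_formDl charD //; ring.
Qed.

Lemma std_reprA i a : delta_mx 0 i *m std_repr (elemA a) =
  delta_mx 0 (shift i a) :> 'rV[C]_N.
Proof. by rewrite std_reprE /= add0r Gmn_form0r char0 // scale1r. Qed.

Lemma std_reprZ : has_central_char std_repr psi.
Proof.
move=> c; apply/row_matrixP => i; rewrite !rowE std_reprE /=.
by rewrite Gmn_form0r addr0 shift0 mul_mx_scalar.
Qed.

(** The basis vectors are eigenvectors of the [elemB b] with distinct
    characters. A vector of least support in an invariant subspace is therefore
    a multiple of a basis vector, and the [elemA a] permute the basis. *)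
Lemma std_repr_irr : (0 < N)%N -> is_irr_repr std_repr.
Proof.
move=> N0; split=> //; first exact: std_repr_repr.
move=> U Ustab U0.
pose supp (u : 'rV[C]_N) := #|[set i | u 0 i != 0]%SET|.
pose Q k := `[< exists u, [/\ (u <= U)%MS, u != 0 & supp u = k] >].
have exQ : exists k, Q k.
  exists (supp (nz_row U)); apply/asboolP; exists (nz_row U); split => //.
    exact: nz_row_sub.
  by rewrite nz_row_eq0.
case: (ex_minnP exQ) => k /asboolP[u [uU u0 uk]] kmin.
have /rV0Pn[i ui] := u0.
have u_supp j : u 0 j != 0 -> j = i.
  move=> uj; apply: contrapT => ji.
  have [b bij] : exists b, psi (Gmn_form (r i) b) <> psi (Gmn_form (r j) b).
    apply/existsNP => eqij; apply/ji/esym; case: rP => _ _ rI; apply: (rI i j) => b.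
    rewrite Gmn_formDl charD // eqij -charD // -Gmn_formDl subrr Gmn_form0l.
    exact: char0.
  pose u' := u *m std_repr (elemB b) - psi (Gmn_form (r i) b) *: u.
  have u'E l : u' 0 l = (psi (Gmn_form (r l) b) - psi (Gmn_form (r i) b)) * u 0 l.
    rewrite /u' !mxE (bigD1 l) //= big1 => [|l' l'l].
      by rewrite !mxE /= shift0 eqxx add0r addr0 mulr1n mulrC mulrBl.
    by rewrite !mxE /= shift0 (negPf l'l) mulr0n mulr0.
  have u'U : (u' <= U)%MS.
    rewrite addmx_sub // ?eqmx_opp ?scalemx_sub //.
    by apply: submx_trans (submxMr _ uU) (Ustab _).
  have u'0 : u' != 0.
    apply/rV0Pn; exists j; rewrite u'E mulf_neq0 // subr_eq0.
    by apply/eqP => /esym.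
  have : (supp u' < supp u)%N.
    apply/proper_card/properP; split.
      by apply/fintype.subsetP => l; rewrite !inE u'E mulf_eq0 negb_or => /andP[].
    by exists i; rewrite !inE ?u'E ?subrr ?mul0r ?eqxx.
  by rewrite ltnNge uk kmin //; apply/asboolP; exists u'.
have uE : u = u 0 i *: delta_mx 0 i.
  apply/rowP => j; rewrite !mxE eqxx /=; case: (eqVneq j i) => [->|ji].
    by rewrite mulr1.
  by rewrite mulr0; apply: contra_neq_eq ji => /u_supp.
have iU : ((delta_mx 0 i : 'rV[C]_N) <= U)%MS.
  by rewrite -[delta_mx 0 i](scalerK ui) -uE scalemx_sub.
rewrite -sub1mx; apply/row_subP => j; rewrite row1 -(shift_sub i j) -std_reprA.
exact: submx_trans (submxMr _ iU) (Ustab _).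
Qed.

(** An irreducible representation with central character [psi] can be twisted
    so that the [elemB b] fix a common eigenvector [v] of theirs, and so that
    the [elemA a] with [a] in the radical, which act as scalars, act trivially:
    a common eigenvector of all the [elemA a] shows that these scalars extend
    to a character of the group. After the twist the translates of [v] by
    [elemA (r i)] are permuted up to scalars exactly as the standard basis. *)
Lemma irr_std_repr k (rho : G -> 'M[C]_k) :
  (0 < N)%N -> is_irr_repr rho -> has_central_char rho psi ->
  exists (chi : G -> 'M[C]_1) (B : 'M[C]_(N, k)),
    [/\ is_repr chi, forall g, std_repr g *m B = B *m repr_twist chi rho g,
      row_free B & row_full B].
Proof.
move=> N0 rho_irr rho_psi; have [rho_repr k0 rirr] := rho_irr.
have [rho1 rhoM] := rho_repr.
have [|v [mu [v0 vmu]]] := @commuting_eigenvector _ k k0 _ (fun b => rho (elemB b)).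
  by move=> b b'; rewrite -!rhoM !elemB_M addrC.
have [|w [nu [w0 wnu]]] := @commuting_eigenvector _ k k0 _ (fun a => rho (elemA a)).
  by move=> a a'; rewrite -!rhoM !elemA_M addrC.
have eig_inj (z : 'rV[C]_k) x y : z != 0 -> x *: z = y *: z -> x = y.
  move=> z0 /eqP; rewrite -subr_eq0 -scalerBl scaler_eq0 (negPf z0) orbF.
  by rewrite subr_eq0 => /eqP.
have mu0 : mu 0 = 1.
  by apply: (eig_inj v) => //; rewrite -vmu [elemB 0](_ : _ = 1%g) // rho1 mulmx1 scale1r.
have nu0 : nu 0 = 1.
  by apply: (eig_inj w) => //; rewrite -wnu [elemA 0](_ : _ = 1%g) // rho1 mulmx1 scale1r.
have muD b b' : mu (b + b') = mu b * mu b'.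
  apply: (eig_inj v) => //.
  by rewrite -vmu -elemB_M rhoM mulmxA !vmu -scalemxAl vmu scalerA.
have nuD a a' : nu (a + a') = nu a * nu a'.
  apply: (eig_inj w) => //.
  by rewrite -wnu -elemA_M rhoM mulmxA !wnu -scalemxAl wnu scalerA.
have mu_neq0 b : mu b != 0.
  by apply/eqP => e; have := oner_neq0 C; rewrite -mu0 -(subrr b) muD e mul0r eqxx.
have nu_neq0 a : nu a != 0.
  by apply/eqP => e; have := oner_neq0 C; rewrite -nu0 -(subrr a) nuD e mul0r eqxx.
have rho_rad a : radical psi a -> rho (elemA a) = (nu a)%:M.
  move=> Ha; have [s sE] : exists s, rho (elemA a) = s%:M.
    apply: (schur rho_irr) => g; rewrite -!rhoM elemA_comm [LHS]rhoM rho_psi Ha.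
    by rewrite mul1mx.
  rewrite sE; congr (_%:M); apply: (eig_inj w) => //.
  by rewrite -wnu sE mul_mx_scalar.
pose x (g : G) : C := (nu g.1.1 * mu g.1.2)^-1.
pose chi (g : G) : 'M[C]_1 := (x g)%:M.
have xM g h : x (g * h)%g = x g * x h.
  case: g h => [[a b] c] [[a' b'] c']; rewrite /x /= nuD muD -invfM.
  by congr (_^-1); ring.
have chiE g : chi g 0 0 = x g by rewrite mxE eqxx.
pose rho' := repr_twist chi rho.
have rho'E g : rho' g = x g *: rho g by rewrite /rho' /repr_twist chiE.
have rho'M g h : rho' (g * h)%g = rho' g *m rho' h.
  by rewrite !rho'E xM rhoM -scalemxAr -scalemxAl scalerA [x h * _]mulrC.
have rho'B b : v *m rho' (elemB b) = v.
  by rewrite rho'E -scalemxAr vmu scalerA /x /= nu0 mul1r mulVf // scale1r.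
have rho'Z c : rho' (elemZ m c) = (psi c)%:M.
  by rewrite rho'E rho_psi /x /= nu0 mu0 mulr1 invr1 scale1r.
have rho'A a : radical psi a -> rho' (elemA a) = 1%:M.
  move=> Ha; rewrite rho'E rho_rad // /x /= mu0 mulr1 scale_scalar_mx mulVf //.
pose B : 'M[C]_(N, k) := \matrix_i (v *m rho' (elemA (r i))).
have BE g : std_repr g *m B = B *m rho' g.
  apply/row_matrixP => i; rewrite !row_mul rowK [row i (std_repr g)]rowE std_reprE.
  rewrite -scalemxAl -rowE rowK -mulmxA -rho'M.
  case: g => [[a b] c] /=; rewrite elemA_mul !rho'M rho'Z mul_scalar_mx.
  rewrite -[RHS]scalemxAr [v *m (_ *m _)]mulmxA rho'B; congr (_ *: (_ *m _)).
  have -> : elemA (r i + a) = (elemA (r i + a - r (shift i a)) * elemA (r (shift i a)))%g.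
    by rewrite elemA_M subrK.
  by rewrite rho'M (rho'A _ (shiftP i a)) mul1mx.
have B0 : B != 0.
  apply: contraNneq v0 => B0; have /(congr1 (row (Ordinal N0))) := B0.
  rewrite rowK row0 rho'E => h.
  have xg : x (elemA (r (Ordinal N0))) != 0 by rewrite invr_eq0 mulf_neq0.
  have u := repr_unit (elemA (r (Ordinal N0))) rho_repr.
  apply/eqP; rewrite -(mulmxK u v); move: h; rewrite -scalemxAr => /eqP.
  by rewrite scaler_eq0 (negPf xg) => /eqP ->; rewrite mul0mx.
have Bfull : row_full B.
  suff : row_full <<B>>%MS by rewrite /row_full !genmxE.
  apply: rirr => [g|]; last by rewrite -mxrank_eq0 genmxE mxrank_eq0.
  rewrite (eqmxMr _ (genmxE B)) genmxE.
  have xg : x g != 0 by rewrite invr_eq0 mulf_neq0.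
  have -> : B *m rho g = (x g)^-1 *: (std_repr g *m B).
    by rewrite BE rho'E -scalemxAr scalerA mulVf // scale1r.
  by rewrite scalemx_sub // submxMl.
exists chi, B; split => //.
- split=> [|g h]; first by rewrite /chi /x /= nu0 mu0 mulr1 invr1.
  by rewrite /chi xM scalar_mxM.
- rewrite -kermx_eq0; apply: contraT => K0.
  have [_ _ sirr] := std_repr_irr N0.
  have Kfull : row_full (kermx B).
    apply: sirr => // g; apply/sub_kermxP.
    by rewrite -mulmxA BE mulmxA mulmx_ker mul0mx.
  case/negP: B0; apply/eqP.
  have /sub_kermxP : (1%:M <= kermx B)%MS by rewrite sub1mx.
  by rewrite mul1mx.
Qed.

End StandardRepresentation.

(** * Twist isoclasses *)

Lemma linear_repr_neq0 (R : realType) (G : groupType) (chi : G -> 'M[R[i]]_1) g :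
  is_repr chi -> chi g 0 0 != 0.
Proof.
move=> /(repr_unit g); rewrite unitmxE det_mx11 unitfE.
by [].
Qed.

Lemma linear_reprM (R : realType) (G : groupType) (chi : G -> 'M[R[i]]_1) g h :
  is_repr chi -> chi (g * h)%g 0 0 = chi g 0 0 * chi h 0 0.
Proof. by move=> [_ ->]; rewrite mxE big_ord1. Qed.

Section TwistIsoclasses.
Variables (R : realType) (A : comNzRingType) (d : nat).
Variables (HA : integers_like A d) (m n : nat).
Hypotheses (m_gt0 : (0 < m)%N) (n_gt0 : (0 < n)%N).
Notation C := R[i].
Notation G := (Gmn m n A).
Notation VZ := {ffun 'I_n -> A}.
Implicit Types psi : VZ -> C.

(** The characters with a nonzero annihilator are those of finite order. *)
Definition torsion_character psi := character psi /\ nzideal (annihilator psi).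

Definition psi_norm psi := ideal_norm (annihilator psi).

(** Both representations are, up to twist, the standard one. *)
Lemma twist_iso_central k (rho rho' : G -> 'M[C]_k) psi : torsion_character psi ->
  is_irr_repr rho -> is_irr_repr rho' ->
  has_central_char rho psi -> has_central_char rho' psi -> twist_iso rho rho'.
Proof.
move=> [cpsi nI] irr irr' rho_psi rho'_psi.
have rad_index := radical_index HA n_gt0 m_gt0 cpsi nI.
have [r rP] := has_index_ord rad_index.
have N_gt0 : (0 < ideal_norm (annihilator psi) ^ e_mn m n)%N.
  by rewrite expn_gt0 (ideal_norm_gt0 HA nI).
move: (_ ^ _)%N N_gt0 r rP {rad_index} => N N_gt0 r rP.
have [chi [B [chi_repr BE /eqP Bfree /eqP Bfull]]] :=
  irr_std_repr cpsi rP N_gt0 irr rho_psi.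
have [chi' [B' [chi'_repr B'E B'free _]]] := irr_std_repr cpsi rP N_gt0 irr' rho'_psi.
have Nk : N = k by rewrite -Bfree.
subst N.
have Bu : B \in unitmx by rewrite -row_free_unit /row_free Bfree.
have B'u : B' \in unitmx by rewrite -row_free_unit.
exists (fun g => (chi g 0 0 / chi' g 0 0)%:M).
  split=> [|g h]; last first.
    by rewrite !linear_reprM // -scalar_mxM; congr (_%:M); rewrite invfM; ring.
  by case: chi_repr chi'_repr => -> _ [-> _]; rewrite !mxE eqxx divff // oner_eq0.
exists (invmx B *m B'); first by rewrite unitmx_mul unitmx_inv Bu.
move=> g; rewrite /repr_twist mxE eqxx mulr1n.
have e1 : chi g 0 0 *: rho g = invmx B *m (std_repr rP g *m B).
  by rewrite BE mulKmx.
have e2 : chi' g 0 0 *: rho' g = invmx B' *m (std_repr rP g *m B').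
  by rewrite B'E mulKmx.
apply: (scalerI (linear_repr_neq0 g chi'_repr)).
rewrite scalemxAl scalerA mulrCA divff ?linear_repr_neq0 // mulr1 scalemxAr.
by rewrite e1 e2 -!mulmxA mulKVmx // mulKVmx.
Qed.

Lemma irr_central_dim k (rho : G -> 'M[C]_k) psi : torsion_character psi ->
  is_irr_repr rho -> has_central_char rho psi -> (psi_norm psi ^ e_mn m n)%N = k.
Proof.
move=> [cpsi nI] irr rho_psi.
have [r rP] := has_index_ord (radical_index HA n_gt0 m_gt0 cpsi nI).
have N_gt0 : (0 < ideal_norm (annihilator psi) ^ e_mn m n)%N.
  by rewrite expn_gt0 (ideal_norm_gt0 HA nI).
have [chi [B [_ _ /eqP Bfree /eqP Bfull]]] := irr_std_repr cpsi rP N_gt0 irr rho_psi.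
by rewrite /psi_norm -Bfree Bfull.
Qed.

Definition central_class k psi : set (G -> 'M[C]_k) :=
  [set rho | is_irr_repr rho /\ has_central_char rho psi].

Lemma central_class_nonempty k psi : torsion_character psi ->
  (psi_norm psi ^ e_mn m n)%N = k -> @central_class k psi !=set0.
Proof.
move=> [cpsi nI] <-.
have [r rP] := has_index_ord (radical_index HA n_gt0 m_gt0 cpsi nI).
exists (std_repr rP); split; last exact: (std_reprZ cpsi rP).
by apply: (std_repr_irr cpsi rP); rewrite expn_gt0 (ideal_norm_gt0 HA nI).
Qed.

Lemma central_class_inj k psi psi' : torsion_character psi ->
  (psi_norm psi ^ e_mn m n)%N = k -> @central_class k psi = @central_class k psi' ->
  psi = psi'.
Proof.
move=> tpsi psik eq_class; have [rho [irr rho_psi]] := central_class_nonempty tpsi psik.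
have [_ rho_psi'] : @central_class k psi' rho by rewrite -eq_class.
have [_ k0 _] := irr; apply/funext => c.
have := rho_psi c; rewrite rho_psi' => /matrixP/(_ (Ordinal k0) (Ordinal k0)).
by rewrite !mxE eqxx !mulr1n.
Qed.

(** The class of [rho] is determined by its central character, and a torsion
    character [psi] occurs in exactly one dimension. *)
Lemma twist_isoclassesE k :
  twist_isoclasses R G k = @central_class k @`
    [set psi | torsion_character psi /\ (psi_norm psi ^ e_mn m n)%N = k].
Proof.
have classE rho psi : torsion_character psi -> @central_class k psi rho ->
    twist_isoclass rho = @central_class k psi.
  move=> tpsi [irr rho_psi]; apply/seteqP; split => rho' [irr' h]; split => //.
    have [rho'_repr k0 _] := irr'.
    exact: (twist_central_char m_gt0 n_gt0 k0 rho'_repr h rho_psi).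
  exact: (twist_iso_central tpsi irr irr' rho_psi h).
apply/seteqP; split => X.
  move=> [rho irr <-].
  have [psi [cpsi rho_psi nI]] := central_char_exists HA m_gt0 n_gt0 irr.
  have tpsi : torsion_character psi by split.
  exists psi; last by apply/esym/classE.
  by split => //; exact: (irr_central_dim tpsi irr rho_psi).
move=> [psi [tpsi psik] <-]; have [rho rhoP] := central_class_nonempty tpsi psik.
by exists rho; [exact: rhoP.1|exact: classE].
Qed.

Lemma finite_torsion_characters k :
  finite_set [set psi : VZ -> C | torsion_character psi /\ (psi_norm psi <= k)%N].
Proof.
have [s sE] := finite_enumerates (finite_ideals_norm HA k).
pose T (I : set A) := [set psi : VZ -> C | character psi /\ I `<=` annihilator psi].
apply: (@sub_finite_set _ _ (\bigcup_(I in [set` s]) T I)).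
  move=> psi [[cpsi nI] psik]; exists (annihilator psi); last by split.
  exact/(sE.2 _).
apply: bigcup_finite => [|I /= /(sE.2 _)[nI _]]; first exact: finite_seq.
have [t [tE _]] := count_characters C HA n nI.
exact: (enumerates_finite tE).
Qed.

Lemma e_mn_gt0 : (0 < e_mn m n)%N.
Proof. by rewrite bin_gt0; lia. Qed.

Lemma finite_twist_isoclasses k : (0 < k)%N -> finite_set (twist_isoclasses R G k).
Proof.
move=> k0; rewrite twist_isoclassesE; apply: finite_image.
apply: sub_finite_set (finite_torsion_characters k) => psi [tpsi psik].
split => //; rewrite -psik -{1}(expn1 (psi_norm psi)) leq_pexp2l ?e_mn_gt0 //.
exact: (ideal_norm_gt0 HA tpsi.2).
Qed.

Lemma nb_twist_isoclassesE k s :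
  enumerates s [set psi | torsion_character psi /\ (psi_norm psi ^ e_mn m n)%N = k] ->
  nb_twist_isoclasses R G k = size s.
Proof.
move=> sE; rewrite /nb_twist_isoclasses twist_isoclassesE.
rewrite (nb_elementsE (enumerates_image _ sE)) ?size_map // => psi psi'.
by move=> /set_mem[tpsi psik] _; exact: central_class_inj.
Qed.

End TwistIsoclasses.

(** * Sums over objects of bounded norm *)

Lemma enumerates_perm (T : choiceType) (s t : seq T) (X : set T) :
  enumerates s X -> enumerates t X -> perm_eq s t.
Proof.
move=> [us sX] [ut tX]; apply: uniq_perm => // x.
by apply/idP/idP => [/sX/tX|/tX/sX].
Qed.

Lemma enumerates_filter (T : choiceType) (s : seq T) (X : set T) (p : pred T) :
  enumerates s X -> enumerates [seq x <- s | p x] [set x | X x /\ p x].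
Proof.
move=> [us sX]; split; first exact: filter_uniq.
by move=> x; rewrite mem_filter; split=> [/andP[px /sX]|[/sX -> ->]].
Qed.

Section UpTo.
Variables (T : choiceType) (P : set T) (nu : T -> nat).
Hypothesis P_fin : forall X, finite_set [set x | P x /\ (nu x <= X)%N].
Hypothesis nu_gt0 : forall x, P x -> (0 < nu x)%N.

(** Sums over [upto X] are the partial sums of the Dirichlet series that counts
    the elements of [P] according to the norm [nu]. *)
Definition upto X : seq T := enum_fset (fset_set [set x | P x /\ (nu x <= X)%N]).

Lemma uptoP X : enumerates (upto X) [set x | P x /\ (nu x <= X)%N].
Proof.
split; first exact: fset_uniq.
by move=> x; rewrite /upto in_fset_set // inE.
Qed.

Lemma mem_upto X x : (x \in upto X) <-> P x /\ (nu x <= X)%N.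
Proof. exact: (uptoP X).2. Qed.

Lemma upto0 : upto 0 = [::].
Proof.
case E : (upto 0) => [//|x s]; have : x \in upto 0 by rewrite E mem_head.
by move=> /mem_upto[/nu_gt0]; rewrite leqn0 lt0n => /negPf ->.
Qed.

Lemma upto_eq X x : (nu x <= X)%N -> P x -> x \in upto X.
Proof. by move=> xX Px; apply/mem_upto. Qed.

Lemma perm_upto_filter X Y : (X <= Y)%N ->
  perm_eq (upto X) [seq x <- upto Y | (nu x <= X)%N].
Proof.
move=> XY; apply: (enumerates_perm (uptoP X)); have [uY YP] := uptoP Y.
split; first exact: filter_uniq.
move=> x; rewrite mem_filter; split=> [/andP[xX /YP[]]//|[Px xX]].
by rewrite xX; apply/YP; split => //; exact: leq_trans XY.
Qed.

Lemma perm_uptoS X : perm_eq (upto X.+1)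
  (upto X ++ [seq x <- upto X.+1 | nu x == X.+1]).
Proof.
apply: (enumerates_perm (uptoP X.+1)); have [uX _] := uptoP X; split.
  rewrite cat_uniq uX filter_uniq ?andbT; last by case: (uptoP X.+1).
  apply/hasPn => x; rewrite mem_filter => /andP[/eqP xX _].
  by apply/negP => /mem_upto[_]; rewrite xX ltnn.
move=> x; rewrite mem_cat mem_filter; split.
  case/orP => [/mem_upto[Px xX]|/andP[_ /mem_upto //]]; split => //.
  exact: leqW.
move=> [Px]; rewrite leq_eqVlt ltnS => /orP[/eqP xX|xX]; apply/orP.
  by right; rewrite xX eqxx /= upto_eq // xX.
by left; exact: upto_eq.
Qed.

Lemma nb_elements_upto X : nb_elements [set x | P x /\ nu x = X.+1] =
  size [seq x <- upto X.+1 | nu x == X.+1].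
Proof.
apply: nb_elementsE; split; first by rewrite filter_uniq //; case: (uptoP X.+1).
move=> x; rewrite mem_filter; split=> [/andP[/eqP ? /mem_upto[]]//|[Px xX]].
by rewrite xX eqxx /= upto_eq // xX.
Qed.

Lemma sum_upto (M : nmodType) (g : nat -> M) X :
  \sum_(0 <= k < X) g k.+1 *+ nb_elements [set x | P x /\ nu x = k.+1] =
  \sum_(x <- upto X) g (nu x).
Proof.
elim: X => [|X IH]; first by rewrite big_geq // upto0 big_nil.
rewrite big_nat_recr //= IH (perm_big _ (perm_uptoS X)) big_cat /=; congr (_ + _).
rewrite nb_elements_upto big_filter (eq_bigr (fun=> g X.+1)) => [|x /eqP -> //].
by rewrite -big_filter big_const_seq count_predT iter_addr_0.
Qed.

Lemma dirichlet_partial_upto (R : realType) (a : nat -> nat) (s : R[i]) X :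
  (forall k, (0 < k)%N -> a k = nb_elements [set x | P x /\ nu x = k]) ->
  dirichlet_partial a s X = \sum_(x <- upto X) npowN (nu x) s.
Proof.
move=> aE; rewrite /dirichlet_partial seriesEnat /= -(sum_upto (fun k => npowN k s)).
by apply: eq_bigr => k _; rewrite aE // mulr_natl.
Qed.

End UpTo.

Section Sieve.
Variables (A : comNzRingType) (d : nat) (HA : integers_like A d).
Variables (F : comPzRingType) (g : nat -> F).
Hypothesis gM : forall j k, (0 < j)%N -> (0 < k)%N -> g (j * k) = g j * g k.
Implicit Types (I J P : set A) (S : seq (set A)).

Definition ideals_upto X := upto (@nzideal A) (@ideal_norm A) X.

Lemma ideals_uptoP X :
  enumerates (ideals_upto X) [set I | nzideal I /\ (ideal_norm I <= X)%N].
Proof. exact: uptoP (finite_ideals_norm HA) X. Qed.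

Definition coprime_to S I := `[< forall P, P \in S -> ~ I `<=` P >].

Definition sifted_sum S X := \sum_(I <- ideals_upto X | coprime_to S I) g (ideal_norm I).

(** Sieving by one more maximal ideal [P]: the terms removed are the [P J] with
    [J] not contained in any of the earlier maximal ideals. *)
Lemma sifted_sum_cons P S X : maximal_ideal P -> P \notin S ->
  (forall Q, Q \in S -> maximal_ideal Q) ->
  sifted_sum (P :: S) X =
  sifted_sum S X - g (ideal_norm P) * sifted_sum S (X %/ ideal_norm P).
Proof.
move=> mP PS mS; have [nP PT _] := mP; have NP_gt0 := ideal_norm_gt0 HA nP.
have -> : sifted_sum S X = sifted_sum (P :: S) X +
    \sum_(I <- ideals_upto X | coprime_to S I && `[< I `<=` P >]) g (ideal_norm I).
  rewrite /sifted_sum (bigID (fun I => `[< I `<=` P >])) /= addrC; congr (_ + _).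
  apply: eq_bigl => I; apply/andP/asboolP => [[/asboolP IS /asboolP IP] Q|IPS].
    by rewrite inE => /orP[/eqP ->|/IS].
  split; first by apply/asboolP => Q QS; apply: IPS; rewrite inE QS orbT.
  by apply/asboolP; apply: IPS; exact: mem_head.
apply/esym/eqP; rewrite subr_eq; apply/eqP; congr (_ + _).
rewrite -big_filter mulr_sumr -[RHS]big_filter.
pose small : set (set A) := [set J |
  (nzideal J /\ (ideal_norm J <= X %/ ideal_norm P)%N) /\ coprime_to S J].
have RE : enumerates _ small := enumerates_filter (coprime_to S) (ideals_uptoP _).
pose cut : set (set A) := [set I |
  (nzideal I /\ (ideal_norm I <= X)%N) /\ coprime_to S I && `[< I `<=` P >]].
have LE : enumerates _ cut :=
  enumerates_filter (fun I => coprime_to S I && `[< I `<=` P >]) (ideals_uptoP X).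
have mulP_inj : {in small &, injective (idmul P)}.
  move=> J J' /set_mem[[nJ _] _] /set_mem[[nJ' _] _] JJ'.
  exact: (idmul_inj HA nP nJ.1 nJ'.1).
have := enumerates_image mulP_inj RE.
rewrite (_ : [set idmul P x | x in small] = cut); last first.
  apply/seteqP; split => I /=.
    move=> [J [[nJ JX] /asboolP JS] <-]; split; first split.
    - exact: (nzideal_mul HA).
    - by rewrite (ideal_normM HA) // mulnC -leq_divRL.
    apply/andP; split; last by apply/asboolP; exact: idmul_subl nP.1.
    apply/asboolP => Q QS /(maximal_prime_ideal (mS Q QS))[PQ|]; last exact: JS.
    by move: PS; rewrite (maximal_eq mP (mS Q QS) PQ) QS.
  move=> [[nI IX] /andP[/asboolP IS /asboolP IP]].
  have [J iJ IE] := ideal_divides HA nI.1 nP IP.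
  have nJ : nzideal J by apply: (nzidealS nI iJ); rewrite IE; exact: idmul_subr.
  exists J => //; split; first split => //.
    by rewrite leq_divRL // mulnC -(ideal_normM HA) // -IE.
  by apply/asboolP => Q QS JQ; apply: (IS Q QS) => x; rewrite IE => /(idmul_subr iJ)/JQ.
move=> ME; rewrite (perm_big _ (enumerates_perm LE ME)) big_map.
rewrite big_seq [RHS]big_seq; apply: eq_bigr => J /(RE.2 _)[[nJ _] _].
by rewrite (ideal_normM HA) // gM //; exact: (ideal_norm_gt0 HA).
Qed.

End Sieve.

Section Convolution.
Variables (R : realType) (A : comNzRingType) (d : nat) (HA : integers_like A d).
Variables (n : nat) (F : comPzRingType) (g : nat -> F).
Notation C := R[i].
Notation VZ := {ffun 'I_n -> A}.

Definition torsion_upto X := upto (@torsion_character R A n) (@psi_norm R A n) X.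

Lemma torsion_uptoP X : enumerates (torsion_upto X)
  [set psi | torsion_character psi /\ (psi_norm psi <= X)%N].
Proof. exact: uptoP (@finite_torsion_characters R A d HA n) X. Qed.

Definition pair_set : set ((VZ -> C) * set A) :=
  [set x | torsion_character x.1 /\ nzideal x.2].

Definition pair_norm (x : (VZ -> C) * set A) := (psi_norm x.1 * ideal_norm x.2)%N.

Lemma psi_norm_gt0 (psi : VZ -> C) : torsion_character psi -> (0 < psi_norm psi)%N.
Proof. by move=> [_ /(ideal_norm_gt0 HA)]. Qed.

Lemma pair_factors_le x X : pair_set x -> (pair_norm x <= X)%N ->
  (psi_norm x.1 <= X)%N /\ (ideal_norm x.2 <= X)%N.
Proof.
move=> [/psi_norm_gt0 p0 /(ideal_norm_gt0 HA) q0] xX.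
by split; apply: leq_trans xX; rewrite ?leq_pmulr ?leq_pmull.
Qed.

Lemma finite_pairs X : finite_set [set x | pair_set x /\ (pair_norm x <= X)%N].
Proof.
pose L := [seq (psi, H) | psi <- torsion_upto X, H <- ideals_upto A X].
apply: (@sub_finite_set _ _ [set` L]); last exact: finite_seq.
move=> x [Px xX]; have [p q] := pair_factors_le Px xX; have [tx nx] := Px.
apply/allpairsP; exists x; split; last exact: surjective_pairing.
  by apply/(torsion_uptoP X).2.
by apply/(ideals_uptoP HA X).2.
Qed.

Definition pairs_upto X := upto pair_set pair_norm X.

Lemma pairs_uptoP X :
  enumerates (pairs_upto X) [set x | pair_set x /\ (pair_norm x <= X)%N].
Proof. exact: uptoP finite_pairs X. Qed.

(** The pairs [(psi, H)] correspond to the pairs [(I, psi)] with [I] in the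
    annihilator of [psi], by [I = ann(psi) H]; there are [N(I) ^ n] of them for
    each [I]. *)
Lemma pairs_convolution X : \sum_(x <- pairs_upto X) g (pair_norm x) =
  \sum_(I <- ideals_upto A X) g (ideal_norm I) *+ ideal_norm I ^ n.
Proof.
pose phi (x : (VZ -> C) * set A) := idmul (annihilator x.1) x.2.
have phiN x : pair_set x -> ideal_norm (phi x) = pair_norm x.
  by move=> [[_ n1] n2]; rewrite /phi (ideal_normM HA).
have /choice[S SP] I : exists S, I \in ideals_upto A X -> enumerates S
    [set x | (pair_set x /\ (pair_norm x <= X)%N) /\ phi x = I]
    /\ size S = (ideal_norm I ^ n)%N.
  have [/(ideals_uptoP HA X).2[nI IX]|] := boolP (I \in ideals_upto A X); last first.
    by exists [::].
  have [s [sE sn]] := count_characters C HA n nI.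
  have /choice[H HE] (psi : VZ -> C) : exists H,
      character psi /\ I `<=` annihilator psi -> is_ideal H /\ I = idmul (annihilator psi) H.
    have [[cpsi Ipsi]|] := pselect (character psi /\ I `<=` annihilator psi); last first.
      by exists I.
    have na := nzidealS nI (annihilator_ideal cpsi) Ipsi.
    have [H iH IE] := ideal_divides HA nI.1 na Ipsi.
    by exists H.
  exists [seq (psi, H psi) | psi <- s] => _; rewrite size_map; split => //.
  split; first by rewrite map_inj_uniq ?sE.1 // => psi psi' [].
  move=> x; split.
    move=> /mapP[psi /(sE.2 _)[cpsi Ipsi] ->] /=.
    have [iH IE] := HE psi (conj cpsi Ipsi).
    have na := nzidealS nI (annihilator_ideal cpsi) Ipsi.
    have nH : nzideal (H psi).
      by apply: (nzidealS nI iH); rewrite {1}IE; exact: idmul_subr.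
    have Px : pair_set (psi, H psi) by split.
    by rewrite -phiN // /phi /= -IE.
  move=> [[[[cpsi na] nx2] xX] phix]; apply/mapP; exists x.1.
    apply/(sE.2 _); split => //; rewrite -phix; exact: idmul_subl na.1.
  have Ix : I `<=` annihilator x.1 by rewrite -phix; exact: idmul_subl na.1.
  have [iH IE] := HE _ (conj cpsi Ix).
  rewrite {1}(surjective_pairing x); congr (_, _).
  by apply: (idmul_inj HA na nx2.1 iH); rewrite -IE -phix.
have pE : enumerates (flatten [seq S J | J <- ideals_upto A X])
    [set x | pair_set x /\ (pair_norm x <= X)%N].
  apply: (enumerates_fibers (f := phi)); first by case: (ideals_uptoP HA X).
    by move=> J /SP[].
  move=> x [Px xX]; apply/(ideals_uptoP HA X).2; split; last by rewrite phiN.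
  by apply: (nzideal_mul HA); case: Px => -[].
rewrite (perm_big _ (enumerates_perm (pairs_uptoP X) pE)) /= big_flatten big_map.
rewrite big_seq [RHS]big_seq; apply: eq_bigr => J /SP[SE <-].
rewrite (eq_big_seq (fun=> g (ideal_norm J))) => [|x /(SE.2 _)[[Px _] <-]].
  by rewrite big_const_seq count_predT iter_addr_0.
by rewrite phiN.
Qed.

End Convolution.

(** * Powers of natural numbers *)

Section Powers.
Variable R : realType.
Implicit Types (sigma : R) (s : R[i]).

(** [k ^ (- sigma)] *)
Definition rpowN sigma (k : nat) : R := expR (- (sigma * ln k%:R)).

Lemma rpowN_ge0 sigma k : 0 <= rpowN sigma k.
Proof. exact: expR_ge0. Qed.

Lemma rpowN1 sigma : rpowN sigma 1 = 1.
Proof. by rewrite /rpowN ln1 mulr0 oppr0 expR0. Qed.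

Lemma ln_natM j k : (0 < j)%N -> (0 < k)%N ->
  ln (j * k)%:R = ln j%:R + ln k%:R :> R.
Proof. by move=> j0 k0; rewrite natrM lnM // posrE ltr0n. Qed.

Lemma rpowNM sigma j k : (0 < j)%N -> (0 < k)%N ->
  rpowN sigma (j * k) = rpowN sigma j * rpowN sigma k.
Proof. by move=> j0 k0; rewrite /rpowN ln_natM // mulrDr opprD expRD. Qed.

Lemma ln_nat_ge0 k : 0 <= ln k%:R :> R.
Proof.
case: k => [|k]; first by rewrite ln0.
by apply: ln_ge0; rewrite ler1n.
Qed.

Lemma rpowN_nonincr sigma j k : 0 <= sigma -> (0 < j)%N -> (j <= k)%N ->
  rpowN sigma k <= rpowN sigma j.
Proof.
move=> s0 j0 jk; rewrite ler_expR lerN2 ler_wpM2l // ler_ln ?ler_nat //.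
  by rewrite posrE ltr0n.
by rewrite posrE ltr0n (leq_trans j0).
Qed.

Lemma rpowN_le_half sigma k : 1 <= sigma -> (1 < k)%N -> rpowN sigma k <= 2^-1.
Proof.
move=> s1 k1; apply: (@le_trans _ _ (rpowN sigma 2)).
  by apply: rpowN_nonincr => //; lra.
rewrite -[leRHS](@lnK R) ?posrE ?invr_gt0 ?ltr0n // lnV ?posrE ?ltr0n //.
by rewrite ler_expR lerN2 ler_peMl // ln_nat_ge0.
Qed.

Lemma rpowN_subn sigma n k : (0 < k)%N ->
  rpowN (sigma - n%:R) k = rpowN sigma k * (k ^ n)%:R.
Proof.
move=> k0; rewrite /rpowN mulrBl opprB addrC expRD; congr (_ * _).
by rewrite mulr_natl -lnXn ?ltr0n // -natrX lnK // posrE ltr0n expn_gt0 k0.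
Qed.

(** Telescoping: [k ^ (-1-delta)] is at most
    [((k-1) ^ (-delta) - k ^ (-delta)) / delta]. *)
Lemma sum_rpowN_le sigma X : 1 < sigma ->
  \sum_(1 <= k < X.+1) rpowN sigma k <= 1 + (sigma - 1)^-1.
Proof.
move=> s1; pose delta := sigma - 1; have d0 : 0 < delta by rewrite subr_gt0.
have step k : (0 < k)%N ->
    rpowN sigma k.+1 <= delta^-1 * (rpowN delta k - rpowN delta k.+1).
  move=> k0; rewrite -ler_pdivrMl ?invr_gt0 // invrK.
  have k_gt0 : 0 < k%:R :> R by rewrite ltr0n.
  have lnk : ln k%:R - ln k.+1%:R <= - k.+1%:R^-1 :> R.
    rewrite -ln_div ?posrE ?ltr0n //.
    have -> : k%:R / k.+1%:R = 1 + - k.+1%:R^-1 :> R.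
      rewrite -[X in X - _](@divff _ k.+1%:R) ?pnatr_eq0 // -natr1; field.
      by rewrite natr1 pnatr_eq0.
    by apply: le_ln1Dx; rewrite ltrN2 invf_lt1 ?ltr0n // ltr1n.
  have -> : rpowN sigma k.+1 = rpowN delta k.+1 * k.+1%:R^-1.
    rewrite -[k.+1%:R^-1](@lnK R) ?posrE ?invr_gt0 ?ltr0n // -expRD.
    by rewrite lnV ?posrE ?ltr0n //; congr expR; rewrite /delta; ring.
  have -> : rpowN delta k = rpowN delta k.+1 * expR (delta * (ln k.+1%:R - ln k%:R)).
    by rewrite -expRD; congr expR; ring.
  rewrite -[X in _ - X]mulr1 -mulrBr mulrCA ler_wpM2l ?rpowN_ge0 // lerBrDl.
  apply: le_trans (expR_ge1Dx _); rewrite lerD2l; apply: ler_wpM2l; first exact: ltW.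
  by rewrite -lerN2 opprB.
case: X => [|X]; first by rewrite big_geq // addr_ge0 // invr_ge0 ltW.
suff : \sum_(1 <= k < X.+2) rpowN sigma k <= 1 + delta^-1 * (1 - rpowN delta X.+1).
  move=> /le_trans; apply; rewrite lerD2l; apply: ler_piMr; first by rewrite invr_ge0 ltW.
  by rewrite gerBl rpowN_ge0.
elim: X => [|X IH]; first by rewrite big_nat1 !rpowN1 subrr mulr0 addr0.
rewrite big_nat_recr //=; apply: le_trans (lerD IH (step X.+1 isT)) _.
by rewrite -addrA -mulrDr addrA subrK.
Qed.

Lemma Re_mulnat s k : complex.Re (s * k%:R) = complex.Re s * k%:R /\
  complex.Im (s * k%:R) = complex.Im s * k%:R.
Proof.
have -> : (k%:R : R[i]) = (k%:R)%:C%C by rewrite rmorph_nat.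
by case: s => a b; split; rewrite /= mulr0 ?subr0 ?add0r.
Qed.

Lemma Re_subnat s k : complex.Re (s - k%:R) = complex.Re s - k%:R /\
  complex.Im (s - k%:R) = complex.Im s.
Proof.
have -> : (k%:R : R[i]) = (k%:R)%:C%C by rewrite rmorph_nat.
by case: s => a b; split; rewrite /= ?subr0.
Qed.

Lemma norm_npowN k s : `|npowN k s| = (rpowN (complex.Re s) k)%:C%C.
Proof.
rewrite normc_def /npowN /=; congr (_%:C)%C.
rewrite sqrrN !exprMn -mulrDr cos2Dsin2 mulr1 sqrtr_sqr ger0_norm // expR_ge0.
Qed.

Lemma npowNM j k s : (0 < j)%N -> (0 < k)%N ->
  npowN (j * k) s = npowN j s * npowN k s.
Proof.
move=> j0 k0; rewrite /npowN ln_natM //; apply/eqP; rewrite eq_complex /=.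
by rewrite !mulrDr opprD expRD cosD sinD; apply/andP; split; apply/eqP; ring.
Qed.

Lemma npowN1 s : npowN 1 s = 1.
Proof. by rewrite /npowN ln1 !mulr0 oppr0 expR0 cos0 sin0 !mul1r oppr0. Qed.

Lemma npowNX k e s : (0 < k)%N -> npowN (k ^ e) s = npowN k (s * e%:R).
Proof.
move=> k0; rewrite /npowN natrX lnXn ?ltr0n //; have [-> ->] := Re_mulnat s e.
have E (x : R) : x * (ln k%:R *+ e) = x * e%:R * ln k%:R.
  by rewrite -[ln k%:R *+ e]mulr_natl mulrA.
by rewrite !E.
Qed.

Lemma npowN_subn n k s : (0 < k)%N ->
  npowN k (s - n%:R) = npowN k s *+ (k ^ n).
Proof.
move=> k0; rewrite -[RHS]mulr_natr.
have -> : ((k ^ n)%:R : R[i]) = ((k ^ n)%:R)%:C%C by rewrite rmorph_nat.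
have := rpowN_subn (complex.Re s) n k0; rewrite /npowN /rpowN.
have [-> ->] := Re_subnat s n => ->.
by apply/eqP; rewrite eq_complex /=; apply/andP; split; apply/eqP; ring.
Qed.

End Powers.

(** * Convergence of complex series *)

Section ComplexSeries.
Variable R : realType.
Implicit Types (u : nat -> R[i]) (v : nat -> R) (l : R[i]).

Lemma complex_squeeze (u : nat -> R[i]^o) (l : R[i]^o) v :
  (forall k, `|u k - l| <= (v k)%:C%C) -> v @ \oo --> (0 : R) -> u @ \oo --> l.
Proof.
move=> uv v0; apply/cvgrPdist_lt => e e0.
have eE : e = (complex.Re e)%:C%C.
  by rewrite [LHS]complexE (ger0_Im (ltW e0)) mulr0 addr0.
have Re_gt0 : 0 < complex.Re e by rewrite -ltcR -eE.
have /cvgrPdist_lt/(_ _ Re_gt0) := v0.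
apply: filterS => k; rewrite sub0r normrN => vk.
rewrite distrC; apply: le_lt_trans (uv k) _; rewrite eE ltcR.
exact: le_lt_trans (ler_norm _) vk.
Qed.

Lemma complex_cvg_parts (u : nat -> R[i]^o) :
  cvgn (fun k => complex.Re (u k)) -> cvgn (fun k => complex.Im (u k)) -> cvgn u.
Proof.
move=> cr ci; apply/cvg_ex.
pose a := limn (fun k => complex.Re (u k)); pose b := limn (fun k => complex.Im (u k)).
exists (Complex a b).
apply: (@complex_squeeze u _
  (fun k => `|complex.Re (u k) - a| + `|complex.Im (u k) - b|)).
  move=> k; case: (u k) => x y /=; rewrite normc_def /= lecR.
  rewrite -[leRHS]ger0_norm ?addr_ge0 // -[leRHS]sqrtr_sqr ler_wsqrtr //.
  rewrite -[(x - a) ^+ 2]real_normK ?num_real // -[(y - b) ^+ 2]real_normK ?num_real //.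
  have := mulr_ge0 (normr_ge0 (x - a)) (normr_ge0 (y - b)).
  by rewrite [(_ + _) ^+ 2]sqrrD; lra.
rewrite -[X in _ --> X](addr0 (0 : R)); apply: cvgD.
  rewrite -(normr0 R) -[X in `|X|](subrr a); apply: cvg_norm.
  by apply: cvgB => //; exact: cvg_cst.
rewrite -(normr0 R) -[X in `|X|](subrr b); apply: cvg_norm.
by apply: cvgB => //; exact: cvg_cst.
Qed.

Lemma complex_series_cvg (u : nat -> R[i]) v M :
  (forall k, `|u k| <= (v k)%:C%C) -> (forall k, series v k <= M) ->
  cvgn (series (u : nat -> R[i]^o)).
Proof.
move=> uv vM.
have v_ge0 k : 0 <= v k by rewrite -ler0c; exact: le_trans (uv k).
have cv : cvgn (series v).
  apply: nondecreasing_is_cvgn; last by exists M => _ [k _ <-].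
  apply/nondecreasing_seqP => k; rewrite !seriesEnat /= big_nat_recr //=.
  by rewrite lerDl.
have part (f : R[i] -> R) : (forall x y, f (x + y) = f x + f y) ->
      (forall x, `|f x| <= complex.Re `|x|) ->
    cvgn (fun k => f (series (u : nat -> R[i]^o) k)).
  move=> fD f_le.
  have f0 : f 0 = 0 by apply: (addrI (f 0)); rewrite -fD !addr0.
  have -> : (fun k => f (series (u : nat -> R[i]^o) k)) = series (f \o u).
    by apply/funext => k; rewrite !seriesEnat /= (big_morph f fD f0).
  apply: normed_cvg; apply: (series_le_cvg _ v_ge0 _ cv) => k /=; first exact: normr_ge0.
by apply: le_trans (f_le _) _; have := uv k; rewrite lecE => /andP[].
apply: complex_cvg_parts; apply: part => //.
- by case=> a b [a' b'].
- case=> a b; rewrite normc_def /= -[leLHS]sqrtr_sqr ler_wsqrtr //.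
  by rewrite lerDl sqr_ge0.
- by case=> a b [a' b'].
- case=> a b; rewrite normc_def /= -[leLHS]sqrtr_sqr ler_wsqrtr //.
  by rewrite lerDr sqr_ge0.
Qed.

End ComplexSeries.

(** * The Dedekind zeta function to the right of 1 *)

Section ZetaBound.
Variables (R : realType) (A : comNzRingType) (d : nat) (HA : integers_like A d).
Implicit Types (I J P : set A) (S : seq (set A)).

Lemma sifted_sum_ge0 (g : nat -> R) S X : (forall k, 0 <= g k) ->
  0 <= sifted_sum g S X.
Proof. by move=> g0; apply: sumr_ge0. Qed.

Lemma sifted_sum_nondecr (g : nat -> R) S X Y : (forall k, 0 <= g k) ->
  (X <= Y)%N -> sifted_sum g S X <= sifted_sum g S Y.
Proof.
move=> g0 XY; rewrite /sifted_sum.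
rewrite (perm_big _ (perm_upto_filter (finite_ideals_norm HA) XY)).
rewrite big_filter_cond /= [leRHS](bigID (fun I => (ideal_norm I <= X)%N)) /=.
rewrite [X in _ <= X + _](eq_bigl (fun I => (ideal_norm I <= X)%N && coprime_to S I)).
  by rewrite lerDl; apply: sumr_ge0.
by move=> I; rewrite andbC.
Qed.

(** Each maximal ideal that is sieved out reduces the sum by at most the
    factor [1 - N(P) ^ (- sigma)]. *)
Lemma sifted_sum_lower (g : nat -> R) S X : (forall k, 0 <= g k) ->
  (forall j k, (0 < j)%N -> (0 < k)%N -> g (j * k)%N = g j * g k) ->
  uniq S -> (forall P, P \in S -> maximal_ideal P /\ g (ideal_norm P) <= 2^-1) ->
  sifted_sum (A := A) g [::] X * \prod_(P <- S) (1 - g (ideal_norm P)) <=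
  sifted_sum g S X.
Proof.
move=> g0 gM; elim: S => [|P S IHS] /=; first by rewrite big_nil mulr1.
move=> /andP[PS uS] SP; have [mP gP] := SP P (mem_head _ _).
have SP' Q : Q \in S -> maximal_ideal Q /\ g (ideal_norm Q) <= 2^-1.
  by move=> QS; apply: SP; rewrite inE QS orbT.
rewrite (sifted_sum_cons HA gM X mP PS) => [|Q /SP'[]//].
rewrite big_cons mulrCA.
apply: (@le_trans _ _ ((1 - g (ideal_norm P)) * sifted_sum g S X)).
  by rewrite ler_wpM2l ?IHS //; lra.
rewrite mulrBl mul1r lerD2l lerN2 ler_wpM2l // sifted_sum_nondecr //.
exact: leq_div.
Qed.

Definition maximal_upto X := [seq P <- ideals_upto A X | `[< maximal_ideal P >]].

Lemma mem_maximal_upto X P :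
  P \in maximal_upto X -> maximal_ideal P /\ (ideal_norm P <= X)%N.
Proof. by rewrite mem_filter => /andP[/asboolP mP /(ideals_uptoP HA X).2[]]. Qed.

Lemma maximal_norm_gt1 P : maximal_ideal P -> (1 < ideal_norm P)%N.
Proof.
move=> [nP PT _]; rewrite ltn_neqAle (ideal_norm_gt0 HA nP) andbT.
by apply/eqP => /esym/(ideal_norm_eq1 HA nP).
Qed.

Lemma coprime_maximal_upto X I : nzideal I -> coprime_to (maximal_upto X) I ->
  I <> setT -> (X < ideal_norm I)%N.
Proof.
move=> nI /asboolP Icop IT; have [P mP IP] := ex_maximal_ideal HA nI IT.
rewrite ltnNge; apply/negP => IX; apply: (Icop P _ IP).
rewrite mem_filter; apply/andP; split; first exact/asboolP.
have [nP _ _] := mP; apply/(ideals_uptoP HA X).2; split => //.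
have [l _ IE] := ideal_normS HA nI nP.1 IP.
apply: leq_trans IX; rewrite IE leq_pmulr //.
by have := ideal_norm_gt0 HA nI; rewrite IE muln_gt0 => /andP[].
Qed.

Lemma prime_below_ex : exists p : set A -> nat, forall P, maximal_ideal P ->
  [/\ prime (p P), P (p P)%:R & (p P <= ideal_norm P)%N].
Proof.
have /choice[p pP] (P : set A) : exists p, maximal_ideal P ->
    [/\ prime p, P p%:R & (p <= ideal_norm P)%N].
  have [mP|] := pselect (maximal_ideal P); last by exists 0%N.
  have [p p_prime Pp] := maximal_has_prime HA mP.
  exists p => _; split => //; apply: dvdn_leq (maximal_dvdn_norm HA mP p_prime Pp).
  by have [nP _ _] := mP; exact: (ideal_norm_gt0 HA nP).
by exists p.
Qed.

(** At most [d] of the maximal ideals lie above each rational prime. *)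
Lemma sum_maximal_le sigma X : 1 < sigma ->
  \sum_(P <- maximal_upto X) rpowN sigma (ideal_norm P) <=
  d%:R * (1 + (sigma - 1)^-1) :> R.
Proof.
move=> s1; have [p pP] := prime_below_ex.
apply: (@le_trans _ _ (\sum_(P <- maximal_upto X) rpowN sigma (p P))).
  rewrite big_seq [leRHS]big_seq; apply: ler_sum => P /mem_maximal_upto[mP _].
  have [p_prime _ pN] := pP P mP; apply: rpowN_nonincr => //; first lra.
  exact: prime_gt0.
have pX P : P \in maximal_upto X -> (p P < X.+1)%N.
  move=> /mem_maximal_upto[mP PX]; have [_ _ pN] := pP P mP.
  by rewrite ltnS (leq_trans pN).
rewrite (partition_big (fun P => inord (p P) : 'I_X.+1) predT) //=.
apply: (@le_trans _ _ (\sum_(k < X.+1) (if k == ord0 then 0 else d%:R * rpowN sigma k))).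
  apply: ler_sum => k _.
  rewrite big_seq_cond.
  rewrite (eq_bigl (fun P => (P \in maximal_upto X) && (p P == k))); last first.
    move=> P; case: (boolP (P \in _)) => //= PX.
    by rewrite -(inj_eq val_inj) /= inordK ?pX.
  rewrite (eq_bigr (fun=> rpowN sigma k)); last by move=> P /andP[_ /eqP ->].
  rewrite -big_seq_cond -big_filter big_const_seq count_predT iter_addr_0.
  set s := [seq P <- _ | _].
  have sP P : P \in s -> maximal_ideal P /\ p P = k :> nat.
    by rewrite mem_filter => /andP[/eqP pk /mem_maximal_upto[]].
  have us : uniq s by rewrite !filter_uniq //; case: (ideals_uptoP HA X).
  case: eqP => [k0|k0].
    case E : s => [|P s']; first by rewrite mulr0n.
    have [|mP] := sP P; first by rewrite E mem_head.
    by have [/prime_gt0 + _ _] := pP P mP => + pk; rewrite pk k0.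
  rewrite -[leLHS]mulr_natl ler_wpM2r ?rpowN_ge0 // ler_nat.
  case E : s => [|P s']; first by [].
  have [|mP pk] := sP P; first by rewrite E mem_head.
  rewrite -E; have [p_prime _ _] := pP P mP; rewrite pk in p_prime.
  apply: (maximal_above_prime HA p_prime us) => Q /sP[mQ Qk]; split => //.
  by have [_ + _] := pP Q mQ; rewrite Qk.
rewrite big_ord_recl /= add0r -mulr_sumr ler_wpM2l //.
rewrite -(big_mkord predT (fun k => rpowN sigma k.+1)).
by rewrite -(big_add1 _ _ 0 X.+1 predT) sum_rpowN_le.
Qed.

(** Sieving by all maximal ideals of norm at most [X] leaves the unit ideal
    alone. The product of the factors [1 - N(P) ^ (- sigma)] is bounded from
    below, as [1 - x] is at least [exp (- 2 x)] for [x <= 1 / 2] and the sum of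
    the [N(P) ^ (- sigma)] is bounded. *)
Lemma zeta_bounded sigma : 1 < sigma -> exists M, forall X,
  \sum_(I <- ideals_upto A X) rpowN sigma (ideal_norm I) <= M :> R.
Proof.
move=> s1; exists (expR (2 * (d%:R * (1 + (sigma - 1)^-1)))) => X.
pose g := @rpowN R sigma; have g0 k : 0 <= g k by exact: rpowN_ge0.
have -> : \sum_(I <- ideals_upto A X) g (ideal_norm I) = sifted_sum (A := A) g [::] X.
  by apply: eq_bigl => I; apply/esym/asboolP.
have sS P : P \in maximal_upto X -> maximal_ideal P /\ g (ideal_norm P) <= 2^-1.
  move=> /mem_maximal_upto[mP _]; split => //.
  by apply: rpowN_le_half; [lra|exact: maximal_norm_gt1].
have uS : uniq (maximal_upto X) by rewrite filter_uniq //; case: (ideals_uptoP HA X).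
have low := sifted_sum_lower X g0 (rpowNM sigma) uS sS.
have top : sifted_sum g (maximal_upto X) X <= 1.
  rewrite /sifted_sum big_seq_cond.
  rewrite (eq_bigr (fun=> 1)); last first.
    move=> I /andP[/(ideals_uptoP HA X).2[nI IX] Icop].
    have [->|IT] := pselect (I = setT); first by rewrite (ideal_normT A) /g rpowN1.
    by have := coprime_maximal_upto nI Icop IT; rewrite ltnNge IX.
  rewrite -big_seq_cond -big_filter big_const_seq count_predT iter_addr_0.
  set s := [seq I <- _ | _]; suff : (size s <= 1)%N.
    by rewrite -(ler_nat R) => /le_trans; exact.
  have us : uniq s by rewrite filter_uniq //; case: (ideals_uptoP HA X).
  suff sT : {subset s <= [:: setT]} by exact: (uniq_leq_size us sT).
  move=> I; rewrite mem_filter inE => /andP[Icop /(ideals_uptoP HA X).2[nI IX]].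
  apply/eqP; apply: contrapT => IT.
  by have := coprime_maximal_upto nI Icop IT; rewrite ltnNge IX.
have prod_low : expR (- (2 * \sum_(P <- maximal_upto X) g (ideal_norm P))) <=
    \prod_(P <- maximal_upto X) (1 - g (ideal_norm P)).
  elim: (maximal_upto X) sS => [|P S IHS] SP.
    by rewrite !big_nil mulr0 oppr0 expR0.
  rewrite !big_cons mulrDr opprD expRD; apply: ler_pM; rewrite ?expR_ge0 //; last first.
    by apply: IHS => Q QS; apply: SP; rewrite inE QS orbT.
  have [_] := SP P (mem_head _ _); have := g0 (ideal_norm P).
  set x := g _ => x0 x_half.
  rewrite expRN -[leLHS]mul1r ler_pdivrMr ?expR_gt0 //.
  apply: (@le_trans _ _ ((1 - x) * (1 + 2 * x))); first by nra.
  by rewrite ler_wpM2l ?expR_ge1Dx //; lra.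
have full_le : sifted_sum (A := A) g [::] X *
    expR (- (2 * \sum_(P <- maximal_upto X) g (ideal_norm P))) <= 1.
  by apply: le_trans top; apply: le_trans low; rewrite ler_wpM2l // sifted_sum_ge0.
rewrite expRN ler_pdivrMr ?expR_gt0 // mul1r in full_le.
apply: le_trans full_le _; rewrite ler_expR ler_wpM2l //.
exact: sum_maximal_le.
Qed.

End ZetaBound.

(** * Limits of the sums *)

Section UptoLimits.
Variables (R : realType) (T : choiceType) (P : set T) (nu : T -> nat).
Hypothesis P_fin : forall X, finite_set [set x | P x /\ (nu x <= X)%N].
Hypothesis nu_gt0 : forall x, P x -> (0 < nu x)%N.

Lemma upto_cvg (s : R[i]) M :
  (forall X, \sum_(x <- upto P nu X) rpowN (complex.Re s) (nu x) <= M) ->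
  cvgn (fun X => \sum_(x <- upto P nu X) npowN (nu x) s : R[i]^o).
Proof.
move=> bound.
pose a k := nb_elements [set x | P x /\ nu x = k.+1].
have -> : (fun X => \sum_(x <- upto P nu X) npowN (nu x) s : R[i]^o) =
    series (fun k => npowN k.+1 s *+ a k : R[i]^o).
  apply/funext => X; rewrite seriesEnat /=.
  by rewrite -(sum_upto P_fin nu_gt0 (fun k => npowN k s)).
apply: (@complex_series_cvg _ _ (fun k => rpowN (complex.Re s) k.+1 *+ a k) M).
  by move=> k; rewrite normrMn norm_npowN -rmorphMn.
by move=> X; rewrite seriesEnat /= (sum_upto P_fin nu_gt0 (rpowN (complex.Re s))).
Qed.

Lemma upto_nondecr (g : nat -> R) X Y : (forall k, 0 <= g k) -> (X <= Y)%N ->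
  \sum_(x <- upto P nu X) g (nu x) <= \sum_(x <- upto P nu Y) g (nu x).
Proof.
move=> g0 XY; rewrite -!(sum_upto P_fin nu_gt0 g) [leRHS](@big_cat_nat _ _ _ X) //=.
by rewrite lerDl; apply: sumr_ge0 => k _; exact: mulrn_wge0.
Qed.

End UptoLimits.

Lemma cvgn_sqr : (fun X : nat => X * X)%N @ \oo --> \oo.
Proof.
apply/cvgnyPge => B; exists B => // X /= BX.
by rewrite (leq_trans BX) //; case: X {BX} => // X; rewrite leq_pmulr.
Qed.

Section ZetaLimits.
Variables (R : realType) (A : comNzRingType) (d : nat).
Variables (HA : integers_like A d) (n : nat).
Notation C := R[i].
Implicit Types (w : C) (sigma : R).

Definition zeta_sum w X : C := \sum_(I <- ideals_upto A X) npowN (ideal_norm I) w.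

Definition torsion_sum w X : C :=
  \sum_(psi <- torsion_upto R A n X) npowN (psi_norm psi) w.

Definition pair_sum sigma X : R :=
  \sum_(x <- pairs_upto R A n X) rpowN sigma (pair_norm x).

Let ideal_gt0 := ideal_norm_gt0 HA.
Let torsion_gt0 := @psi_norm_gt0 R A d HA n.

Let pair_gt0 x : @pair_set R A n x -> (0 < pair_norm x)%N.
Proof. by move=> [/torsion_gt0 p0 /ideal_gt0 q0]; rewrite muln_gt0 p0. Qed.

Lemma zeta_cvg w : 1 < complex.Re w -> cvgn (zeta_sum w : nat -> C^o).
Proof.
move=> w1; have [M MP] := zeta_bounded HA w1.
exact: (upto_cvg (finite_ideals_norm HA) ideal_gt0 MP).
Qed.

Lemma pair_sumE sigma X : pair_sum sigma X =
  \sum_(I <- ideals_upto A X) rpowN (sigma - n%:R) (ideal_norm I).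
Proof.
rewrite /pair_sum (pairs_convolution R HA n (rpowN sigma)) big_seq [RHS]big_seq.
apply: eq_bigr => I /(ideals_uptoP HA X).2[/ideal_gt0 I0 _].
by rewrite rpowN_subn // mulr_natr.
Qed.

Lemma pair_zeta_sum w X :
  \sum_(x <- pairs_upto R A n X) npowN (pair_norm x) w = zeta_sum (w - n%:R) X.
Proof.
rewrite (pairs_convolution R HA n (fun k => npowN k w)) big_seq /zeta_sum [RHS]big_seq.
apply: eq_bigr => I /(ideals_uptoP HA X).2[/ideal_gt0 I0 _].
by rewrite npowN_subn.
Qed.

Lemma pair_sum_cvg sigma : n%:R + 1 < sigma -> cvgn (pair_sum sigma).
Proof.
move=> sn; have [|M MP] := @zeta_bounded R A d HA (sigma - n%:R); first lra.
apply: nondecreasing_is_cvgn; last first.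
  by exists M => _ [X _ <-]; rewrite pair_sumE.
move=> X Y.
exact: (upto_nondecr (@finite_pairs R A d HA n) pair_gt0 (rpowN_ge0 sigma)).
Qed.

(** A product of two partial sums is a sum over a box, which contains the pairs
    of norm at most [X] and is contained in those of norm at most [X ^ 2]. *)
Definition box X : seq (({ffun 'I_n -> A} -> C) * set A) :=
  [seq (psi, H) | psi <- torsion_upto R A n X, H <- ideals_upto A X].

Lemma boxP X : enumerates (box X) [set x | pair_set x /\
  ((psi_norm x.1 <= X)%N && (ideal_norm x.2 <= X)%N)].
Proof.
have [uT TP] := torsion_uptoP R HA n X; have [uI IP] := ideals_uptoP HA X.
split; first by apply: allpairs_uniq => // -[x1 x2] [y1 y2] _ _ [-> ->].
move=> x; split.
  by move=> /allpairsP[[p q] /= [/TP[tp pX] /IP[nq qX] ->]] /=; rewrite pX.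
move=> [[tx nx] /andP[pX qX]]; apply/allpairsP; exists x; split.
- by apply/TP.
- by apply/IP.
- exact: surjective_pairing.
Qed.

Lemma box_sum (F : comPzRingType) (g : nat -> F) X :
  (forall j k, (0 < j)%N -> (0 < k)%N -> g (j * k)%N = g j * g k) ->
  \sum_(x <- box X) g (pair_norm x) =
  (\sum_(psi <- torsion_upto R A n X) g (psi_norm psi)) *
  (\sum_(I <- ideals_upto A X) g (ideal_norm I)).
Proof.
move=> gM; rewrite /box big_allpairs big_distrlr /=.
rewrite big_seq [RHS]big_seq.
apply: eq_bigr => psi /(torsion_uptoP R HA n X).2[/torsion_gt0 p0 _].
rewrite big_seq [RHS]big_seq; apply: eq_bigr => I /(ideals_uptoP HA X).2[/ideal_gt0 I0 _].
exact: gM.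
Qed.

Lemma box_pairs (F : comPzRingType) (g : nat -> F) X :
  \sum_(x <- box X | (pair_norm x <= X)%N) g (pair_norm x) =
  \sum_(x <- pairs_upto R A n X) g (pair_norm x).
Proof.
rewrite -big_filter; apply: perm_big.
have [uB BP] := boxP X; apply: (enumerates_perm _ (pairs_uptoP R HA n X)).
split; first exact: filter_uniq.
move=> x; rewrite mem_filter; split; first by move=> /andP[xX /BP[]].
move=> [Px xX]; rewrite xX; apply/BP; split => //.
by have [-> ->] := pair_factors_le HA Px xX.
Qed.

Lemma box_sum_le sigma X :
  \sum_(x <- box X) rpowN sigma (pair_norm x) <= pair_sum sigma (X * X).
Proof.
pose p (x : ({ffun 'I_n -> A} -> C) * set A) :=
  (psi_norm x.1 <= X)%N && (ideal_norm x.2 <= X)%N.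
have [uP PP] := pairs_uptoP R HA n (X * X).
have E : perm_eq (box X) [seq x <- pairs_upto R A n (X * X) | p x].
  apply: (enumerates_perm (boxP X)); split; first exact: filter_uniq.
  move=> x; rewrite mem_filter; split; first by move=> /andP[px /PP[]].
  move=> [Px /andP[pX qX]]; rewrite {1}/p pX qX; apply/PP; split => //.
  exact: leq_mul.
rewrite (perm_big _ E) big_filter /pair_sum [leRHS](bigID p) /=.
by rewrite lerDl; apply: sumr_ge0 => x _; exact: rpowN_ge0.
Qed.

Lemma torsion_bounded sigma : n%:R + 1 < sigma -> exists M, forall X,
  \sum_(psi <- torsion_upto R A n X) rpowN sigma (psi_norm psi) <= M :> R.
Proof.
move=> sn; have [|M MP] := @zeta_bounded R A d HA (sigma - n%:R); first lra.
exists (Num.max 0 M) => -[|X].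
  rewrite /torsion_upto (upto0 (@finite_torsion_characters R A d HA n) torsion_gt0).
  by rewrite big_nil le_max lexx.
rewrite le_max; apply/orP; right; apply: le_trans (MP (X.+1 * X.+1)%N).
rewrite -pair_sumE; apply: le_trans (box_sum_le sigma X.+1).
rewrite (box_sum _ (@rpowNM R sigma)) ler_peMr //.
  by apply: sumr_ge0 => psi _; exact: rpowN_ge0.
have T1 : (setT : set A) \in ideals_upto A X.+1.
  by apply/(ideals_uptoP HA _).2; split; [exact: nzidealT|rewrite ideal_normT].
rewrite (bigD1_seq _ T1) /=; last by case: (ideals_uptoP HA X.+1).
rewrite ideal_normT rpowN1 lerDl; apply: sumr_ge0 => I _; exact: rpowN_ge0.
Qed.

Lemma torsion_cvg w : n%:R + 1 < complex.Re w -> cvgn (torsion_sum w : nat -> C^o).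
Proof.
move=> /torsion_bounded[M MP].
exact: (upto_cvg (@finite_torsion_characters R A d HA n) torsion_gt0 MP).
Qed.

(** The product of the partial sums differs from the partial sum over pairs by
    at most the tail [X < N <= X ^ 2] of a convergent series. *)
Lemma torsion_zeta w : n%:R + 1 < complex.Re w ->
  limn (torsion_sum w : nat -> C^o) * limn (zeta_sum w : nat -> C^o) =
  limn (zeta_sum (w - n%:R) : nat -> C^o).
Proof.
set sigma := complex.Re w => sn.
have n_ge0 : 0 <= n%:R :> R by [].
have cz : cvgn (zeta_sum w : nat -> C^o) by apply: zeta_cvg; rewrite -/sigma; lra.
have ct := torsion_cvg sn.
have czn : cvgn (zeta_sum (w - n%:R) : nat -> C^o).
  by apply: zeta_cvg; have [-> _] := Re_subnat w n; rewrite -/sigma; lra.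
have cp := pair_sum_cvg sn.
pose prod X : C^o := torsion_sum w X * zeta_sum w X.
have prod_cvg : prod @ \oo -->
    (limn (torsion_sum w : nat -> C^o) * limn (zeta_sum w : nat -> C^o) : C^o).
  exact: (@cvgM C _ _ _ _ _ _ _ ct cz).
have diff0 : (fun X => prod X - zeta_sum (w - n%:R) X : C^o) @ \oo --> (0 : C^o).
  apply: (@complex_squeeze _ _ _ (fun X => pair_sum sigma (X * X) - pair_sum sigma X)).
    move=> X; rewrite subr0 /prod -(box_sum _ (fun j k => @npowNM R j k w)).
    rewrite -pair_zeta_sum -(box_pairs (fun k => npowN k w)).
    rewrite (bigID (fun x => (pair_norm x <= X)%N)) /= addrAC subrr add0r.
    apply: le_trans (ler_norm_sum _ _ _) _.
    under eq_bigr => x _ do rewrite norm_npowN.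
    rewrite -rmorph_sum lecR lerBrDl; apply: le_trans (box_sum_le sigma X).
    rewrite [leRHS](bigID (fun x => (pair_norm x <= X)%N)) /= lerD2r.
    by rewrite (box_pairs (rpowN sigma)).
  rewrite -(subrr (limn (pair_sum sigma))); apply: cvgB => //.
  exact: (cvg_comp _ _ cvgn_sqr cp).
pose diff X : C^o := prod X - zeta_sum (w - n%:R) X.
have znE : (zeta_sum (w - n%:R) : nat -> C^o) = prod \- diff.
  by apply/funext => X; rewrite /diff /= subKr.
have zn_cvg : (zeta_sum (w - n%:R) : nat -> C^o) @ \oo -->
    (limn (torsion_sum w : nat -> C^o) * limn (zeta_sum w : nat -> C^o) - 0 : C^o).
  by rewrite znE; exact: cvgB prod_cvg diff0.
by rewrite (cvg_lim (@norm_hausdorff _ _) zn_cvg) subr0.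
Qed.

End ZetaLimits.

(** * Nonvanishing of the zeta function *)

Section Nonvanishing.
Variables (R : realType) (A : comNzRingType) (d : nat) (HA : integers_like A d).
Notation C := R[i].
Implicit Types (w : C) (sigma : R) (S : seq (set A)).

(** Apart from the unit ideal, the ideals that survive the sieve by all maximal
    ideals of norm at most [Y] have norm greater than [Y]. *)
Lemma sifted_sum_tail w X Y : (0 < Y)%N -> (Y <= X)%N ->
  `|sifted_sum (fun k => npowN k w) (maximal_upto A Y) X - 1| <=
  (\sum_(I <- ideals_upto A X) rpowN (complex.Re w) (ideal_norm I) -
   \sum_(I <- ideals_upto A Y) rpowN (complex.Re w) (ideal_norm I))%:C%C.
Proof.
move=> Y0 YX; set sigma := complex.Re w.
have [uX XP] := ideals_uptoP HA X.
have TX : (setT : set A) \in ideals_upto A X.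
  by apply/XP; split; [exact: nzidealT|rewrite ideal_normT (leq_trans Y0)].
have Tcop : coprime_to (maximal_upto A Y) (setT : set A).
  apply/asboolP => P /(mem_maximal_upto HA)[mP _] TP.
  by apply: (maximal_not1 mP); exact: TP.
rewrite (perm_big _ (perm_upto_filter (finite_ideals_norm HA) YX)) big_filter.
rewrite [X in (X - _)%:C%C](bigID (fun I => (ideal_norm I <= Y)%N)) /= addrAC subrr add0r.
rewrite /sifted_sum big_mkcond /= (bigD1_seq _ TX uX) /= Tcop ideal_normT npowN1.
rewrite addrAC subrr add0r; apply: le_trans (ler_norm_sum _ _ _) _.
rewrite rmorph_sum /= [leRHS]big_mkcond [leLHS]big_mkcond /=.
rewrite big_seq [leRHS]big_seq; apply: ler_sum => I /XP[nI _].
have rp0 : 0 <= (rpowN sigma (ideal_norm I))%:C%C :> C by rewrite ler0c rpowN_ge0.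
case: ifP => [IT|_]; last by case: ifP.
case: ifP => [Icop|_]; last by rewrite normr0; case: ifP.
rewrite norm_npowN; case: ifP => //; rewrite -ltnNge => /negbT/negP; case.
by apply: (coprime_maximal_upto HA nI Icop); exact/eqP.
Qed.

(** If the zeta function vanished at [w], so would all the sifted sums in the
    limit, but they tend to 1 as more maximal ideals are sieved out. *)
Lemma zeta_neq0 w : 1 < complex.Re w -> limn (zeta_sum A w : nat -> C^o) != 0.
Proof.
set sigma := complex.Re w => w1; apply/eqP => z0.
pose g k := npowN k w.
have sifted0 S : uniq S -> (forall P, P \in S -> maximal_ideal P) ->
    (sifted_sum g S : nat -> C^o) @ \oo --> (0 : C^o).
  elim: S => [|P S IHS] /=.
    move=> _ _; rewrite -z0 (_ : sifted_sum g [::] = zeta_sum A w).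
      exact: (zeta_cvg HA).
    by apply/funext => X; apply: eq_bigl => I; apply/asboolP.
  move=> /andP[PS uS] mS; have mP := mS P (mem_head _ _).
  have mS' Q : Q \in S -> maximal_ideal Q by move=> QS; apply: mS; rewrite inE QS orbT.
  have S0 := IHS uS mS'; have [nP _ _] := mP.
  have NP0 := ideal_norm_gt0 HA nP.
  have -> : sifted_sum g (P :: S) = (sifted_sum g S : nat -> C^o) \-
      (fun X => g (ideal_norm P) * sifted_sum g S (X %/ ideal_norm P)%N).
    apply/funext => X; apply: (sifted_sum_cons HA) => // j k.
    by move=> j0 k0; exact: npowNM.
  rewrite -[X in _ --> X](subr0 (0 : C^o)) -[X in _ - X](mulr0 (g (ideal_norm P))).
  apply: (cvgB S0); apply: (@cvgM C _ _ _ _ _ _ _ (cvg_cst _)).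
  exact: (cvg_comp _ _ (cvg_divnr _ NP0) S0).
pose r X : R := \sum_(I <- ideals_upto A X) rpowN sigma (ideal_norm I).
have r_nd : nondecreasing_seq r.
  move=> X Y.
  exact: (upto_nondecr (finite_ideals_norm HA) (ideal_norm_gt0 HA) (rpowN_ge0 sigma)).
have [M MP] := zeta_bounded HA w1.
have r_cvg : cvgn r.
  by apply: nondecreasing_is_cvgn => //; exists M => _ [X _ <-]; exact: MP.
have half_gt0 : 0 < 2^-1 :> R by rewrite invr_gt0.
have [Y0 _ Y0P] : \forall Y \near \oo, `|limn r - r Y| < 2^-1.
  by have /cvgrPdist_lt/(_ _ half_gt0) := r_cvg.
pose Y := maxn Y0 1; have Yr : limn r - r Y < 2^-1.
  by apply: le_lt_trans (ler_norm _) (Y0P Y _); rewrite /= leq_maxl.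
have s0 : (sifted_sum g (maximal_upto A Y) : nat -> C^o) @ \oo --> (0 : C^o).
  apply: sifted0 => [|P /(mem_maximal_upto HA)[] //].
  by rewrite filter_uniq //; case: (ideals_uptoP HA Y).
have half_gt0' : 0 < (2^-1)%:C%C :> C by rewrite ltcR.
have [X0 _ X0P] : \forall X \near \oo,
    `|0 - sifted_sum g (maximal_upto A Y) X| < (2^-1)%:C%C :> C.
  by have /cvgrPdist_lt/(_ _ half_gt0') := s0.
pose X := maxn X0 Y.
have := X0P X; rewrite /= leq_maxl sub0r normrN => /(_ isT) sX.
have Y1 : (0 < Y)%N by rewrite /Y leq_max orbT.
have := @sifted_sum_tail w X Y Y1 (leq_maxr _ _).
have rX : r X - r Y < 2^-1.
  by apply: le_lt_trans Yr; rewrite lerD2r; exact: nondecreasing_cvgn_le.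
move=> /le_lt_trans; rewrite -/sigma => /(_ (2^-1)%:C%C); rewrite ltcR => /(_ rX) tX.
set z := sifted_sum _ _ X in sX tX.
have halves : (2^-1)%:C%C + (2^-1)%:C%C = 1 :> C.
  by rewrite -rmorphD /= (_ : 2^-1 + 2^-1 = 1 :> R); last lra.
suff : (1 : C) < 1 by rewrite ltxx.
rewrite -[X in _ < X]halves; apply: le_lt_trans (ltrD sX tX).
by rewrite -{1}(normr1 C) -{1}[1 : C](subKr z 1); exact: ler_normB.
Qed.

End Nonvanishing.

(** * The representation zeta function *)

Section Conclusion.
Variables (R : realType) (A : comNzRingType) (d : nat) (HA : integers_like A d).
Variables (m n : nat) (m_gt0 : (0 < m)%N) (n_gt0 : (0 < n)%N).
Notation C := R[i].
Notation G := (Gmn m n A).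
Notation e := (e_mn m n).

Lemma dirichlet_nb_ideals (w : C) :
  dirichlet_partial (nb_ideals A) w = zeta_sum A w :> (nat -> C^o).
Proof.
apply/funext => X.
apply: (dirichlet_partial_upto (finite_ideals_norm HA) (ideal_norm_gt0 HA)) => k _.
congr nb_elements; apply/seteqP; split => I /=.
  by move=> [iI I0 Ik]; split => //; apply/nzidealP.
by move=> [/nzidealP[iI I0] Ik].
Qed.

Definition torsion_dim (psi : {ffun 'I_n -> A} -> C) := (psi_norm psi ^ e)%N.

Lemma torsion_dim_gt0 (psi : {ffun 'I_n -> A} -> C) :
  torsion_character psi -> (0 < torsion_dim psi)%N.
Proof. by move=> /(psi_norm_gt0 HA) p0; rewrite expn_gt0 p0. Qed.

Lemma torsion_dim_le (psi : {ffun 'I_n -> A} -> C) X :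
  (torsion_dim psi <= X ^ e)%N = (psi_norm psi <= X)%N.
Proof. by rewrite leq_exp2r // e_mn_gt0. Qed.

Lemma finite_torsion_dim X : finite_set
  [set psi : {ffun 'I_n -> A} -> C | torsion_character psi /\ (torsion_dim psi <= X)%N].
Proof.
apply: sub_finite_set (@finite_torsion_characters R A d HA n X) => psi [tpsi psiX].
split=> //; apply: leq_trans psiX; rewrite -{1}(expn1 (psi_norm psi)).
by rewrite leq_pexp2l ?e_mn_gt0 // (psi_norm_gt0 HA).
Qed.

Definition dim_upto X := upto (@torsion_character R A n) torsion_dim X.

Lemma dim_uptoX X : dim_upto (X ^ e) = torsion_upto R A n X.
Proof.
rewrite /dim_upto /torsion_upto /upto; congr (enum_fset (fset_set _)).
by apply/seteqP; split => psi /= [tpsi]; rewrite torsion_dim_le.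
Qed.

Lemma dirichlet_nb_twist (s : C) :
  dirichlet_partial (nb_twist_isoclasses R G) s =
  (fun X => \sum_(psi <- dim_upto X) npowN (torsion_dim psi) s) :> (nat -> C^o).
Proof.
apply/funext => X.
apply: (dirichlet_partial_upto finite_torsion_dim torsion_dim_gt0) => k k0.
have fin : finite_set [set psi : {ffun 'I_n -> A} -> C |
    torsion_character psi /\ torsion_dim psi = k].
  apply: sub_finite_set (finite_torsion_dim k) => psi [tpsi psik].
  by split; rewrite ?psik.
have [t tE] := finite_enumerates fin.
by rewrite (nb_twist_isoclassesE HA m_gt0 n_gt0 tE) (nb_elementsE tE).
Qed.

(** Grouped by dimension instead of by norm, the characters are summed in the
    same order, since the dimension is the norm to the power [e]. *)
Lemma dim_sum_torsion_sum (s : C) X :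
  \sum_(psi <- dim_upto (X ^ e)) npowN (torsion_dim psi) s =
  torsion_sum A n (s * e%:R) X.
Proof.
rewrite dim_uptoX /torsion_sum big_seq [RHS]big_seq.
apply: eq_bigr => psi /(torsion_uptoP R HA n X).2[/(psi_norm_gt0 HA) p0 _].
by rewrite npowNX.
Qed.

Lemma dirichlet_nb_twist_cvg (s : C) : n%:R + 1 < complex.Re s * e%:R ->
  cvgn (dirichlet_partial (nb_twist_isoclasses R G) s).
Proof.
move=> hs; rewrite dirichlet_nb_twist.
have [M MP] := torsion_bounded HA hs.
apply: (upto_cvg (M := M) finite_torsion_dim torsion_dim_gt0) => X.
apply: le_trans (MP X); rewrite -dim_uptoX.
apply: le_trans (upto_nondecr finite_torsion_dim torsion_dim_gt0
  (rpowN_ge0 (complex.Re s)) (_ : X <= X ^ e)%N) _.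
  by case: X => // X; rewrite -{1}(expn1 X.+1) leq_pexp2l // e_mn_gt0.
rewrite -/(dim_upto (X ^ e)) dim_uptoX big_seq [leRHS]big_seq.
apply: ler_sum => psi /(torsion_uptoP R HA n X).2[/(psi_norm_gt0 HA) p0 _].
rewrite /rpowN natrX lnXn ?ltr0n // -[ln _ *+ _]mulr_natl mulrA.
by [].
Qed.

Lemma repr_zeta_quotient (s : C) : n%:R + 1 < complex.Re s * e%:R ->
  repr_zeta G s = limn (zeta_sum A (s * e%:R - n%:R) : nat -> C^o) /
                  limn (zeta_sum A (s * e%:R) : nat -> C^o).
Proof.
move=> hs; have [ReE _] := Re_mulnat s e.
have hw : n%:R + 1 < complex.Re (s * e%:R) by rewrite ReE.
have n_ge0 : 0 <= n%:R :> R by [].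
have z0 : limn (zeta_sum A (s * e%:R) : nat -> C^o) != 0.
  by apply: (zeta_neq0 HA); lra.
rewrite -(torsion_zeta HA hw) mulfK //.
have cv := dirichlet_nb_twist_cvg hs.
rewrite /repr_zeta /dirichlet_series.
have cX : (fun X => X ^ e)%N @ \oo --> \oo.
  apply/cvgnyPge => B; exists B => // X /= BX; apply: leq_trans BX _.
  by case: X => // X; rewrite -{1}(expn1 X.+1) leq_pexp2l // e_mn_gt0.
have := cvg_comp _ _ cX cv.
rewrite {1}dirichlet_nb_twist.
rewrite (_ : _ \o _ = (torsion_sum A n (s * e%:R) : nat -> C^o)); last first.
  by apply/funext => X; exact: dim_sum_torsion_sum.
by move=> h; rewrite (cvg_lim (@norm_hausdorff _ _) h).
Qed.

End Conclusion.

Unset Implicit Arguments.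

Theorem theorem3p12 (R : realType) (K : fieldExtType rat) (m n : nat)
    (hm : (0 < m)%N) (hn : (0 < n)%N) :
  (forall k : nat, (0 < k)%N ->
     finite_set (twist_isoclasses R (Gmn m n (ring_of_integers K)) k)) /\
  (forall s : R[i],
     (n%:R : R) + 1 < complex.Re s * (e_mn m n)%:R ->
     cvgn (dirichlet_partial
       (nb_twist_isoclasses R (Gmn m n (ring_of_integers K))) s) /\
     repr_zeta (Gmn m n (ring_of_integers K)) s =
       dedekind_zeta K (s * (e_mn m n)%:R - n%:R) /
       dedekind_zeta K (s * (e_mn m n)%:R)).
Proof.
have [d HA] := integers_like_integers K.
split=> [k k_gt0|s hs]; first exact: (finite_twist_isoclasses R HA hm hn).
split; first exact: (dirichlet_nb_twist_cvg HA hm hn hs).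
rewrite (repr_zeta_quotient HA hm hn hs) /dedekind_zeta /dirichlet_series.
by rewrite !(dirichlet_nb_ideals HA).
Qed.
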